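(* Let $B$ be an $n$-dimensional Riemannian manifold, $M$ an $m$-dimensional semi-Riemannian manifold of index $r=m-n\ge2$ with constant (sectional) curvature $c$, and $\pi:(M,g)\to(B,g')$ a semi-Riemannian submersion with totally umbilic fibres. If $g\bigl(\frac{H_p}{r},\frac{H_p}{r}\bigr)\ne-c$ for all $p\in M$, then $$\frac Hr=\frac12\,\mathrm{grad}\Bigl(\ln\Bigl|c+g\Bigl(\frac Hr,\frac Hr\Bigr)\Bigr|\Bigr)$$ and $\pi$ is a Clairaut semi-Riemannian submersion.
   Context: All manifolds are smooth and connected. A semi-Riemannian submersion $\pi:(M,g)\to(B,g')$ between semi-Riemannian manifolds is a smooth surjective map such that $\pi_*$ is onto at every point, the fibres $\pi^{-1}(b)$ are semi-Riemannian (nondegenerate) submanifolds of $M$, and $\pi_*$ preserves scalar products of vectors normal to fibres. Throughout, fibres are connected and of dimension $r=\dim M-\dim B>0$. Vectors tangent to fibres are vertical, vectors normal to fibres are horizontal; $h$ is the orthogonal projection onto the horizontal part; $\nabla$ is the Levi-Civita connection of $g$. For vertical $U,V$ put $T_UV=h\nabla_UV$; with $e_1,\dots,e_r$ a local orthonormal vertical frame, $g(e_i,e_j)=\varepsilon_i\delta_{ij}$, $\varepsilon_i\in\{-1,1\}$, put $H=\sum_i\varepsilon_iT_{e_i}e_i$. The fibres are totally umbilic if $T_UV=\frac1r g(U,V)H$ for all vertical $U,V$. Curvature: $R(E,F)G=\nabla_E\nabla_FG-\nabla_F\nabla_EG-\nabla_{[E,F]}G$; constant curvature $c$ means $R(E,F)G=c\,(g(F,G)E-g(E,G)F)$.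 Clairaut submersion: let $B$ be Riemannian of dimension $n$ and $M$ of dimension $m$ and index $m-n$. For a timelike geodesic $\gamma$ in $M$ (i.e. $g(\gamma',\gamma')<0$) let $E=\gamma'$, let $V$ be the vertical part of $E$, and let $\varphi\ge0$ be the hyperbolic angle between $E$ and $V$, determined by $g(E,V)=-\|E\|\,\|V\|\cosh\varphi$, where $\|E\|^2=-g(E,E)$ and $\|V\|^2=-g(V,V)$. $\pi$ is a Clairaut semi-Riemannian submersion if there is a positive function $w:M\to\mathbb R$ such that for every timelike geodesic $\gamma$ in $M$, $w\cosh\varphi$ is constant along $\gamma$. *)

(* Defs.v *)
(* Everything is done in charts: a point
   of a chart is a row vector x in its codomain, a tangent vector at x is a row
   vector v (its coordinates), and a vector field is a function 'rV -> 'rV. *)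
From HB Require Import structures.
From mathcomp Require Import all_boot all_order all_algebra.
From mathcomp Require Import all_classical all_reals all_analysis.
From mathcomp Require Import ring.

Set Implicit Arguments.
Unset Strict Implicit.
Unset Printing Implicit Defensive.

Import Order.TTheory GRing.Theory Num.Theory.
Import numFieldNormedType.Exports.

Local Open Scope classical_set_scope.
Local Open Scope ring_scope.

(* C^k and C^oo on an open set A; in finite dimension, all directional
   derivatives exist and are C^k iff all partial derivatives do. *)
Fixpoint Ck_on (R : realType) (V W : normedModType R) (k : nat)
    (A : set V) (f : V -> W) : Prop :=
  (forall x, A x -> {for x, continuous f}) /\
  if k is k'.+1 then
    forall v, (forall x, A x -> derivable f x v) /\ Ck_on k' A ('D_v f)
  else True.

Definition smooth_on (R : realType) (V W : normedModType R) (A : set V)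
  (f : V -> W) : Prop := forall k, Ck_on k A f.

Definition cosh (R : realType) (x : R) : R := (expR x + expR (- x)) / 2.

(* ch_map and ch_inv are total functions, meaningful only on ch_dom, ch_cod. *)
Record chart (R : realType) (n : nat) (M : topologicalType) := Chart {
  ch_dom : set M;
  ch_cod : set 'rV[R]_n;
  ch_map : M -> 'rV[R]_n;
  ch_inv : 'rV[R]_n -> M;
  ch_dom_open : open ch_dom;
  ch_cod_open : open ch_cod;
  ch_map_cod : forall p, ch_dom p -> ch_cod (ch_map p);
  ch_inv_dom : forall x, ch_cod x -> ch_dom (ch_inv x);
  ch_mapK : forall p, ch_dom p -> ch_inv (ch_map p) = p;
  ch_invK : forall x, ch_cod x -> ch_map (ch_inv x) = x;
  ch_map_cont : forall p, ch_dom p -> {for p, continuous ch_map};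
  ch_inv_cont : forall x, ch_cod x -> {for x, continuous ch_inv} }.

Definition crep (R : realType) (m n : nat) (M N : topologicalType)
  (a : chart R m M) (b : chart R n N) (f : M -> N) : 'rV[R]_m -> 'rV[R]_n :=
  fun x => ch_map b (f (ch_inv a x)).

Definition crep_dom (R : realType) (m n : nat) (M N : topologicalType)
  (a : chart R m M) (b : chart R n N) (f : M -> N) : set 'rV[R]_m :=
  [set x | ch_cod a x /\ ch_dom b (f (ch_inv a x))].

Record manifold (R : realType) (n : nat) := Manifold {
  mf_space :> topologicalType;
  mf_hausdorff : hausdorff_space mf_space;
  mf_countable : @second_countable mf_space;
  mf_connected : connected [set: mf_space];
  mf_idx : Type;
  atlas : mf_idx -> chart R n mf_space;
  mf_cover : forall p, exists a, ch_dom (atlas a) p;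
  mf_smooth : forall a b, smooth_on (crep_dom (atlas a) (atlas b) id)
                                    (crep (atlas a) (atlas b) id) }.

Definition smooth_map (R : realType) (m n : nat)
  (M : manifold R m) (N : manifold R n) (f : M -> N) : Prop :=
  continuous f /\
  forall (a : mf_idx M) (b : mf_idx N),
    smooth_on (crep_dom (atlas a) (atlas b) f) (crep (atlas a) (atlas b) f).

Definition bform (R : realType) (n : nat) (G : 'M[R]_n) (u v : 'rV[R]_n) : R :=
  (u *m G *m v^T) 0 0.

(* The largest dimension of a subspace on which the form is negative definite. *)
Definition form_index (R : realType) (n : nat) (G : 'M[R]_n) (k : nat) : Prop :=
  let negdef_dim d := exists A : 'M[R]_n, \rank A = d /\
    forall v : 'rV[R]_n, (v <= A)%MS -> v != 0 -> bform G v v < 0 in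
  negdef_dim k /\ forall d, negdef_dim d -> (d <= k)%N.

(* gram a x is the matrix of the metric at the point x of the chart a. *)
Record semiRiemannian (R : realType) (n : nat) := SemiRiemannian {
  sr_mf :> manifold R n;
  gram : mf_idx sr_mf -> 'rV[R]_n -> 'M[R]_n;
  gram_smooth : forall a, smooth_on (ch_cod (atlas a)) (gram a);
  gram_sym : forall a x, ch_cod (atlas a) x -> (gram a x)^T = gram a x;
  gram_unit : forall a x, ch_cod (atlas a) x -> gram a x \in unitmx;
  gram_compat : forall a b x, crep_dom (atlas a) (atlas b) id x ->
    let f := crep (atlas a) (atlas b) id in
    forall u v, bform (gram a x) u v = bform (gram b (f x)) ('D_u f x) ('D_v f x);
  sr_index : nat;
  gram_index : forall a x, ch_cod (atlas a) x -> form_index (gram a x) sr_index }.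

Definition riemannian (R : realType) (n : nat) (B : semiRiemannian R n) : Prop :=
  forall (b : mf_idx B) y, ch_cod (atlas b) y ->
  forall v : 'rV[R]_n, v != 0 -> 0 < bform (gram b y) v v.

Section LeviCivita.
Variables (R : realType) (m : nat) (M : semiRiemannian R m).
Implicit Types (a : mf_idx M) (x u v : 'rV[R]_m).
Implicit Types (X Y Z : 'rV[R]_m -> 'rV[R]_m).

Definition met a x u v : R := bform (gram a x) u v.

Definition dgram a x (k i j : 'I_m) : R :=
  'D_(delta_mx 0 k) (fun y => gram a y i j) x.

(* christoffel a x k i j is the symbol Gamma^k_ij. *)
Definition christoffel a x (k i j : 'I_m) : R :=
  2^-1 * \sum_l invmx (gram a x) k l *
           (dgram a x i j l + dgram a x j i l - dgram a x l i j).

Definition christoffel_form a x u v : 'rV[R]_m :=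
  \row_k \sum_i \sum_j christoffel a x k i j * u 0 i * v 0 j.

(* Levi-Civita derivative at x of the field Y along the tangent vector v. *)
Definition nabla a v Y x : 'rV[R]_m :=
  'D_v Y x + christoffel_form a x v (Y x).

Definition lie_bracket X Y x : 'rV[R]_m := 'D_(X x) Y x - 'D_(Y x) X x.

Definition curv a X Y Z x : 'rV[R]_m :=
  nabla a (X x) (fun y => nabla a (Y y) Z y) x
  - nabla a (Y x) (fun y => nabla a (X y) Z y) x
  - nabla a (lie_bracket X Y x) Z x.

Definition constant_curvature (c : R) : Prop :=
  forall a (W : set 'rV[R]_m) X Y Z,
    open W -> W `<=` ch_cod (atlas a) ->
    smooth_on W X -> smooth_on W Y -> smooth_on W Z ->
  forall x, W x ->
    curv a X Y Z x = c *: (met a x (Y x) (Z x) *: X x - met a x (X x) (Z x) *: Y x).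

Definition grad a (f : 'rV[R]_m -> R) x : 'rV[R]_m :=
  (\row_k 'D_(delta_mx 0 k) f x) *m invmx (gram a x).

Lemma dgramC a x k i j : ch_cod (atlas a) x -> dgram a x k i j = dgram a x k j i.
Proof.
move=> ax; apply: near_eq_derive.
have := open_nbhs_nbhs (conj (@ch_cod_open _ _ _ (atlas a)) ax).
by apply: filterS => y /gram_sym sym; rewrite -[in LHS]sym mxE.
Qed.

Lemma christoffelC a x k i j : ch_cod (atlas a) x ->
  christoffel a x k i j = christoffel a x k j i.
Proof.
move=> ax; congr (_ * _); apply: eq_bigr => l _.
by rewrite (dgramC l i j ax) [X in _ * (X - _)]addrC.
Qed.

(* The next two lemmas characterize the Levi-Civita connection: it is torsion
   free and compatible with the metric. *)
Lemma nabla_torsion_free a X Y x : ch_cod (atlas a) x ->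
  nabla a (X x) Y x - nabla a (Y x) X x = lie_bracket X Y x.
Proof.
move=> ax; rewrite /nabla /lie_bracket opprD addrACA.
rewrite [X in _ + X](_ : _ = 0) ?addr0 //.
apply/eqP; rewrite subr_eq0; apply/eqP/rowP => k; rewrite !mxE exchange_big /=.
apply: eq_bigr => i _; apply: eq_bigr => j _.
by rewrite (christoffelC k j i ax) mulrAC.
Qed.

Lemma christoffel_metric a x k i j : ch_cod (atlas a) x ->
  dgram a x k i j =
    \sum_l (christoffel a x l k i * gram a x l j
           + christoffel a x l k j * gram a x i l).
Proof.
move=> ax.
have symg p q : gram a x p q = gram a x q p by rewrite -[in LHS]gram_sym ?mxE.
have key p q : \sum_l christoffel a x l k p * gram a x q l =
    2^-1 * (dgram a x k p q + dgram a x p k q - dgram a x q k p).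
  under eq_bigr do rewrite -mulrA.
  rewrite -mulr_sumr; congr (_ * _).
  under eq_bigr do rewrite mulr_suml.
  rewrite exchange_big /= (bigD1 q) //= [X in _ + X]big1 ?addr0 => [|s sq].
    under eq_bigr do rewrite mulrAC mulrC [_ * gram _ _ _ _]mulrC.
    rewrite -mulr_sumr; have := mulmxV (gram_unit ax) => /matrixP/(_ q q).
    by rewrite !mxE eqxx => ->; rewrite mulr1.
  under eq_bigr do rewrite mulrAC mulrC [_ * gram _ _ _ _]mulrC.
  rewrite -mulr_sumr; have := mulmxV (gram_unit ax) => /matrixP/(_ q s).
  by rewrite !mxE eq_sym (negbTE sq) => ->; rewrite mulr0.
rewrite big_split /=; under eq_bigr do rewrite symg.
rewrite !key (dgramC k j i ax) -mulrDr.
rewrite addrACA [X in _ * X](_ : _ = dgram a x k i j *+ 2).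
  by rewrite -[X in _ * X]mulr_natl mulKf ?pnatr_eq0.
rewrite mulr2n; set A := dgram a x k i j; set P := dgram a x i k j.
by set Q := dgram a x j k i; ring.
Qed.

End LeviCivita.

Section Submersion.
Variables (R : realType) (m n : nat).
Variables (M : semiRiemannian R m) (B : semiRiemannian R n) (piM : M -> B).
Implicit Types (a : mf_idx M) (b : mf_idx B) (x u v : 'rV[R]_m).

(* The fibre through x has tangent space ker pi_*. *)
Definition vertical a x v : Prop := forall b,
  ch_dom (atlas b) (piM (ch_inv (atlas a) x)) ->
  'D_v (crep (atlas a) (atlas b) piM) x = 0.

Definition horizontal a x v : Prop :=
  forall u, vertical a x u -> met a x v u = 0.

Record semiRiemannian_submersion : Prop := SemiRiemannianSubmersion {
  sub_smooth : smooth_map piM;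
  sub_surj : forall q, exists p, piM p = q;
  sub_onto : forall a b x, crep_dom (atlas a) (atlas b) piM x ->
    forall w, exists v, 'D_v (crep (atlas a) (atlas b) piM) x = w;
  sub_nondeg : forall a x, ch_cod (atlas a) x -> forall v, vertical a x v ->
    (forall u, vertical a x u -> met a x v u = 0) -> v = 0;
  sub_isom : forall a b x, crep_dom (atlas a) (atlas b) piM x ->
    let f := crep (atlas a) (atlas b) piM in
    forall u v, horizontal a x u -> horizontal a x v ->
      met b (f x) ('D_u f x) ('D_v f x) = met a x u v }.

Definition connected_fibres : Prop := forall q, connected (piM @^-1` [set q]).

Definition hpart a x v : 'rV[R]_m :=
  xget 0 [set w | horizontal a x w /\ vertical a x (v - w)].

Definition vpart a x v : 'rV[R]_m := v - hpart a x v.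

Definition vertical_field a (W : set 'rV[R]_m) (X : 'rV[R]_m -> 'rV[R]_m) :=
  smooth_on W X /\ forall x, W x -> vertical a x (X x).

Definition Ttensor a (U V : 'rV[R]_m -> 'rV[R]_m) x : 'rV[R]_m :=
  hpart a x (nabla a (U x) V x).

Definition vertical_frame a (W : set 'rV[R]_m) (r : nat)
    (e : 'I_r -> 'rV[R]_m -> 'rV[R]_m) (eps : 'I_r -> R) : Prop :=
  [/\ open W, W `<=` ch_cod (atlas a),
      forall i, eps i = 1 \/ eps i = -1,
      forall i, vertical_field a W (e i) &
      forall i j x, W x ->
        met a x (e i x) (e j x) = if i == j then eps i else 0].

(* r is the dimension of the fibres. *)
Definition mean_curvature (r : nat) a x : 'rV[R]_m :=
  xget 0 [set h | exists W (e : 'I_r -> 'rV[R]_m -> 'rV[R]_m) (eps : 'I_r -> R),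
    [/\ vertical_frame a W e eps, W x &
        h = \sum_i eps i *: Ttensor a (e i) (e i) x]].

Definition totally_umbilic_fibres (r : nat) : Prop :=
  forall a (W : set 'rV[R]_m) (U V : 'rV[R]_m -> 'rV[R]_m),
    open W -> W `<=` ch_cod (atlas a) ->
    vertical_field a W U -> vertical_field a W V ->
  forall x, W x ->
    Ttensor a U V x = r%:R^-1 *: (met a x (U x) (V x) *: mean_curvature r a x).

Definition normalized_H (r : nat) a x : 'rV[R]_m :=
  r%:R^-1 *: mean_curvature r a x.

Definition normalized_H_sq (r : nat) a x : R :=
  met a x (normalized_H r a x) (normalized_H r a x).

End Submersion.

Section Clairaut.
Variables (R : realType) (m n : nat).
Variables (M : semiRiemannian R m) (B : semiRiemannian R n) (piM : M -> B).
Implicit Types (a : mf_idx M) (x u v : 'rV[R]_m) (I : set R) (gam : R -> M).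

Definition curve_in a gam : R -> 'rV[R]_m := fun t => ch_map (atlas a) (gam t).

Definition velocity a gam t : 'rV[R]_m := derive1 (curve_in a gam) t.

(* gam is meaningful only on the open interval I. *)
Definition geodesic I gam : Prop :=
  [/\ open I, is_interval I,
      forall t, I t -> {for t, continuous gam} &
      forall a,
        let J := I `&` gam @^-1` ch_dom (atlas a) in
        smooth_on (V := R^o) J (curve_in a gam) /\
        forall t, J t ->
          derive1 (velocity a gam) t
          + christoffel_form a (curve_in a gam t)
              (velocity a gam t) (velocity a gam t) = 0].

Definition timelike I gam : Prop := forall t a,
  I t -> ch_dom (atlas a) (gam t) ->
  met a (curve_in a gam t) (velocity a gam t) (velocity a gam t) < 0.

Definition tnorm a x v : R := Num.sqrt (- met a x v v).

(* The hyperbolic angle phi >= 0 between v and its vertical part w, determined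
   by g(v, w) = - |v| |w| cosh phi. *)
Definition hangle a x v : R :=
  let w := vpart piM a x v in
  xget 0 [set phi | 0 <= phi /\
    met a x v w = - (tnorm a x v * tnorm a x w * cosh phi)].

Definition clairaut : Prop :=
  exists w : M -> R, (forall p, 0 < w p) /\
  forall I gam, geodesic I gam -> timelike I gam ->
  exists k : R, forall t a, I t -> ch_dom (atlas a) (gam t) ->
    w (gam t) * cosh (hangle a (curve_in a gam t) (velocity a gam t)) = k.

End Clairaut.

(* Main.v *)
Require Import Defs.
From HB Require Import structures.
From mathcomp Require Import all_boot all_order all_algebra.
From mathcomp Require Import all_classical all_reals all_analysis.
From mathcomp Require Import ring.

Set Implicit Arguments.
Unset Strict Implicit.
Unset Printing Implicit Defensive.

Import Order.TTheory GRing.Theory Num.Theory.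
Import numFieldNormedType.Exports.

Local Open Scope classical_set_scope.
Local Open Scope ring_scope.

(** Write [N = H / r] and [K = c + g(N, N)]. By the Gauss equation [K] is the sectional
curvature of the umbilic fibres, and the hypothesis says that it has no zeros. Both
assertions follow from the differential equation

    D_X K = 2 K g(N, X)   for every tangent vector X.                         (E)

Divided by [K], it is the gradient formula ([normalized_H_grad]). For the Clairaut
relation, let [V] be the vertical part of the velocity [E] of a timelike geodesic.
Umbilicity and the skew-symmetry of O'Neill's tensor give
[(g(V, V))' = 2 g(N, E) g(V, V)] ([D_g_vp]), and [K] satisfies the same equation by (E).
Since [g(E, E)] is constant, so is [g(V, V) / (K g(E, E))]. The fibres are negative
definite and the horizontal spaces positive definite, hence [cosh^2 phi] is
[g(V, V) / g(E, E)], and [1 / sqrt |K|] is the required function ([umbilic_clairaut]).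

Along a vertical vector both sides of (E) vanish, by the Codazzi equation
([codazzi_hor_part]); this needs [r >= 2]. For horizontal [X] put

    J X = h nabla_X N - g(N, X) N - c X,    j(X, Y) = g(J X, Y),

so that (E) becomes [j(X, N) = 0]. Let [A] be O'Neill's tensor, with [A_X U] horizontal
and [A_X Y] vertical for [X], [Y] horizontal and [U] vertical. Constant curvature yields
the following, with [U], [V], [W] vertical.
- [g(A_X V, A_Y W) + g(A_Y V, A_X W) = - (j(X, Y) + j(Y, X)) g(V, W)] ([Ah_conformal]).
- O'Neill's formula expresses [3 |A_X Y|^2] by curvatures of the base and the total
  space. For basic [X], [Y] it is therefore constant along the fibres, which is a cubic
  relation for [A] ([Av_cubic_bas]).
- Hence [j] is symmetric ([dform_sym]), which gives in turn
  [g(J X, A_Y V) = K g(A_X V, Y)] ([defect_Ah]) and a cyclic identity for [A]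
  ([Av_cyclic]).

If [s = j(N, N)] were not zero at a point, [A_N] would be a similarity from the vertical
space into the horizontal space. The form [g(A_(A_N U) A_N V, W)] is then alternating,
so the cyclic identity makes it zero, and the cubic relation for two orthogonal vertical
vectors leaves [K s g(U, U) g(V, V) = 0], which is absurd ([dform_NN]). So
[j(N, N) = 0], whence [A_N U = 0] for all vertical [U], and then [j(X, N) = 0]
([dform_N]).

This argument is algebra over the ring of smooth functions on an open set that the
submersion maps into one chart of the base. What remains is analysis: smoothness of [N],
symmetry of second derivatives, and the independence of [K] of the chart. The vector [N]
is chosen in each chart separately; it is recovered without choices from the vertical
Hessian of the submersion ([mean_hessian]). *)

(** * Umbilic submersions as algebra over the ring of functions *)

(** The scalar functions on an open set form the ring [S] and the vector fields
the module [E]; [ev x] evaluates a function at the point [x], [D] is the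
derivative along a field, [nab] the Levi-Civita connection, [vp] the
projection on the vertical distribution, [N] the normalized mean curvature, and
[bas] singles out the basic horizontal fields. The argument consists of tensor
computations, hence is algebra; points enter only where definiteness or a choice of
vertical vectors is used. *)
Section UmbilicAlgebra.
Variables (R : realFieldType) (T : Type) (S : comPzRingType) (E : lmodType S).
Variable ev : T -> S -> R.
Hypothesis evD : forall x f h, ev x (f + h) = ev x f + ev x h.
Hypothesis evM : forall x f h, ev x (f * h) = ev x f * ev x h.
Hypothesis ev_inj : forall f, (forall x, ev x f = 0) -> f = 0.
Variable g : E -> E -> S.
Hypothesis gC : forall X Y, g X Y = g Y X.
Hypothesis gDl : forall X Y Z, g (X + Y) Z = g X Z + g Y Z.
Hypothesis gZl : forall f X Z, g (f *: X) Z = f * g X Z.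
Hypothesis g_ndg : forall X, (forall Y, g X Y = 0) -> X = 0.
Variable D : E -> S -> S.
Hypothesis DDl : forall X Y f, D (X + Y) f = D X f + D Y f.
Hypothesis DD : forall X f h, D X (f + h) = D X f + D X h.
Hypothesis DM : forall X f h, D X (f * h) = D X f * h + f * D X h.
Variable nab : E -> E -> E.
Hypothesis nabDl : forall X Y Z, nab (X + Y) Z = nab X Z + nab Y Z.
Hypothesis nabZl : forall f X Z, nab (f *: X) Z = f *: nab X Z.
Hypothesis nabD : forall X Y Z, nab X (Y + Z) = nab X Y + nab X Z.
Hypothesis nabZ : forall X f Y, nab X (f *: Y) = D X f *: Y + f *: nab X Y.
Hypothesis nab_met : forall X Y Z, D X (g Y Z) = g (nab X Y) Z + g Y (nab X Z).

(** [bracket], [hor_part], [Ah], [Av], [defect] and [fibre_curv] are locked: the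
proofs rewrite with the bilinearity of [g], [nab] and [D], which has to stop at
these tensors. *)
Definition bracket X Y := locked (nab X Y - nab Y X).
Hypothesis D_bracket : forall X Y f, D (bracket X Y) f = D X (D Y f) - D Y (D X f).
Variable c : S.
Hypothesis Dc : forall X, D X c = 0.
Hypothesis curv : forall X Y Z, nab X (nab Y Z) - nab Y (nab X Z) - nab (bracket X Y) Z
  = c *: (g Y Z *: X - g X Z *: Y).
Variable vp : E -> E.
Hypothesis vpD : forall X Y, vp (X + Y) = vp X + vp Y.
Hypothesis vpZ : forall f X, vp (f *: X) = f *: vp X.
Hypothesis vpK : forall X, vp (vp X) = vp X.
Hypothesis g_vp : forall X Y, g (vp X) Y = g X (vp Y).
Definition hor X := vp X = 0.
Definition ver X := vp X = X.
Definition hor_part X := locked (X - vp X).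
Variable N : E.
Hypothesis hor_N : hor N.
Hypothesis umb : forall U V, ver U -> ver V -> hor_part (nab U V) = g U V *: N.
Variable bas : E -> Prop.
Hypothesis bas_hor : forall X, bas X -> hor X.
Hypothesis basD : forall X Y, bas X -> bas Y -> bas (X + Y).
Hypothesis basN : forall X, bas X -> bas (- X).
Hypothesis bas_bracket_ver : forall X U, bas X -> ver U -> ver (bracket U X).
Hypothesis bas_bracket : forall X Y, bas X -> bas Y -> ver (bracket X Y).
Hypothesis bas_g : forall X Y U, bas X -> bas Y -> ver U -> D U (g X Y) = 0.
Hypothesis hor_ind : forall P : E -> Prop,
  (forall X Y, P X -> P Y -> P (X + Y)) -> (forall f X, P X -> P (f *: X)) ->
  (forall X, bas X -> P X) -> forall X, hor X -> P X.
Hypothesis hor_def : forall x X Y, hor X -> hor Y -> ev x (g X X) = 0 -> ev x (g X Y) = 0.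
Hypothesis ver_def : forall x X Y, ver X -> ver Y -> ev x (g X X) = 0 -> ev x (g X Y) = 0.
Hypothesis two_dim : forall x U, ver U ->
  exists V, [/\ ver V, ev x (g U V) = 0 & ev x (g V V) != 0].

(** By the Gauss equation this is the sectional curvature of the umbilic fibres. *)
Definition fibre_curv := locked (c + g N N).
Hypothesis fibre_curv_neq0 : forall x, ev x fibre_curv != 0.

Definition mean_form X := g N X.

(** The two halves of O'Neill's integrability tensor, for horizontal [X]: the first with
[U] vertical, the second with [Y] horizontal. *)
Definition Ah X U := locked (hor_part (nab X U)).
Definition Av X Y := locked (vp (nab X Y)).

(** For horizontal [X] the scalar [g (defect X) N] is half the difference between
[D X fibre_curv] and [2 * fibre_curv * g N X], so that the differential equation of
the fibre curvature is the vanishing of [dform X N]. *)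
Definition defect X := locked (hor_part (nab X N) - mean_form X *: N - c *: X).
Definition dform X Y := g (defect X) Y.

Lemma hor_partE X : hor_part X = X - vp X. Proof. by rewrite /hor_part -lock. Qed.
Lemma fibre_curvE : fibre_curv = c + g N N. Proof. by rewrite /fibre_curv -lock. Qed.
Lemma defectE X : defect X = hor_part (nab X N) - mean_form X *: N - c *: X.
Proof. by rewrite /defect -lock. Qed.
Lemma bracketE X Y : bracket X Y = nab X Y - nab Y X. Proof. by rewrite /bracket -lock. Qed.
Lemma AhE X U : Ah X U = hor_part (nab X U). Proof. by rewrite /Ah -lock. Qed.
Lemma AvE X Y : Av X Y = vp (nab X Y). Proof. by rewrite /Av -lock. Qed.

(** Reduces a consequence of linear equations to a ring identity: the difference of
the two sides of the goal is that of a combination of the hypotheses. *)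
Lemma eq_of_sub_eq (s t l r : S) : s = t -> l - r = s - t -> l = r.
Proof. by move=> ->; rewrite subrr => /subr0_eq. Qed.

Lemma ev0 x : ev x 0 = 0.
Proof. by apply: (@addrI _ (ev x 0)); rewrite -evD !addr0. Qed.
Lemma evN x f : ev x (- f) = - ev x f.
Proof. by apply: (@addrI _ (ev x f)); rewrite -evD !subrr ev0. Qed.
Lemma evMn x f m : ev x (f *+ m) = ev x f *+ m.
Proof. by elim: m => [|m IH]; rewrite ?mulr0n ?ev0 // !mulrS evD IH. Qed.
Lemma mulrn_eq0_inj (f : S) m : f *+ m.+1 = 0 -> f = 0.
Proof.
move=> f0; apply: ev_inj => x; apply/eqP.
by have /eqP := congr1 (ev x) f0; rewrite evMn ev0 mulrn_eq0.
Qed.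

Lemma gDr X Y Z : g X (Y + Z) = g X Y + g X Z.
Proof. by rewrite gC gDl !(gC X). Qed.
Lemma gZr f X Z : g X (f *: Z) = f * g X Z.
Proof. by rewrite gC gZl gC. Qed.
Lemma g0l X : g 0 X = 0. Proof. by rewrite -(scale0r 0) gZl mul0r. Qed.
Lemma g0r X : g X 0 = 0. Proof. by rewrite gC g0l. Qed.
Lemma gNl X Y : g (- X) Y = - g X Y. Proof. by rewrite -scaleN1r gZl mulN1r. Qed.
Lemma gNr X Y : g X (- Y) = - g X Y. Proof. by rewrite gC gNl gC. Qed.
Definition gE := (gDl, gDr, gZl, gZr, gNl, gNr, g0l, g0r).

Lemma DN X f : D X (- f) = - D X f.
Proof.
apply: (@addrI _ (D X f)); rewrite -DD !subrr.
by apply: (@addrI _ (D X 0)); rewrite -DD !addr0.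
Qed.
Lemma D0 X : D X 0 = 0.
Proof. by apply: (@addrI _ (D X 0)); rewrite -DD !addr0. Qed.
Lemma D1 X : D X 1 = 0.
Proof. by apply: (@addrI _ (D X 1)); have := DM X 1 1; rewrite addr0 !mulr1 mul1r. Qed.
Lemma nabNl X Y : nab (- X) Y = - nab X Y.
Proof. by rewrite -scaleN1r nabZl scaleN1r. Qed.
Lemma nabN X Y : nab X (- Y) = - nab X Y.
Proof. by rewrite -scaleN1r nabZ DN D1 oppr0 scale0r add0r scaleN1r. Qed.
Definition nabE := (nabDl, nabD, nabZl, nabZ, nabNl, nabN).

Lemma vpN X : vp (- X) = - vp X. Proof. by rewrite -scaleN1r vpZ scaleN1r. Qed.
Lemma ver_vp X : ver (vp X). Proof. exact: vpK. Qed.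
Lemma hor_hor_part X : hor (hor_part X). Proof. by rewrite /hor hor_partE vpD vpN vpK subrr. Qed.
Lemma horD X Y : hor X -> hor Y -> hor (X + Y).
Proof. by rewrite /hor vpD => -> ->; rewrite addr0. Qed.
Lemma horZ f X : hor X -> hor (f *: X).
Proof. by rewrite /hor vpZ => ->; rewrite scaler0. Qed.
Lemma hor_opp X : hor X -> hor (- X).
Proof. by rewrite /hor vpN => ->; rewrite oppr0. Qed.
Lemma hor_vp_split X : X = hor_part X + vp X. Proof. by rewrite hor_partE subrK. Qed.
Lemma hor_Ah X U : hor (Ah X U). Proof. rewrite AhE; exact: hor_hor_part. Qed.
Lemma ver_Av X Y : ver (Av X Y). Proof. rewrite AvE; exact: ver_vp. Qed.
Lemma hor_defect X : hor X -> hor (defect X).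
Proof.
move=> hX; rewrite defectE; apply: horD; last exact/hor_opp/horZ.
by apply: horD; [exact: hor_hor_part | exact/hor_opp/horZ].
Qed.

Lemma g_hv X U : hor X -> ver U -> g X U = 0.
Proof. by move=> hX <-; rewrite -g_vp hX g0l. Qed.
Lemma g_vh X U : hor X -> ver U -> g U X = 0.
Proof. by move=> hX vU; rewrite gC g_hv. Qed.
Lemma g_hor_partl X Y : hor Y -> g (hor_part X) Y = g X Y.
Proof. by move=> hY; rewrite {2}[X]hor_vp_split gDl (g_vh hY (ver_vp X)) addr0. Qed.
Lemma g_vpl X U : ver U -> g (vp X) U = g X U.
Proof. by move=> vU; rewrite g_vp vU. Qed.
Lemma g_split X Y : g X Y = g (hor_part X) (hor_part Y) + g (vp X) (vp Y).
Proof. by rewrite (g_hor_partl _ (hor_hor_part Y)) (g_vpl _ (ver_vp Y)) -gDr -hor_vp_split. Qed.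
Lemma g_ext X Y : (forall Z, g X Z = g Y Z) -> X = Y.
Proof.
move=> e; apply/eqP; rewrite -subr_eq0; apply/eqP/g_ndg => Z.
by rewrite !gE e subrr.
Qed.
Lemma hv_ext X Y : (forall Z, hor Z -> g X Z = g Y Z) -> (forall U, ver U -> g X U = g Y U) ->
  X = Y.
Proof.
move=> eh ev'; apply/eqP; rewrite -subr_eq0; apply/eqP/g_ndg => Z.
by rewrite [Z]hor_vp_split !gE (eh _ (hor_hor_part Z)) (ev' _ (ver_vp Z)) !subrr addr0.
Qed.

Lemma g_nab_hv X Y U : hor Y -> ver U -> g (nab X Y) U = - g Y (nab X U).
Proof.
move=> hY vU; apply/eqP; rewrite -addr_eq0; apply/eqP.
by rewrite -nab_met g_hv // D0.
Qed.
Lemma g_nab_vvh U V Y : ver U -> ver V -> hor Y -> g (nab U V) Y = g U V * mean_form Y.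
Proof. by move=> vU vV hY; rewrite -g_hor_partl // umb // gZl. Qed.
Lemma g_nab_vhv U V Y : ver U -> ver V -> hor Y -> g (nab U Y) V = - (g U V * mean_form Y).
Proof. by move=> vU vV hY; rewrite g_nab_hv // gC g_nab_vvh. Qed.
Lemma ver_bracket U V : ver U -> ver V -> ver (bracket U V).
Proof.
move=> vU vV; rewrite /ver; apply/esym/eqP; rewrite -subr_eq0; apply/eqP.
have -> : bracket U V - vp (bracket U V) = hor_part (nab U V) - hor_part (nab V U).
  by apply: g_ext => Z; rewrite bracketE !hor_partE vpD vpN !gE; ring.
by rewrite !umb // gC subrr.
Qed.

(** The bracket of a basic field with a vertical one is vertical, so the horizontal
parts of the two mixed derivatives agree. *)
Lemma nab_bas X U Y : bas X -> ver U -> hor Y -> g (nab U X) Y = g (Ah X U) Y.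
Proof.
move=> bX vU hY; rewrite AhE g_hor_partl //.
by have := g_vh hY (bas_bracket_ver bX vU); rewrite bracketE !gE => /subr0_eq.
Qed.
Lemma g_Ah X U Y : hor Y -> ver U -> g (Ah X U) Y = - g (Av X Y) U.
Proof.
by move=> hY vU; rewrite AhE AvE g_hor_partl // g_vpl // (@g_nab_hv X Y U) // opprK gC.
Qed.

Lemma AvZl f X Y : Av (f *: X) Y = f *: Av X Y. Proof. by rewrite !AvE nabZl vpZ. Qed.
Lemma AvDl X X' Y : Av (X + X') Y = Av X Y + Av X' Y. Proof. by rewrite !AvE nabDl vpD. Qed.
Lemma AvZr f X Y : hor Y -> Av X (f *: Y) = f *: Av X Y.
Proof. by move=> hY; rewrite !AvE nabZ vpD !vpZ hY scaler0 add0r. Qed.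
Lemma AvDr X Y Y' : Av X (Y + Y') = Av X Y + Av X Y'. Proof. by rewrite !AvE nabD vpD. Qed.
Lemma AhZl f X Y : Ah (f *: X) Y = f *: Ah X Y.
Proof. by rewrite !AhE !hor_partE nabZl vpZ scalerBr. Qed.
Lemma AhDl X X' Y : Ah (X + X') Y = Ah X Y + Ah X' Y.
Proof. by rewrite !AhE !hor_partE nabDl vpD opprD addrACA. Qed.
Lemma AhDr X Y Y' : Ah X (Y + Y') = Ah X Y + Ah X Y'.
Proof. by rewrite !AhE !hor_partE nabD vpD opprD addrACA. Qed.
Lemma AhZr f X U : ver U -> Ah X (f *: U) = f *: Ah X U.
Proof.
move=> vU; rewrite !AhE !hor_partE nabZ vpD !vpZ vU opprD addrACA subrr add0r.
by rewrite scalerBr.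
Qed.
Lemma defectD X Y : defect (X + Y) = defect X + defect Y.
Proof. by apply: g_ext => Z; rewrite !defectE !hor_partE /mean_form nabDl vpD !gE; ring. Qed.
Lemma defectZ f X : defect (f *: X) = f *: defect X.
Proof.
rewrite !defectE !hor_partE /mean_form nabZl vpZ gZr !scalerBr !scalerA; congr (_ - _ - _ *: _).
by rewrite mulrC.
Qed.
#[local] Hint Resolve hor_Ah ver_Av ver_vp hor_hor_part hor_defect hor_N bas_hor ver_bracket
  bas_bracket bas_bracket_ver : core.
Lemma eqrD (a b1 d e : S) : a = b1 -> d = e -> a + d = b1 + e.
Proof. by move=> -> ->. Qed.
Lemma eqrB (a b1 d e : S) : a = b1 -> d = e -> a - d = b1 - e.
Proof. by move=> -> ->. Qed.
Lemma eqrM (f a b1 : S) : a = b1 -> f * a = f * b1.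
Proof. by move=> ->. Qed.

(** For basic fields [g X Y] is constant along the fibres; differentiating it along
a vertical field gives the skew-symmetry. *)
Lemma Av_skew_bas X Y : bas X -> bas Y -> Av X Y = - Av Y X.
Proof.
move=> bX bY; have hX := bas_hor bX; have hY := bas_hor bY.
apply: hv_ext => [Z hZ|U vU].
  by rewrite !gE !(g_vh hZ) ?oppr0 //; exact: ver_Av.
have := nab_met U X Y; rewrite bas_g // (nab_bas bX) // (gC X) (nab_bas bY) // !g_Ah // => e.
by rewrite gNl; apply: (eq_of_sub_eq e); ring.
Qed.

(** Identities that are linear over the functions in a horizontal argument need to
be proved for basic fields only. *)
Lemma hor_elim (P : E -> Prop) :
  (forall X Y, hor X -> hor Y -> P X -> P Y -> P (X + Y)) ->
  (forall f X, hor X -> P X -> P (f *: X)) ->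
  (forall X, bas X -> P X) -> forall X, hor X -> P X.
Proof.
move=> PD PZ Pb X hX; suff [] : hor X /\ P X by [].
move: X hX; apply: hor_ind => [X Y [hX PX] [hY PY]|f X [hX PX]|X bX].
- by split; [exact: horD | exact: PD].
- by split; [exact: horZ | exact: PZ].
- by split; [exact: bas_hor | exact: Pb].
Qed.

Lemma Av_skew X Y : hor X -> hor Y -> Av X Y = - Av Y X.
Proof.
move=> hX; move: Y; apply: hor_elim => [Y Y' _ _ e e'|f Y hY e|Y bY].
- by rewrite AvDr AvDl e e' opprD.
- by rewrite AvZr // AvZl e scalerN.
move: X hX; apply: hor_elim => [X X' _ _ e e'|f X hX e|X bX].
- by rewrite AvDr AvDl e e' opprD.
- by rewrite AvZr // AvZl e scalerN.
- exact: Av_skew_bas.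
Qed.

Lemma Av_diag X : hor X -> Av X X = 0.
Proof.
move=> hX; apply: g_ext => Z; have := congr1 (g^~ Z) (Av_skew hX hX).
rewrite g0l /= gNl => e; apply: (@mulrn_eq0_inj _ 1); rewrite mulr2n.
by rewrite {1}e addNr.
Qed.

Lemma Ah_skew X Y U : hor X -> hor Y -> ver U -> g (Ah X U) Y = - g (Ah Y U) X.
Proof. by move=> hX hY vU; rewrite !g_Ah // Av_skew // gNl. Qed.

Lemma Ah_diag X U : hor X -> ver U -> g (Ah X U) X = 0.
Proof. by move=> hX vU; rewrite g_Ah // Av_diag // g0l oppr0. Qed.

Lemma g_nabv_hor P V Y : ver V -> hor Y ->
  g P (nab V Y) = g (hor_part P) (nab V Y) - g V P * mean_form Y.
Proof.
move=> vV hY; rewrite {1}[P]hor_vp_split gDl; congr (_ + _).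
by rewrite gC g_nab_vhv ?ver_vp // -g_vp vV.
Qed.

(** The horizontal part of the curvature identity for three vertical fields: its
right-hand side is vertical, and umbilicity turns each second derivative into a
multiple of the derivative of [N]. *)
Lemma codazzi_eq U V W Y : ver U -> ver V -> ver W -> hor Y ->
  g V W * g (nab U N) Y = g U W * g (nab V N) Y.
Proof.
move=> vU vV vW hY.
have second U' V' : ver U' -> ver V' -> g (nab U' (nab V' W)) Y =
    mean_form Y * (g (nab U' V') W + g V' (nab U' W) + g U' (nab V' W)) + g V' W * g (nab U' N) Y.
  move=> vU' vV'.
  have := nab_met U' (nab V' W) Y; rewrite g_nabv_hor // umb //.
  rewrite (g_nab_vvh vV' vW hY) DM /mean_form !nab_met gZl => e.
  by apply: (eq_of_sub_eq (esym e)); ring.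
have := congr1 (g^~ Y) (curv U V W); rewrite /= !gE !second // (g_vh hY vU) (g_vh hY vV).
rewrite (g_nab_vvh (ver_bracket vU vV) vW hY) bracketE !gE => e.
by apply: (eq_of_sub_eq e); ring.
Qed.

(** Take [V] orthogonal to [U] and not null in [codazzi_eq]: a choice that needs fibres
of dimension at least two. *)
Lemma codazzi_hor_part U : ver U -> hor_part (nab U N) = 0.
Proof.
move=> vU; apply: hv_ext => [Y hY|V vV]; last by rewrite g0l (g_hv (hor_hor_part _) vV).
rewrite g0l g_hor_partl //; apply: ev_inj => x.
have [V [vV UV VV]] := two_dim x vU.
have /(congr1 (ev x)) := codazzi_eq vU vV vV hY.
by rewrite !evM UV mul0r => /eqP; rewrite mulf_eq0 (negPf VV) => /eqP.
Qed.

Lemma nab_ver_N U : ver U -> nab U N = - (g N N *: U).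
Proof.
move=> vU; rewrite [LHS]hor_vp_split codazzi_hor_part // add0r; apply: hv_ext => [Y hY|V vV].
  by rewrite !gE !(g_vh hY) ?mulr0 ?oppr0 //; exact: ver_vp.
by rewrite g_vpl // g_nab_vhv // !gE mulrC.
Qed.

Lemma g_nab_ver_N U Y : ver U -> hor Y -> g (nab U N) Y = 0.
Proof. by move=> vU hY; rewrite -g_hor_partl // codazzi_hor_part // g0l. Qed.

Lemma D_mean_form U X : bas X -> ver U -> D U (mean_form X) = g (Ah X U) N.
Proof.
move=> bX vU; have hX := bas_hor bX.
rewrite nab_met nab_ver_N // gNl gZl (g_vh hX vU) mulr0 oppr0 add0r gC.
exact: nab_bas.
Qed.

Lemma D_fibre_curv_ver U : ver U -> D U fibre_curv = 0.
Proof.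
by move=> vU; rewrite fibre_curvE DD Dc nab_met (gC N) nab_ver_N // !gE (g_vh hor_N vU); ring.
Qed.

Lemma dformE X Y : hor Y -> dform X Y = g (nab X N) Y - mean_form X * mean_form Y - c * g X Y.
Proof. by move=> hY; rewrite /dform defectE !gE g_hor_partl. Qed.

(** The horizontal part of the curvature identity for [V], [X], [W] with only [X]
horizontal. *)
Lemma nab_Ah X V W Y : bas X -> ver V -> ver W -> hor Y ->
  g (nab V (Ah X W)) Y = g (Ah X (vp (nab V W))) Y + g V W * dform X Y.
Proof.
move=> bX vV vW hY; have hX := bas_hor bX.
have := congr1 (g^~ Y) (curv V X W); rewrite /= !gE.
rewrite (g_vh hY vV) (g_hv hX vW) (g_nab_vvh (bas_bracket_ver bX vV) vW hY) bracketE !gE.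
rewrite {1}[nab X W]hor_vp_split nabD -AhE gDl (g_nab_vvh vV (ver_vp _) hY) (gC V)
  g_vpl // (gC _ V).
rewrite {1}[nab V W]hor_vp_split nabD umb // nabZ !gE nab_met -(g_hor_partl (nab X (vp _)) hY)
  -AhE.
rewrite (g_nab_vhv vV vW hX) (dformE _ hY) /mean_form => e.
by apply: (eq_of_sub_eq e); ring.
Qed.

(** The same for [U], [X], [N]: vertical derivatives of [defect] give back [Ah]. *)
Lemma nab_defect X U Y : bas X -> ver U -> hor Y ->
  g (nab U (defect X)) Y = - (fibre_curv * g (Ah X U) Y).
Proof.
move=> bX vU hY; have hX := bas_hor bX.
have vbr := bas_bracket_ver bX vU.
have := congr1 (g^~ Y) (curv U X N); rewrite /= !gE (g_vh hor_N vU).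
rewrite (g_vh hY vU) (nab_ver_N vbr) !gE (g_vh hY vbr).
rewrite [nab X N]hor_vp_split nabD gDl (g_nab_vvh vU (ver_vp _) hY) (gC U) g_vpl //.
rewrite (nab_ver_N vU) nabN nabZ !gE (g_vh hY vU) -(g_hor_partl (nab X U) hY) -!AhE.
rewrite (@g_nab_hv X N U) // => e.
rewrite defectE !nabE !gE -AhE -/(mean_form X) (D_mean_form bX) // g_nab_ver_N //.
rewrite (nab_bas bX) // Dc fibre_curvE.
rewrite (gC N (nab X U)) -(g_hor_partl (nab X U) hor_N) -!AhE in e.
by rewrite /mean_form in e *; apply: (eq_of_sub_eq e); ring.
Qed.

(** The vertical derivative of the skew-symmetry of [Ah]. For [X = Y] it says that
[Ah X] is conformal, with factor [- dform X X]. *)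
Lemma Ah_conformal X Y V W : hor X -> hor Y -> ver V -> ver W ->
  g (Ah X V) (Ah Y W) + g (Ah Y V) (Ah X W) = - ((dform X Y + dform Y X) * g V W).
Proof.
move=> hX hY vV vW; move: X hX.
apply: hor_elim => [X X' _ _ e e'|f X hX e|X bX].
- by rewrite !AhDl /dform defectD !gE; apply: (eq_of_sub_eq (eqrD e e')); rewrite /dform; ring.
- by rewrite !AhZl /dform defectZ !gE; apply: (eq_of_sub_eq (eqrM f e)); rewrite /dform; ring.
move: Y hY; apply: hor_elim => [X' Y _ _ e e'|f Y hY e|Y bY].
- by rewrite !AhDl /dform defectD !gE; apply: (eq_of_sub_eq (eqrD e e')); rewrite /dform; ring.
- by rewrite !AhZl /dform defectZ !gE; apply: (eq_of_sub_eq (eqrM f e)); rewrite /dform; ring.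
have hX := bas_hor bX; have hY := bas_hor bY.
have := congr1 (D V) (Ah_skew hX hY vW); rewrite DN !nab_met !nab_Ah //.
rewrite (gC (Ah X W)) (gC (Ah Y W)) !nab_bas // (Ah_skew hX hY (ver_vp _)) (gC _ (Ah Y W)) => e.
by apply: (eq_of_sub_eq e); ring.
Qed.

(** Differentiate [Ah_conformal] along [U]; choosing the vertical argument orthogonal
to [U], only the derivative of the factor survives. *)
Lemma D_dform_sym U X Y : bas X -> bas Y -> ver U -> D U (dform X Y + dform Y X) = 0.
Proof.
move=> bX bY vU; apply: ev_inj => x.
have hX := bas_hor bX; have hY := bas_hor bY.
have [V [vV UV VV]] := two_dim x vU.
have := congr1 (D U) (Ah_conformal hX hY vV vV).
rewrite DN DM DD !nab_met.
rewrite -(g_hor_partl (nab U (Ah X V))) // -(g_hor_partl (nab U (Ah Y V))) //.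
have nb Z Z' : bas Z -> hor Z' -> g (nab U (Ah Z V)) Z' =
    g (Ah Z (vp (nab U V))) Z' + g U V * dform Z Z' by move=> ? ?; exact: nab_Ah.
rewrite !g_hor_partl // (gC _ (nab U (Ah Y V))) (gC _ (nab U (Ah X V))) !nb //.
have := Ah_conformal hX hY (ver_vp (nab U V)) vV; rewrite (g_vpl _ vV) (gC V) => e1 e2.
have {e1 e2} e : D U (dform X Y + dform Y X) * g V V =
   g U V * (- (dform X (Ah Y V) + dform Y (Ah X V)) *+ 2).
  apply: (eq_of_sub_eq (eqrB e2 (eqrD e1 e1))); ring.
have /eqP := congr1 (ev x) e; rewrite !evM UV mul0r mulf_eq0 (negPf VV) orbF.
by move/eqP.
Qed.

Lemma defect_Ah_diag U X : bas X -> ver U -> g (defect X) (Ah X U) = 0.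
Proof.
move=> bX vU; have hX := bas_hor bX.
have : D U (dform X X) = 0.
  by have := D_dform_sym bX bX vU; rewrite DD -mulr2n => /mulrn_eq0_inj.
rewrite nab_met nab_defect // Ah_diag // mulr0 oppr0 add0r gC.
by rewrite (nab_bas bX) // 1?gC //; exact: hor_defect.
Qed.

Lemma defect_sq U W X : bas X -> ver U -> ver W ->
  g U W * g (defect X) (defect X) =
    fibre_curv * g (Ah X U) (Ah X W) - g (defect X) (Ah X (vp (nab U W))).
Proof.
move=> bX vU vW; have hX := bas_hor bX; have hJ := hor_defect hX.
have := congr1 (D U) (defect_Ah_diag bX vW); rewrite D0 nab_met nab_defect //.
rewrite (gC (defect X) (nab _ _)) nab_Ah // /dform (gC (defect X) (Ah X (vp _))) => e.
by apply: (eq_of_sub_eq e); ring.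
Qed.

Lemma D_D_bas U X f : bas X -> ver U -> (forall V, ver V -> D V f = 0) -> D U (D X f) = 0.
Proof.
move=> bX vU f0; have := D_bracket U X f.
by rewrite (f0 _ (bas_bracket_ver bX vU)) (f0 _ vU) D0 subr0.
Qed.

Lemma g_nab_bas_sym X Y Z : bas X -> bas Y -> hor Z -> g (nab X Y) Z = g (nab Y X) Z.
Proof.
move=> bX bY hZ; have := g_vh hZ (bas_bracket bX bY).
by rewrite bracketE !gE => /subr0_eq.
Qed.

(** Brackets of basic fields are vertical and drop out of Koszul's formula. By [D_D_bas]
what remains is constant along the fibres: the horizontal part of the connection comes
from the base. *)
Lemma koszul_bas X Y Z : bas X -> bas Y -> bas Z ->
  g (nab X Y) Z *+ 2 = D X (g Y Z) + D Y (g X Z) - D Z (g X Y).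
Proof.
move=> bX bY bZ; rewrite !nab_met.
have hX := bas_hor bX; have hY := bas_hor bY; have hZ := bas_hor bZ.
rewrite (g_nab_bas_sym bY bX) // (gC Y (nab X Z)) (gC X (nab Y Z)) (gC X (nab Z Y)).
rewrite (g_nab_bas_sym bX bZ) // (g_nab_bas_sym bY bZ) //.
ring.
Qed.

Lemma D_g_nab_bas U X Y Z : bas X -> bas Y -> bas Z -> ver U -> D U (g (nab X Y) Z) = 0.
Proof.
move=> bX bY bZ vU; apply: (@mulrn_eq0_inj _ 1); rewrite mulr2n -DD -mulr2n koszul_bas //.
by rewrite !DD DN !D_D_bas ?oppr0 ?addr0 // => V vV; exact: bas_g.
Qed.

Lemma D_nab_nab U X Y X' Y' : bas X -> bas Y -> bas X' -> bas Y' -> ver U ->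
  D U (g (hor_part (nab X Y)) (hor_part (nab X' Y'))) = 0.
Proof.
move=> bX bY bX' bY' vU.
have key Z Z' W : bas Z -> bas Z' -> hor W ->
    g (nab U (hor_part (nab Z Z'))) W = g (Ah (hor_part (nab Z Z')) U) W.
  move=> bZ bZ'; move: W; apply: hor_ind => [W W' e e'|f W e|W bW].
  - by rewrite !gDr e e'.
  - by rewrite !gZr e.
  have hW := bas_hor bW; have := D_g_nab_bas bZ bZ' bW vU.
  rewrite -(g_hor_partl _ hW) nab_met (gC _ (nab U W)) (nab_bas bW) // (Ah_skew hW) // => /eqP.
  by rewrite subr_eq0 => /eqP.
rewrite nab_met key // (gC (hor_part (nab X Y))) key // Ah_skew //.
by rewrite addrC subrr.
Qed.

(** O'Neill's formula: [3 * |Av X Y|^2] is the difference of the sectional curvatures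
of the base and of the total space on the plane of [X] and [Y], and both are constant
along the fibres. *)
Lemma D_Av_sq U X Y : bas X -> bas Y -> ver U -> D U (g (Av X Y) (Av X Y)) = 0.
Proof.
move=> bX bY vU; have hX := bas_hor bX; have hY := bas_hor bY.
have brA : bracket X Y = Av X Y + Av X Y.
  rewrite -(bas_bracket bX bY) bracketE vpD vpN -!AvE; congr (_ + _).
  by rewrite (Av_skew hY hX) opprK.
have := congr1 (g^~ X) (curv X Y Y); rewrite /= brA nabDl !gE.
have e1 := nab_met X (nab Y Y) X; have e2 := nab_met Y (nab X Y) X.
rewrite (g_split (nab Y Y) (nab X X)) -!AvE Av_diag // g0l addr0 in e1.
rewrite (g_split (nab X Y) (nab Y X)) -!AvE (Av_skew hY hX) gNr in e2.
rewrite (nab_bas bY) // g_Ah // (Av_skew hY hX) gNl opprK => e3.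
have e4 : g (Av X Y) (Av X Y) *+ 3 = D X (g (nab Y Y) X)
  - g (hor_part (nab Y Y)) (hor_part (nab X X))
  - D Y (g (nab X Y) X) + g (hor_part (nab X Y)) (hor_part (nab Y X))
  - c * (g Y Y * g X X - g X Y * g Y X).
  by apply: (eq_of_sub_eq (eqrB (eqrB e2 e1) e3)); ring.
apply: (@mulrn_eq0_inj _ 2); move: (congr1 (D U) e4).
rewrite !mulrS mulr0n !(DD, DN) D0 => ->.
rewrite !DM Dc !(DD, DN, DM) (bas_g bX bX) // (bas_g bY bY) // (bas_g bX bY) // (bas_g bY bX) //.
rewrite !D_nab_nab // !D_D_bas //; try by move=> V vV; exact: D_g_nab_bas.
by ring.
Qed.

(** The derivative of [|Av X Y|^2] along [U], rewritten with [nab_Ah]. *)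
Lemma Av_cubic_bas X Y U : bas X -> bas Y -> ver U ->
  g (Ah X (Av X Y)) (Ah Y U) + dform X Y * g U (Av X Y) = 0.
Proof.
move=> bX bY vU; have hX := bas_hor bX; have hY := bas_hor bY.
have vA := ver_Av X Y.
have e1 := D_Av_sq bX bY vU; rewrite nab_met (gC (Av X Y) (nab _ _)) in e1.
have := congr1 (D U) (g_Ah X hY vA); rewrite DN !nab_met nab_Ah // (gC (Ah X _) (nab _ _)).
rewrite (nab_bas bY) // g_Ah // (gC (Av X Y) (nab U (Av X Y))) (gC (Av X Y) (vp _)) (g_vpl _ vA).
rewrite (gC (Ah Y U)) => e2.
apply: (@mulrn_eq0_inj _ 1); apply: (eq_of_sub_eq (eqrB (eqrM 2%:R e2) e1)); ring.
Qed.

(** Compare [Av_cubic_bas] for [U = Av X Y] with [Ah_conformal]. *)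
Lemma dform_skew_Av X Y : bas X -> bas Y -> (dform X Y - dform Y X) * g (Av X Y) (Av X Y) = 0.
Proof.
move=> bX bY; have hX := bas_hor bX; have hY := bas_hor bY.
have vA := ver_Av X Y.
have e1 := Av_cubic_bas bX bY vA; have := Ah_conformal hX hY vA vA.
rewrite (gC (Ah Y _)) => e2.
by apply: (eq_of_sub_eq (eqrB (eqrM 2%:R e1) e2)); ring.
Qed.

Lemma dformDl X X' Y : dform (X + X') Y = dform X Y + dform X' Y.
Proof. by rewrite /dform defectD gDl. Qed.
Lemma dformDr X Y Y' : dform X (Y + Y') = dform X Y + dform X Y'.
Proof. by rewrite /dform gDr. Qed.
Lemma dformZl f X Y : dform (f *: X) Y = f * dform X Y. Proof. by rewrite /dform defectZ gZl. Qed.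
Lemma dformZr f X Y : dform X (f *: Y) = f * dform X Y. Proof. by rewrite /dform gZr. Qed.
Lemma dformNl X Y : dform (- X) Y = - dform X Y. Proof. by rewrite -scaleN1r dformZl mulN1r. Qed.
Lemma dformNr X Y : dform X (- Y) = - dform X Y. Proof. by rewrite -scaleN1r dformZr mulN1r. Qed.
Lemma AvNl X Y : Av (- X) Y = - Av X Y. Proof. by rewrite -scaleN1r AvZl scaleN1r. Qed.

(** By [dform_skew_Av] the skew part [al] of [dform] and the tensor [Av] cannot both be
nonzero on the same pair of basic fields. If [al X Y] is nonzero at [x], varying one
field of the pair at a time forces [Av] to vanish at [x]; then so does [Ah], and
[defect_sq] makes [defect] vanish at [x], whence [al X Y = 0] after all. *)
Lemma dform_sym_bas X Y : bas X -> bas Y -> dform X Y = dform Y X.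
Proof.
move=> bX bY; apply/subr0_eq/ev_inj => x.
pose al Z Z' := ev x (dform Z Z' - dform Z' Z).
have alDl Z Z' W : al (Z + Z') W = al Z W + al Z' W.
  by rewrite /al -evD; congr (ev x _); rewrite dformDl dformDr; ring.
have alNl Z W : al (- Z) W = - al Z W.
  by rewrite /al dformNl dformNr -evN; congr (ev x _); ring.
have alC Z W : al Z W = - al W Z.
  by rewrite /al -evN opprB.
have Avan Z Z' U : bas Z -> bas Z' -> al Z Z' != 0 -> ver U -> ev x (g (Av Z Z') U) = 0.
  move=> bZ bZ' nz vU; apply: ver_def => //.
  have /(congr1 (ev x))/eqP := dform_skew_Av bZ bZ'.
  by rewrite evM ev0 mulf_eq0 -/(al Z Z') (negPf nz) => /eqP.
have Avan1 Z Z' W U : bas Z -> bas Z' -> bas W -> al Z W != 0 -> ver U ->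
    ev x (g (Av Z' W) U) = 0.
  move=> bZ bZ' bW nz vU.
  have e0 := Avan _ _ _ bZ bW nz vU.
  have [z|z] := eqVneq (al (Z + Z') W) 0; last first.
    have := Avan _ _ _ (basD bZ bZ') bW z vU.
    by rewrite AvDl gDl evD e0 add0r.
  have z' : al (Z - Z') W != 0.
    apply: contra_neq nz => z'; have := f_equal2 +%R z z'.
    by rewrite !alDl alNl addrACA subrr !addr0 -mulr2n => /eqP; rewrite mulrn_eq0 => /eqP.
  have := Avan _ _ _ (basD bZ (basN bZ')) bW z' vU.
  by rewrite AvDl AvNl gDl gNl evD evN e0 add0r => /eqP; rewrite oppr_eq0 => /eqP.
have [//|nz] := eqVneq (al X Y) 0.
have A0 Z Z' U : bas Z -> bas Z' -> ver U -> ev x (g (Av Z Z') U) = 0.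
  move=> bZ bZ' vU.
  have [z|z] := eqVneq (al Z' X) 0; last first.
    have nz1 : al X Z' != 0 by rewrite alC oppr_eq0.
    exact: Avan1 bX bZ bZ' nz1 vU.
  have z' : al X (Y + Z') != 0 by rewrite alC alDl z addr0 -alC.
  have e1 := Avan1 _ _ _ _ bX bZ (basD bY bZ') z' vU.
  have e2 := Avan1 _ _ _ _ bX bZ bY nz vU.
  by move: e1; rewrite AvDr gDl evD e2 add0r.
have b0 Z U Y' : bas Z -> ver U -> hor Y' -> ev x (g (Ah Z U) Y') = 0.
  move=> bZ vU; move: Y'; apply: hor_ind => [W W' e e'|f W e|W bW].
  - by rewrite gDr evD e e' addr0.
  - by rewrite gZr evM e mulr0.
  - by rewrite g_Ah // ?evN ?A0 ?oppr0 //; exact: bas_hor.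
have J0 Z Y' : bas Z -> hor Y' -> ev x (dform Z Y') = 0.
  move=> bZ hY'; have hZ := bas_hor bZ; apply: hor_def => //; first exact: hor_defect.
  have [U [vU _ UU]] := two_dim x (ver_vp X).
  have /(congr1 (ev x)) := defect_sq bZ vU vU.
  rewrite evD evN !evM (gC (defect Z) (Ah _ _)) !b0 //; last exact: hor_defect.
  by rewrite mulr0 subr0 => /eqP; rewrite mulf_eq0 (negPf UU) => /eqP.
by rewrite evD evN !J0 ?subrr //; exact: bas_hor.
Qed.

Lemma dform_sym X Y : hor X -> hor Y -> dform X Y = dform Y X.
Proof.
move=> hX hY; move: X hX; apply: hor_ind => [X X' e e'|f X e|X bX].
- by rewrite dformDl dformDr e e'.
- by rewrite dformZl dformZr e.
move: Y hY; apply: hor_ind => [Y Y' e e'|f Y e|Y bY].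
- by rewrite dformDl dformDr e e'.
- by rewrite dformZl dformZr e.
exact: dform_sym_bas.
Qed.

(** The vertical derivative of [dform X Y], which vanishes by [D_dform_sym] and the
symmetry of [dform]. *)
Lemma defect_Ah X Y V : hor X -> hor Y -> ver V ->
  g (defect X) (Ah Y V) = fibre_curv * g (Ah X V) Y.
Proof.
move=> hX hY vV; move: X hX; apply: hor_elim => [X X' _ _ e e'|f X _ e|X bX].
- by rewrite defectD AhDl !gE e e' mulrDr.
- by rewrite defectZ AhZl !gE e mulrCA.
move: Y hY; apply: hor_elim => [Y Y' _ _ e e'|f Y _ e|Y bY].
- by rewrite AhDl !gE e e' mulrDr.
- by rewrite AhZl !gE e mulrCA.
have hX := bas_hor bX; have hY := bas_hor bY; have hJ := hor_defect hX.
have := D_dform_sym bX bY vV; rewrite (dform_sym hY hX) DD -mulr2n => /mulrn_eq0_inj.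
rewrite nab_met nab_defect // (gC (defect X)) (nab_bas bY) // (gC (Ah Y V)) => e.
by apply: (eq_of_sub_eq e); ring.
Qed.

(** The symmetry of [dform] says that [mean_form] is closed on basic fields; summing
the commutators of its second derivatives cyclically gives a Bianchi-type
identity. *)
Lemma Av_cyclic X Y Z : hor X -> hor Y -> hor Z ->
  g (Av N Z) (Av X Y) + g (Av N X) (Av Y Z) + g (Av N Y) (Av Z X) = 0.
Proof.
move=> hX hY hZ; move: X hX; apply: hor_elim => [X X' hX hX' e e'|f X hX e|X bX].
- by rewrite !(AvDl, AvDr) !gE; apply: (eq_of_sub_eq (eqrD e e')); ring.
- by rewrite !AvZl !AvZr // !gE; apply: (eq_of_sub_eq (eqrM f e)); ring.
move: Y hY; apply: hor_elim => [Y Y' hY hY' e e'|f Y hY e|Y bY].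
- by rewrite !(AvDl, AvDr) !gE; apply: (eq_of_sub_eq (eqrD e e')); ring.
- by rewrite !AvZl !AvZr // !gE; apply: (eq_of_sub_eq (eqrM f e)); ring.
move: Z hZ; apply: hor_elim => [Z Z' hZ hZ' e e'|f Z hZ e|Z bZ].
- by rewrite !(AvDl, AvDr) !gE; apply: (eq_of_sub_eq (eqrD e e')); ring.
- by rewrite !AvZl !AvZr // !gE; apply: (eq_of_sub_eq (eqrM f e)); ring.
have clos X1 Y1 : bas X1 -> bas Y1 -> D X1 (mean_form Y1) = D Y1 (mean_form X1).
  move=> bX1 bY1; have := dform_sym_bas bX1 bY1; rewrite !dformE;
    [|exact: bas_hor|exact: bas_hor].
  rewrite !nab_met (gC N (nab X1 _)) (gC N (nab Y1 _)) (g_nab_bas_sym bX1 bY1 hor_N) (gC Y1) => e.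
  by apply: (eq_of_sub_eq e); ring.
have comm X1 Y1 Z1 : bas X1 -> bas Y1 -> bas Z1 ->
    D X1 (D Y1 (mean_form Z1)) - D Y1 (D X1 (mean_form Z1)) = g (Av N Z1) (Av X1 Y1) *+ 2.
  move=> bX1 bY1 bZ1; have vb := bas_bracket bX1 bY1.
  have [hX1 [hY1 hZ1]] := (bas_hor bX1, (bas_hor bY1, bas_hor bZ1)).
  rewrite -D_bracket D_mean_form // Ah_skew // g_Ah // opprK -vb bracketE vpD vpN -!AvE.
  by rewrite (Av_skew hY1 hX1) opprK gDr mulr2n.
apply: (@mulrn_eq0_inj _ 1); rewrite !mulrnDl -!comm //.
rewrite (clos X Z) // (clos Y Z) // (clos X Y) //.
by ring.
Qed.

(** The full polarization of [Av_cubic_bas]. The quadratic identity holds for basic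
fields only; its polarization is linear over the functions in every argument and so
extends to all horizontal fields. *)
Definition cubic_form X X' Y Y' U :=
  g (Ah X (Av X' Y)) (Ah Y' U) + g (Ah X (Av X' Y')) (Ah Y U)
  + g (Ah X' (Av X Y)) (Ah Y' U) + g (Ah X' (Av X Y')) (Ah Y U)
  + dform X Y * g U (Av X' Y') + dform X Y' * g U (Av X' Y)
  + dform X' Y * g U (Av X Y') + dform X' Y' * g U (Av X Y).

Lemma cubic_form_bas X X' Y Y' U : bas X -> bas X' -> bas Y -> bas Y' -> ver U ->
  cubic_form X X' Y Y' U = 0.
Proof.
move=> bX bX' bY bY' vU.
have e1 Z W : bas Z -> bas W -> g (Ah Z (Av Z W)) (Ah W U) + dform Z W * g U (Av Z W) = 0.
  by move=> bZ bW; exact: Av_cubic_bas.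
have [bXX bYY] := (basD bX bX', basD bY bY').
have := eqrD (e1 _ _ bXX bYY) (eqrD (eqrD (e1 _ _ bX bY) (e1 _ _ bX bY')) (eqrD (e1 _ _ bX' bY)
  (e1 _ _ bX' bY'))).
have e2 := eqrD (eqrD (e1 _ _ bXX bY) (e1 _ _ bXX bY')) (eqrD (e1 _ _ bX bYY) (e1 _ _ bX' bYY)).
move=> e3; have := eqrB e3 e2.
rewrite !(AvDl, AvDr, AhDl, AhDr, dformDl, dformDr, gDl, gDr) => e.
by rewrite /cubic_form; apply: (eq_of_sub_eq e); ring.
Qed.

Lemma cubic_form0 X X' Y Y' U : hor X -> hor X' -> hor Y -> hor Y' -> ver U ->
  cubic_form X X' Y Y' U = 0.
Proof.
move=> hX hX' hY hY' vU; rewrite /cubic_form.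
move: X hX; apply: hor_elim => [X1 X2 hX1 hX2 e e'|f X hX e|X bX].
- by rewrite !(AvDl, AvDr, AhDl, AhDr, dformDl, dformDr, gDl, gDr);
  apply: (eq_of_sub_eq (eqrD e e')); ring.
- by rewrite !(AvZl, AhZl, dformZl) !AhZr // !gE; apply: (eq_of_sub_eq (eqrM f e)); ring.
move: X' hX'; apply: hor_elim => [X1 X2 hX1 hX2 e e'|f X' hX' e|X' bX'].
- by rewrite !(AvDl, AvDr, AhDl, AhDr, dformDl, dformDr, gDl, gDr);
  apply: (eq_of_sub_eq (eqrD e e')); ring.
- by rewrite !(AvZl, AhZl, dformZl) !AhZr // !gE; apply: (eq_of_sub_eq (eqrM f e)); ring.
move: Y hY; apply: hor_elim => [X1 X2 hX1 hX2 e e'|f Y hY e|Y bY].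
- by rewrite !(AvDl, AvDr, AhDl, AhDr, dformDl, dformDr, gDl, gDr);
  apply: (eq_of_sub_eq (eqrD e e')); ring.
- by rewrite !AvZr // !(AhZl, dformZr) !AhZr // !gE; apply: (eq_of_sub_eq (eqrM f e)); ring.
move: Y' hY'; apply: hor_elim => [X1 X2 hX1 hX2 e e'|f Y' hY' e|Y' bY'].
- by rewrite !(AvDl, AvDr, AhDl, AhDr, dformDl, dformDr, gDl, gDr);
  apply: (eq_of_sub_eq (eqrD e e')); ring.
- by rewrite !AvZr // !(AhZl, dformZr) !AhZr // !gE; apply: (eq_of_sub_eq (eqrM f e)); ring.
exact: cubic_form_bas.
Qed.

Lemma Av_cubic X X' Y U : hor X -> hor X' -> hor Y -> ver U ->
  g (Ah X (Av X' Y)) (Ah Y U) + g (Ah X' (Av X Y)) (Ah Y U)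
  + dform X Y * g U (Av X' Y) + dform X' Y * g U (Av X Y) = 0.
Proof.
move=> hX hX' hY vU; apply: (@mulrn_eq0_inj _ 1).
by have e := cubic_form0 hX hX' hY hY vU; apply: (eq_of_sub_eq e); rewrite /cubic_form; ring.
Qed.

Lemma dform_N_Ah X V : hor X -> ver V -> dform (Ah N V) X = - (fibre_curv * g (Ah N V) X).
Proof.
move=> hX vV; rewrite dform_sym // /dform defect_Ah // Ah_skew // mulrN //.
Qed.

(** Assume that [sigma := dform N N] does not vanish at [x]. Then [Ah N] is a similarity
with factor [- sigma] from vertical to horizontal vectors, inverted up to [sigma] by
[Av N]. The trilinear form [th] is skew in its first two arguments by [Av_skew] and in
the last two by [Ah_conformal], so [Av_cyclic] becomes [3 sigma th = 0]. Feeding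
[th = 0] into [Av_cubic] with two orthogonal vertical fields [U] and [V] leaves
[fibre_curv * sigma * g U U * g V V = 0] at [x], which is absurd. *)
Lemma dform_NN : dform N N = 0.
Proof.
apply: ev_inj => x; apply/eqP; apply: contraT => sigma_neq0.
have [U [vU _ UU]] := two_dim x (ver_vp 0).
have [V [vV UV VV]] := two_dim x vU.
have two_inj (s t : S) : s *+ 2 = t *+ 2 -> s = t.
  by move=> e; apply/subr0_eq/(@mulrn_eq0_inj _ 1); rewrite mulrnBl e subrr.
have conf W W' : ver W -> ver W' -> g (Ah N W) (Ah N W') = - (dform N N * g W W').
  move=> vW vW'; apply: two_inj; have := Ah_conformal hor_N hor_N vW vW' => e.
  by apply: (eq_of_sub_eq e); ring.
have ANb W : ver W -> Av N (Ah N W) = dform N N *: W.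
  move=> vW; apply: hv_ext => [Z hZ|W' vW'].
    by rewrite gZl !(g_vh hZ) ?mulr0.
  have := g_Ah N (hor_Ah N W) vW'; rewrite conf // (gC W') => /oppr_inj <-.
  by rewrite gZl.
pose th W W' W2 := g (Av (Ah N W) (Ah N W')) W2.
have th12 W W' W2 : th W W' W2 = - th W' W W2.
  by rewrite /th Av_skew // gNl.
have th23 W W' W2 : ver W -> ver W' -> ver W2 -> th W W' W2 = - th W W2 W'.
  move=> vW vW' vW2; have := Ah_conformal hor_N (hor_Ah N W) vW' vW2.
  rewrite (dform_sym hor_N) // dform_N_Ah // (Ah_diag hor_N vW) mulr0 oppr0 addr0 mul0r oppr0.
  rewrite (gC (Ah N W')) !g_Ah // /th => e.
  by apply: (eq_of_sub_eq (esym e)); ring.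
have th0 W W' W2 : ver W -> ver W' -> ver W2 -> ev x (th W W' W2) = 0.
  move=> vW vW' vW2; have := Av_cyclic (hor_Ah N W) (hor_Ah N W') (hor_Ah N W2).
  rewrite !ANb // !gZl (gC W2) (gC W) (gC W') -!/(th _ _ _).
  rewrite (th23 W' W2 W) // (th12 W' W W2) (th12 W2 W W') (th23 W W2 W') // !opprK => e.
  have {e} : (dform N N * th W W' W2) *+ 3 = 0 by rewrite -[RHS]e; ring.
  move=> /mulrn_eq0_inj /(congr1 (ev x)) /eqP.
  by rewrite evM ev0 mulf_eq0 (negPf sigma_neq0) => /eqP.
set X := Ah N V; set Y := Ah N U.
have [hX hY] : hor X /\ hor Y by split; exact: hor_Ah.
have jXY : ev x (dform X Y) = 0.
  by rewrite dform_N_Ah // conf // !(evN, evM) (gC V) UV !mulr0 oppr0 mulr0 oppr0.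
have jNY : dform N Y = 0 by rewrite dform_sym // dform_N_Ah // Ah_diag // mulr0 oppr0.
have gAXY Z : hor Z -> ev x (g (Ah N (Av X Y)) Z) = 0.
  move=> hZ; rewrite g_Ah // gC evN (th0 V U) ?oppr0 //.
have := congr1 (ev x) (Av_cubic hX hor_N hY vV).
rewrite ANb // gZr (AhZr _ _ vU) gZl !evD (gAXY _ (hor_Ah Y V)) !evM jXY jNY ev0 mul0r.
rewrite mul0r !addr0 => /eqP; rewrite mulf_eq0 (negPf sigma_neq0) /= => /eqP bb0.
have hZ := hor_Ah Y V.
have := congr1 (ev x) (Ah_conformal hor_N hZ vU vV); rewrite -/X -/Y.
rewrite (gC Y) (Ah_skew hZ hY) // (Ah_skew hZ hX) // evD !evN evM UV bb0 mulr0 oppr0 addr0.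
move=> /eqP; rewrite oppr_eq0 => /eqP bY0.
have := congr1 (ev x) (Ah_conformal hY hY vV vV).
have -> : dform Y Y + dform Y Y = fibre_curv * (dform N N * g U U) *+ 2
  by rewrite dform_N_Ah // conf //; ring.
rewrite evD bY0 addr0 evN evM evMn !evM => /esym/eqP.
rewrite oppr_eq0 mulf_eq0 (negPf VV) orbF mulrn_eq0 /= !mulf_eq0 (negPf (fibre_curv_neq0 x)).
by rewrite (negPf UU) (negPf sigma_neq0).
Qed.

(** Now [Ah N V] is null, hence zero as [g] is definite on horizontal fields, and
[Ah_conformal] for the pair [N], [X] leaves [dform X N]. *)
Lemma dform_N X : hor X -> dform X N = 0.
Proof.
move=> hX; rewrite dform_sym //; apply: ev_inj => x.
have [V [vV _ VV]] := two_dim x (ver_vp 0).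
have bN0 Z : hor Z -> ev x (g (Ah N V) Z) = 0.
  move=> hZ; apply: hor_def => //.
  have := congr1 (ev x) (Ah_conformal hor_N hor_N vV vV).
  rewrite dform_NN addr0 mul0r oppr0 ev0 -mulr2n evMn => /eqP.
  by rewrite mulrn_eq0 => /eqP.
have := congr1 (ev x) (Ah_conformal hor_N hX vV vV).
rewrite (gC (Ah X V)) evD !bN0 // addr0 (dform_sym hX hor_N) -mulr2n evN evM evMn.
by move=> /esym/eqP; rewrite oppr_eq0 mulf_eq0 (negPf VV) orbF mulrn_eq0 => /eqP.
Qed.

(** The vertical part of [X] contributes nothing by the Codazzi equation, the horizontal
one is [dform_N]. *)
Theorem D_fibre_curv X : D X fibre_curv = 2%:R * fibre_curv * mean_form X.
Proof.
have hX := hor_hor_part X; rewrite [X]hor_vp_split DDl (D_fibre_curv_ver (ver_vp X)) /mean_form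
  gDr (g_hv hor_N (ver_vp X)) !addr0.
have := dform_N hX; rewrite dformE // => e.
rewrite /mean_form in e *; rewrite fibre_curvE DD Dc nab_met (gC N (nab _ _)).
by apply: (eq_of_sub_eq (eqrM 2%:R e)); rewrite (gC (hor_part X)); ring.
Qed.

(** For [nab X X = 0] this is the law by which the vertical length changes along a
geodesic. The derivative of [hor_part X] along itself has no vertical part since [Av] is
alternating, and that along [vp X] contributes the mean curvature. *)
Lemma D_g_vp X :
  D X (g (vp X) (vp X)) = 2%:R * (g (nab X X) (vp X) + mean_form X * g (vp X) (vp X)).
Proof.
have [hH vV] := (hor_hor_part X, ver_vp X).
have e1 : g (nab (vp X) (hor_part X)) (vp X) = - (g (vp X) (vp X) * mean_form (hor_part X)).
  exact: g_nab_vhv.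
have e2 : g (nab (hor_part X) (hor_part X)) (vp X) = 0.
  by rewrite -(g_vpl _ vV) -AvE Av_diag // g0l.
have e3 : g (nab X X) (vp X) = g (nab X (vp X)) (vp X) + g (nab X (hor_part X)) (vp X).
  by rewrite {2}[X]hor_vp_split nabD gDl addrC.
have e4 : g (nab X (hor_part X)) (vp X) =
    g (nab (hor_part X) (hor_part X)) (vp X) + g (nab (vp X) (hor_part X)) (vp X).
  by rewrite {1}[X]hor_vp_split nabDl gDl.
have nE : mean_form X = mean_form (hor_part X).
  by rewrite /mean_form {1}[X]hor_vp_split gDr (g_hv hor_N vV) addr0.
rewrite nab_met (gC (vp X) (nab _ _)) e3 e4 e1 e2 nE; ring.
Qed.
End UmbilicAlgebra.

(** * Smooth functions on open sets of row vectors *)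
Section Calculus.
Variables (R : realType).

Lemma derive_line (V W : normedModType R) (f : V -> W) (y v : V) (s : R) :
  derivable f (s *: v + y) v ->
  is_derive s 1 (fun t : R => f (t *: v + y)) ('D_v f (s *: v + y)).
Proof.
move=> df.
have e : (fun h : R => h^-1 *: (f ((h *: (1 : R) + s) *: v + y) - f (s *: v + y))) =
         (fun h : R => h^-1 *: (f (h *: v + (s *: v + y)) - f (s *: v + y))).
  by apply: funext => h; rewrite scalerDl addrA [h *: _]mulr1.
by apply: DeriveDef; rewrite /derivable /derive /= e.
Qed.

Lemma mvt_line (V : normedModType R) (f : V -> R) (y v : V) (a : R) :
  (forall s : R, `|s| <= `|a| -> derivable f (s *: v + y) v) ->
  exists c : R, `|c| <= `|a| /\ f (a *: v + y) - f y = a * 'D_v f (c *: v + y).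
Proof.
move=> df; pose psi := fun t : R => f (t *: v + y).
have dpsi (s : R) : `|s| <= `|a| -> is_derive s (1 : R) psi ('D_v f (s *: v + y)).
  by move=> sa; apply: derive_line; exact: df.
have cpsi lo hi : (forall s, s \in `[lo, hi]%R -> `|s| <= `|a|) ->
    {within `[lo, hi], continuous psi}.
  move=> h; apply: derivable_within_continuous => s /h sa.
  exact: (@ex_derive _ _ _ _ _ _ _ (dpsi s sa)).
have psi0 : psi 0 = f y by rewrite /psi scale0r add0r.
have [a0|a0] := leP 0 a.
  have h s : s \in `[0, a]%R -> `|s| <= `|a|.
    by rewrite in_itv /= => /andP[s0 sa]; rewrite !ger0_norm.
  have [c cI E] := @MVT_segment R psi (fun s => 'D_v f (s *: v + y)) 0 a a0
    (fun s sI => dpsi s (h s (subset_itv_oo_cc sI))) (cpsi _ _ h).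
  by exists c; split; [exact: h | rewrite -psi0 E subr0 mulrC].
have h s : s \in `[a, 0]%R -> `|s| <= `|a|.
  by rewrite in_itv /= => /andP[s0 sa]; rewrite ler0_norm // ltr0_norm // lerN2.
have [c cI E] := @MVT_segment R psi (fun s => 'D_v f (s *: v + y)) a 0 (ltW a0)
  (fun s sI => dpsi s (h s (subset_itv_oo_cc sI))) (cpsi _ _ h).
exists c; split; first exact: h.
by rewrite -psi0 -opprB E sub0r mulrN opprK mulrC.
Qed.

Lemma normr_coord m (h : 'rV[R]_m) i : `|h 0 i| <= `|h|.
Proof.
rewrite [leRHS]/Num.Def.normr /= mx_normrE; exact: (le_bigmax _ _ (0, i)).
Qed.

Lemma norm_mx_le p q (M : 'M[R]_(p, q)) (e : R) :
  0 <= e -> (forall ij : 'I_p * 'I_q, `|M ij.1 ij.2| <= e) -> `|M| <= e.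
Proof.
move=> e0 he; rewrite [leLHS]/Num.Def.normr /= mx_normrE.
by apply: bigmax_le => // -[i k] _ /=; exact: (he (i, k)).
Qed.

(** The increment is split into steps along the coordinate axes ([tr k] keeps the first
[k] coordinates of [h]) and the mean value theorem is applied to each. *)
Lemma C1_increment m (A : set 'rV[R]_m) (f : 'rV[R]_m -> R) x (e : R) : open A -> A x ->
  (forall y v, A y -> derivable f y v) ->
  (forall v, {for x, continuous ('D_v f)}) -> 0 < e ->
  \forall h \near (0 : 'rV[R]_m),
    `|f (h + x) - f x - \sum_i h 0 i * 'D_(delta_mx 0 i) f x| <= e * `|h|.
Proof.
move=> oA Ax df cf e0; pose e' := e / m.+1%:R.
have e'0 : 0 < e' by rewrite divr_gt0.
have nA : \forall y \near x, A y by apply: open_nbhs_nbhs.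
have nD : \forall y \near x, forall i : 'I_m,
    `|'D_(delta_mx 0 i) f y - 'D_(delta_mx 0 i) f x| <= e'.
  refine (@filter_forall _ _ (fun (i : 'I_m) y => `|'D_(delta_mx 0 i) f y - 'D_(delta_mx 0 i) f
    x| <= e') (nbhs x) _ _) => i.
  by have /cvgrPdist_le/(_ _ e'0) := cf (delta_mx 0 i); apply: filterS => y; rewrite distrC.
have /nbhs_ballP[d /= d0 hd] : nbhs x [set y | A y /\ forall i : 'I_m,
    `|'D_(delta_mx 0 i) f y - 'D_(delta_mx 0 i) f x| <= e'].
  by apply: filterS2 nA nD => y; split.
have hd' y : `|y| < d -> A (y + x) /\ forall i : 'I_m,
    `|'D_(delta_mx 0 i) f (y + x) - 'D_(delta_mx 0 i) f x| <= e'.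
  by move=> yd; apply: hd; rewrite -ball_normE /= opprD addrCA subrr addr0 normrN.
have nd : \forall h \near (0 : 'rV[R]_m), `|h| < d.
  by apply/nbhs_ballP; exists d => // h; rewrite -ball_normE /= sub0r normrN.
near=> h.
have hh : `|h| < d by near: h.
pose tr k : 'rV[R]_m := \row_i (if (i < k)%N then h 0 i else 0).
have tr_le k s (i : 'I_m) : `|s| <= `|h 0 i| -> i = k :> nat ->
    `|s *: delta_mx 0 i + tr k| <= `|h|.
  move=> sh ik; apply: norm_mx_le => // -[z l]; rewrite ord1 !mxE eqxx /=.
  have [li|li] := eqVneq l i.
    by rewrite mulr1 li ik ltnn addr0 (le_trans sh) // normr_coord.
  rewrite mulr0 add0r; case: ifP => _; [exact: normr_coord | by rewrite normr0].
have trS (i : 'I_m) : tr i.+1 = h 0 i *: delta_mx 0 i + tr i.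
  apply/rowP => l; rewrite !mxE eqxx /= ltnS leq_eqVlt.
  have [->|li] := eqVneq l i; first by rewrite eqxx /= mulr1 ltnn addr0.
  by rewrite (negPf (_ : (l != i :> nat))) //= mulr0 add0r.
have -> : f (h + x) - f x = \sum_(i < m) (f (tr i.+1 + x) - f (tr i + x)).
  have tr0 : tr 0%N = 0 by apply/rowP => l; rewrite !mxE ltn0.
  have trm : tr m = h by apply/rowP => l; rewrite !mxE ltn_ord.
  have -> : f (h + x) - f x = f (tr m + x) - f (tr 0%N + x) by rewrite trm tr0 add0r.
  by rewrite -(@telescope_sumr _ 0 m (fun k => f (tr k + x))) // big_mkord.
rewrite -sumrB; apply: (le_trans (ler_norm_sum _ _ _)).
have step (i : 'I_m) : `|f (tr i.+1 + x) - f (tr i + x) - h 0 i * 'D_(delta_mx 0 i) f x|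
    <= `|h| * e'.
  rewrite trS -[_ + tr i + x]addrA.
  have [|c [ch ->]] := @mvt_line _ f (tr i + x) (delta_mx 0 i) (h 0 i).
    move=> s sh; apply: df; rewrite addrA.
    by have [] := hd' _ (le_lt_trans (tr_le _ _ _ sh erefl) hh).
  rewrite -mulrBr normrM addrA; apply: ler_pM; rewrite ?normr_coord //.
  by have [_] := hd' _ (le_lt_trans (tr_le _ _ _ ch erefl) hh); exact.
apply: (le_trans (ler_sum _ (fun i _ => step i))).
rewrite sumr_const card_ord -mulrnAr mulrC ler_wpM2r // /e' -mulr_natr -mulrA.
apply: ler_piMr; first exact: ltW.
by rewrite mulrC ler_pdivrMr // mul1r ler_nat.
Unshelve. all: by end_near. Qed.

Lemma C1_differentiable m (A : set 'rV[R]_m) (f : 'rV[R]_m -> R) x : open A -> A x ->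
  (forall y v, A y -> derivable f y v) ->
  (forall v, {for x, continuous ('D_v f)}) -> differentiable f x.
Proof.
move=> oA Ax df cf.
pose L0 := fun h : 'rV[R]_m => \sum_i h 0 i * 'D_(delta_mx 0 i) f x.
have L0lin : linear (L0 : 'rV[R]_m -> R^o).
  move=> a u v; rewrite /L0 /= scaler_sumr -big_split /=; apply: eq_bigr => i _.
  by rewrite !mxE mulrDl scalerAl.
pose L : {linear 'rV[R]_m -> R^o} := HB.pack L0 (GRing.isLinear.Build _ _ _ _ L0 L0lin).
have Lc : continuous L.
  move=> u; apply: differentiable_continuous.
  have -> : (L : 'rV[R]_m -> R^o) =
      \sum_(i < m) (fun h : 'rV[R]_m => h 0 i * 'D_(delta_mx 0 i) f x : R^o).
    by apply: funext => h; rewrite fct_sumE.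
  apply: differentiable_sum => i; apply: differentiableM => //.
  exact: differentiable_coord.
have fL : f \o shift x = cst (f x) + L +o_ (0 : 'rV[R]_m) id.
  apply/eqaddoP => e e0.
  have := C1_increment oA Ax df cf e0.
  apply: filterS => h /=; by rewrite opprD addrA.
have dfL := diff_unique Lc fL.
by apply/diff_locallyP; rewrite dfL.
Qed.

Section Smooth.
Variables (V W : normedModType R).
Implicit Types (A : set V) (f : V -> W).

Lemma nbhs_open A x (P : V -> Prop) : open A -> A x -> (forall y, A y -> P y) ->
  \forall y \near x, P y.
Proof.
move=> oA Ax AP; have : \forall y \near x, A y by apply: open_nbhs_nbhs.
by apply: filterS => y /AP.
Qed.

Lemma continuous_ext A f f' x : open A -> A x -> (forall y, A y -> f y = f' y) ->
  {for x, continuous f} -> {for x, continuous f'}.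
Proof.
move=> oA Ax ff' cf; suff : f' y @[y --> x] --> f' x by [].
rewrite -(ff' x Ax); apply: cvg_trans cf; apply: near_eq_cvg.
exact: nbhs_open ff'.
Qed.

Lemma Ck_ext k A f f' : open A -> (forall x, A x -> f x = f' x) ->
  Ck_on k A f -> Ck_on k A f'.
Proof.
move=> oA; elim: k f f' => [|k IH] f f' ff' /= [cf df].
  by split=> // x Ax; exact: (continuous_ext oA Ax ff' (cf x Ax)).
split=> [x Ax|v]; first exact: (continuous_ext oA Ax ff' (cf x Ax)).
have [dfv Df] := df v; split=> [x Ax|].
  by apply: near_eq_derivable (dfv x Ax); apply: nbhs_open ff'.
apply: IH Df => x Ax; apply: near_eq_derive; exact: nbhs_open ff'.
Qed.

Lemma Ck_sub k A A' f : A' `<=` A -> Ck_on k A f -> Ck_on k A' f.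
Proof.
move=> AA; elim: k f => [|k IH] f /= [cf df].
  by split=> // x /AA/cf.
split=> [x /AA/cf //|v].
by have [dv Dv] := df v; split=> [x /AA/dv //|]; exact: IH.
Qed.

Lemma smooth_sub A A' f : A' `<=` A -> smooth_on A f -> smooth_on A' f.
Proof. by move=> AA sf k; exact: Ck_sub AA (sf k). Qed.

Lemma smooth_ext A f f' : open A -> (forall x, A x -> f x = f' x) ->
  smooth_on A f -> smooth_on A f'.
Proof. by move=> oA ff' sf k; exact: Ck_ext oA ff' (sf k). Qed.

Lemma smooth_continuous A f x : smooth_on A f -> A x -> {for x, continuous f}.
Proof. by move=> sf Ax; have [cf _] := sf 0%N; exact: cf. Qed.

Lemma smooth_derivable A f x v : smooth_on A f -> A x -> derivable f x v.
Proof. by move=> sf Ax; have [_ /(_ v)[df _]] := sf 1%N; exact: df. Qed.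

Lemma smooth_derive A f v : smooth_on A f -> smooth_on A ('D_v f).
Proof. by move=> sf k; have [_ /(_ v)[]] := sf k.+1. Qed.

Lemma Ck_S k A f : Ck_on k.+1 A f -> Ck_on k A f.
Proof.
elim: k f => [|k IH] f [cf df]; split => // v.
by have [dv Dv] := df v; split=> //; exact: IH.
Qed.

Lemma Ck_cst k A (w : W) : Ck_on k A (cst w : V -> W).
Proof.
elim: k w => [|k IH] w /=.
  by split=> // x _; exact: cst_continuous.
split=> [x _|v]; first exact: cst_continuous.
split=> [x _|]; first exact: derivable_cst.
have -> : 'D_v (cst w) = cst 0 :> (V -> W) by apply: funext => x; rewrite derive_cst.
exact: IH.
Qed.

Lemma Ck_add k A f f' : open A -> Ck_on k A f -> Ck_on k A f' -> Ck_on k A (f \+ f').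
Proof.
move=> oA; elim: k f f' => [|k IH] f f' /= [cf df] [cf' df'].
  by split=> // x Ax; apply: continuousD; [exact: cf | exact: cf'].
split=> [x Ax|v]; first by apply: continuousD; [exact: cf | exact: cf'].
have [[dv Dv] [dv' Dv']] := (df v, df' v).
split=> [x Ax|]; first by apply: derivableD; [exact: dv | exact: dv'].
by apply: Ck_ext (IH _ _ Dv Dv') => // x Ax; rewrite deriveD; [|exact: dv|exact: dv'].
Qed.

Lemma Ck_scale k A (a : R) f : open A -> Ck_on k A f -> Ck_on k A (a \*: f).
Proof.
move=> oA; elim: k f => [|k IH] f /= [cf df].
  by split=> // x Ax; apply: continuousZr; exact: cf.
split=> [x Ax|v]; first by apply: continuousZr; exact: cf.
have [dv Dv] := df v.
split=> [x Ax|]; first by apply: derivableZ; exact: dv.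
by apply: Ck_ext (IH _ Dv) => // x Ax; rewrite deriveZ //; exact: dv.
Qed.

End Smooth.

Section SmoothScalar.
Variables (V : normedModType R).
Implicit Types (A : set V) (f : V -> R).

Lemma Ck_mul k A f f' : open A -> Ck_on k A f -> Ck_on k A f' -> Ck_on k A (f \* f').
Proof.
move=> oA; elim: k f f' => [|k IH] f f' Hf Hf'.
  have [[cf _] [cf' _]] := (Hf, Hf').
  by split=> // x Ax; apply: continuousM; [exact: cf | exact: cf'].
have [Sf Sf'] := (Ck_S Hf, Ck_S Hf').
have [[cf df] [cf' df']] := (Hf, Hf').
split=> [x Ax|v]; first by apply: continuousM; [exact: cf | exact: cf'].
have [[dv Dv] [dv' Dv']] := (df v, df' v).
split=> [x Ax|]; first by apply: derivableM; [exact: dv | exact: dv'].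
have := Ck_add oA (IH _ _ Sf Dv') (IH _ _ Sf' Dv).
by apply: Ck_ext => // x Ax; rewrite deriveM; [|exact: dv|exact: dv'].
Qed.

Lemma Ck_inv k A f : open A -> (forall x, A x -> f x != 0) ->
  Ck_on k A f -> Ck_on k A (fun x => (f x)^-1).
Proof.
move=> oA f0; elim: k f f0 => [|k IH] f f0 Hf.
  by have [cf _] := Hf; split=> // x Ax; apply: continuousV; [exact: f0 | exact: cf].
have [cf df] := Hf; have Sf := IH _ f0 (Ck_S Hf).
split=> [x Ax|v]; first by apply: continuousV; [exact: f0 | exact: cf].
have [dv Dv] := df v.
split=> [x Ax|]; first by apply: derivableV; [exact: f0 | exact: dv].
have := Ck_scale (-1) oA (Ck_mul oA (Ck_mul oA Sf Sf) Dv).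
apply: Ck_ext => // x Ax; rewrite deriveV; [|exact: f0|exact: dv].
by rewrite /= scaleN1r scaleNr expr2 invfM.
Qed.

End SmoothScalar.

Section SmoothCoord.
Variable m : nat.
Implicit Types (A : set 'rV[R]_m).

Lemma smooth_differentiable A (f : 'rV[R]_m -> R) x :
  open A -> smooth_on A f -> A x -> differentiable f x.
Proof.
move=> oA sf Ax; apply: (C1_differentiable oA Ax) => [y v Ay|v].
  exact: smooth_derivable sf Ay.
exact: smooth_continuous (smooth_derive v sf) Ax.
Qed.

Lemma derive_sum_coord (f : 'rV[R]_m -> R) x v : differentiable f x ->
  'D_v f x = \sum_i v 0 i * 'D_(delta_mx 0 i) f x.
Proof.
move=> df; rewrite deriveE // {1}[v]row_sum_delta linear_sum /=.
by apply: eq_bigr => i _; rewrite linearZ /= deriveE.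
Qed.

(** Two uses of the mean value theorem. As the left-hand side is symmetric in [u] and
[v], this is the source of the symmetry of second derivatives. *)
Lemma second_difference A (f : 'rV[R]_m -> R) (x u v : 'rV[R]_m) (d t : R) : smooth_on A f ->
  ball x d `<=` A -> `|t| * (`|u| + `|v|) < d ->
  exists2 xi, `|xi - x| <= `|t| * (`|u| + `|v|) &
    f (t *: u + (t *: v + x)) - f (t *: u + x) - (f (t *: v + x) - f x)
      = t * (t * 'D_v ('D_u f) xi).
Proof.
move=> sf xA td.
have inA (a b : R) : `|a| <= `|t| -> `|b| <= `|t| ->
    `|a *: u + b *: v| <= `|t| * (`|u| + `|v|) /\ A (a *: u + b *: v + x).
  move=> at_ bt; have h : `|a *: u + b *: v| <= `|t| * (`|u| + `|v|).
    by rewrite (le_trans (ler_normD _ _)) // !normrZ mulrDr lerD // ler_wpM2r.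
  split=> //; apply: xA; rewrite -ball_normE /= opprD addrCA subrr addr0 normrN.
  exact: le_lt_trans h td.
pose F y := f (t *: v + y) - f y.
have dF (a : R) : `|a| <= `|t| -> is_derive (a *: u + x) u F
   ('D_u f (t *: v + (a *: u + x)) - 'D_u f (a *: u + x)).
  move=> at_.
  have A1 : A (a *: u + x).
    by have [_] := inA a 0 at_ (ltac:(by rewrite normr0)); rewrite scale0r addr0.
  have A2 : A (t *: v + (a *: u + x)).
    by have [_] := inA a t at_ (lexx _); rewrite addrA [t *: v + _]addrC.
  have d1 := smooth_derivable (v := u) sf A1.
  have d2 : is_derive (a *: u + x) u (fun y => f (t *: v + y)) ('D_u f (t *: v + (a *: u + x))).
    have e : (fun h : R => h^-1 *: (f (t *: v + (h *: u + (a *: u + x))) -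
      f (t *: v + (a *: u + x)))) =
       (fun h : R => h^-1 *: (f (h *: u + (t *: v + (a *: u + x))) - f (t *: v + (a *: u + x)))).
      by apply: funext => h; rewrite addrCA.
    have := smooth_derivable (v := u) sf A2; rewrite /derivable => d3.
    by apply: DeriveDef; rewrite /derivable /derive /= e.
  apply: is_deriveB; exact: derivableP.
have [|c [ct Ec]] := @mvt_line _ F x u t.
  by move=> a /dF h; exact: (@ex_derive _ _ _ _ _ _ _ h).
have Ac : A (c *: u + x).
  by have [_] := inA c 0 ct (ltac:(by rewrite normr0)); rewrite scale0r addr0.
have [|c' [ct' Ec']] := @mvt_line _ ('D_u f) (c *: u + x) v t.
  move=> a at_; apply: smooth_derivable (smooth_derive u sf) _.
  by have [_] := inA c a ct at_; rewrite addrA [a *: v + _]addrC.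
exists (c' *: v + (c *: u + x)).
  have [h _] := inA c c' ct ct'.
  by rewrite !addrA addrK addrC.
rewrite -Ec' -(@derive_val _ _ _ _ _ _ _ (dF c ct)) -Ec /F.
by rewrite addrCA.
Qed.

Lemma dist_close (a b c c' e : R) :
  c = c' -> `|b - c| <= e / 2 -> `|a - c'| <= e / 2 -> `|a - b| <= e.
Proof.
move=> -> hb ha; rewrite [e]splitr (_ : a - b = (a - c') - (b - c')); last by ring.
by rewrite (le_trans (ler_normB _ _)) // lerD.
Qed.

Lemma schwarz A (f : 'rV[R]_m -> R) (x u v : 'rV[R]_m) : open A -> smooth_on A f -> A x ->
  'D_u ('D_v f) x = 'D_v ('D_u f) x.
Proof.
move=> oA sf Ax; apply/eqP; rewrite -subr_eq0 -normr_le0; apply/ler_addgt0Pl => e e0.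
rewrite addr0.
have e2 : 0 < e / 2 by rewrite divr_gt0.
have c1 := smooth_continuous (smooth_derive u (smooth_derive v sf)) Ax.
have c2 := smooth_continuous (smooth_derive v (smooth_derive u sf)) Ax.
have n0 : nbhs x A by apply: open_nbhs_nbhs.
have /cvgrPdist_le/(_ _ e2) n1 := c1; have /cvgrPdist_le/(_ _ e2) n2 := c2.
have : nbhs x (A `&` ([set y | `|'D_u ('D_v f) x - 'D_u ('D_v f) y| <= e / 2] `&`
    [set y | `|'D_v ('D_u f) x - 'D_v ('D_u f) y| <= e / 2])).
  exact: filterI n0 (filterI n1 n2).
move=> /nbhs_ballP[d /= d0 hd].
pose t := d / 2 / (`|u| + `|v| + 1).
have uv0 : 0 <= `|u| + `|v| by rewrite addr_ge0.
have uv1 : 0 < `|u| + `|v| + 1 by rewrite ltr_wpDl.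
have t0 : 0 < t by rewrite !divr_gt0.
have td : `|t| * (`|u| + `|v|) < d.
  rewrite gtr0_norm // /t mulrAC ltr_pdivrMr //.
  apply: (@le_lt_trans _ _ (d / 2 * (`|u| + `|v| + 1))).
    by rewrite ler_wpM2l ?lerDl // divr_ge0 // ltW.
  by rewrite ltr_pM2r // ltr_pdivrMr // ltr_pMr // ltr1n.
have dA : ball x d `<=` A by move=> y /hd [].
have [xi xid E1] := second_difference sf dA td.
have td' : `|t| * (`|v| + `|u|) < d by rewrite addrC in td *.
have [xi' xid' E2] := second_difference sf dA td'.
have inb y : `|y - x| < d -> ball x d y by rewrite -ball_normE /= distrC.
have [_ [_ h1]] := hd _ (inb _ (le_lt_trans xid td)).
have [_ [h2 _]] := hd _ (inb _ (le_lt_trans xid' td')).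
have t_neq0 : t != 0 by rewrite gt_eqF.
have E : 'D_v ('D_u f) xi = 'D_u ('D_v f) xi'.
  apply: (mulfI t_neq0); apply: (mulfI t_neq0); apply: (etrans (esym E1)).
  apply: etrans E2.
  have aux (p a b c : R) : p - a - (b - c) = p - b - (a - c) by ring.
  by rewrite (addrCA (t *: u)); exact: aux.
exact: dist_close E h1 h2.
Qed.
End SmoothCoord.

Section SmoothMatrix.
Variables (V : normedModType R) (p q : nat).
Implicit Types (A : set V) (F : V -> 'M[R]_(p, q)).

Lemma continuous_coord F x i j : {for x, continuous F} ->
  {for x, continuous (fun y => F y i j : R^o)}.
Proof. by move=> cF; exact: (continuous_comp cF (@coord_continuous R p q i j (F x))). Qed.

Lemma continuous_mx F x : (forall i j, {for x, continuous (fun y => F y i j : R^o)}) ->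
  {for x, continuous F}.
Proof.
move=> cF; apply/cvgrPdist_le => e e0.
suff : \forall y \near x, forall ij : 'I_p * 'I_q, `|F x ij.1 ij.2 - F y ij.1 ij.2| <= e.
  apply: filterS => y hy; apply: (@norm_mx_le _ _ (F x - F y) e (ltW e0)).
  by move=> ij; rewrite !mxE.
refine (@filter_forall _ _ (fun (ij : 'I_p * 'I_q) y => `|F x ij.1 ij.2 - F y ij.1 ij.2| <= e)
  (nbhs x) _ _) => -[i j] /=.
by have /cvgrPdist_le/(_ _ e0) := cF i j.
Qed.

Lemma derive_coord F x v i j : derivable F x v ->
  'D_v F x i j = 'D_v (fun y => F y i j : R^o) x.
Proof. by move=> dF; rewrite derive_mx // mxE. Qed.

Lemma Ck_coord k A F i j : open A -> Ck_on k A F -> Ck_on k A (fun y => F y i j : R^o).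
Proof.
move=> oA; elim: k F => [|k IH] F /= [cF dF].
  by split=> // x Ax; apply: continuous_coord; exact: cF.
split=> [x Ax|v]; first by apply: continuous_coord; exact: cF.
have [dv Dv] := dF v.
split=> [x Ax|]; first by have /derivable_mxP/(_ i j) := dv x Ax.
by apply: Ck_ext (IH _ Dv) => // x Ax; rewrite derive_coord //; exact: dv.
Qed.

Lemma Ck_mx k A F : open A -> (forall i j, Ck_on k A (fun y => F y i j : R^o)) -> Ck_on k A F.
Proof.
move=> oA; elim: k F => [|k IH] F hF.
  by split=> // x Ax; apply: continuous_mx => i j; have [cf _] := hF i j; exact: cf.
split=> [x Ax|v].
  by apply: continuous_mx => i j; have [cf _] := hF i j; exact: cf.
have dv x : A x -> derivable F x v.
  by move=> Ax; apply/derivable_mxP => i j; have [_ /(_ v)[df _]] := hF i j; exact: df.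
split=> //; apply: IH => i j; have [_ /(_ v)[_ Df]] := hF i j.
by apply: Ck_ext Df => // x Ax; rewrite derive_coord //; exact: dv.
Qed.

Lemma smooth_coord A F i j : open A -> smooth_on A F -> smooth_on A (fun y => F y i j : R^o).
Proof. by move=> oA sF k; exact: Ck_coord. Qed.

Lemma smooth_mx A F : open A -> (forall i j, smooth_on A (fun y => F y i j : R^o)) ->
  smooth_on A F.
Proof. by move=> oA sF k; apply: Ck_mx => // i j; exact: sF. Qed.

End SmoothMatrix.

Lemma differentiable_mx (V : normedModType R) p q (F : V -> 'M[R]_(p, q)) x :
  (forall i j, differentiable (fun y => F y i j : R^o) x) -> differentiable F x.
Proof.
move=> dF.
have -> : F = \sum_(i < p) \sum_(j < q) (fun y => F y i j *: delta_mx i j).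
  apply: funext => y; rewrite {1}[F y]matrix_sum_delta fct_sumE.
  by apply: eq_bigr => i _; rewrite fct_sumE.
apply: differentiable_sum => i; apply: differentiable_sum => j.
by apply: differentiableZl.
Qed.

Lemma smooth_differentiable_mx m p q (A : set 'rV[R]_m) (F : 'rV[R]_m -> 'M[R]_(p, q)) x :
  open A -> smooth_on A F -> A x -> differentiable F x.
Proof.
move=> oA sF Ax; apply: differentiable_mx => i j.
by apply: smooth_differentiable Ax => //; exact: smooth_coord.
Qed.

Lemma derive_comp (U V W : normedModType R) (f : U -> V) (g : V -> W) x u :
  differentiable f x -> differentiable g (f x) ->
  'D_u (g \o f) x = 'D_('D_u f x) g (f x).
Proof.
move=> df dg; rewrite !deriveE //; last exact: differentiable_comp.
by rewrite diff_comp.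
Qed.
End Calculus.

(** * The ring of smooth functions on an open set *)
Section SmoothRing.
Variables (R : realType) (m : nat) (W : set 'rV[R]_m) (oW : open W).

(** Vanishing outside of [W] makes functions with the same values on [W] equal, so that
they form a ring for Leibniz equality. *)
Definition smooth0 (f : 'rV[R]_m -> R) : Prop :=
  smooth_on W f /\ forall x, ~ W x -> f x = 0.

Definition smfun of open W := {f : 'rV[R]_m -> R | smooth0 f}.
Local Notation S := (smfun oW).
Definition sapp (s : S) : 'rV[R]_m -> R := sval s.
Coercion sapp : smfun >-> Funclass.

Lemma sapp_smooth (s : S) : smooth_on W s. Proof. exact: (proj1 (svalP s)). Qed.
Lemma sapp_out (s : S) x : ~ W x -> s x = 0. Proof. exact: (proj2 (svalP s)). Qed.
Lemma smfun_ext (s t : S) : (forall x, W x -> s x = t x) -> s = t.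
Proof.
move=> st; have : sapp s = sapp t.
  apply: funext => x; have [Wx|nWx] := pselect (W x); first exact: st.
  by rewrite !sapp_out.
by apply: eq_sig_hprop => f p q; exact: Prop_irrelevance.
Qed.

Lemma cut_smooth0 (f : 'rV[R]_m -> R) : smooth_on W f ->
  smooth0 (fun x => if `[< W x >] then f x else 0).
Proof.
move=> sf; split=> [|x]; last by case: asboolP.
by apply: smooth_ext sf => // x Wx; case: asboolP.
Qed.
Definition mks (f : 'rV[R]_m -> R) (sf : smooth_on W f) : S := exist _ _ (cut_smooth0 sf).
Lemma mksE (f : 'rV[R]_m -> R) (sf : smooth_on W f) x : W x -> mks sf x = f x.
Proof. by move=> Wx; rewrite /sapp /=; case: asboolP. Qed.

Lemma smooth_add (f f' : 'rV[R]_m -> R) : smooth_on W f -> smooth_on W f' ->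
  smooth_on W (f \+ f').
Proof. by move=> sf sf' k; exact: Ck_add. Qed.
Lemma smooth_mul (f f' : 'rV[R]_m -> R) : smooth_on W f -> smooth_on W f' ->
  smooth_on W (f \* f').
Proof. by move=> sf sf' k; exact: Ck_mul. Qed.
Lemma smooth_opp (f : 'rV[R]_m -> R) : smooth_on W f -> smooth_on W (fun x => - f x).
Proof.
move=> sf k; have := Ck_scale (-1) oW (sf k).
by apply: Ck_ext => // x _; rewrite /= scaleN1r.
Qed.
Lemma smooth_cst (r : R) : smooth_on W (cst r : 'rV[R]_m -> R).
Proof. by move=> k; exact: Ck_cst. Qed.

Definition sadd (s t : S) : S := mks (smooth_add (sapp_smooth s) (sapp_smooth t)).
Definition smul (s t : S) : S := mks (smooth_mul (sapp_smooth s) (sapp_smooth t)).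
Definition sopp (s : S) : S := mks (smooth_opp (sapp_smooth s)).
Definition scst (r : R) : S := mks (smooth_cst r).

Lemma saddE s t x : W x -> sadd s t x = s x + t x. Proof. exact: mksE. Qed.
Lemma smulE s t x : W x -> smul s t x = s x * t x. Proof. exact: mksE. Qed.
Lemma soppE s x : W x -> sopp s x = - s x. Proof. exact: mksE. Qed.
Lemma scstE r x : W x -> scst r x = r. Proof. exact: mksE. Qed.
Definition sE := (saddE, smulE, soppE, scstE).

HB.instance Definition _ := gen_eqMixin S.
HB.instance Definition _ := gen_choiceMixin S.

Lemma saddA : associative sadd.
Proof. by move=> s t u; apply: smfun_ext => x Wx; rewrite !sE // addrA. Qed.
Lemma saddC : commutative sadd.
Proof. by move=> s t; apply: smfun_ext => x Wx; rewrite !sE // addrC. Qed.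
Lemma sadd0 : left_id (scst 0) sadd.
Proof. by move=> s; apply: smfun_ext => x Wx; rewrite !sE // add0r. Qed.
Lemma saddN : left_inverse (scst 0) sopp sadd.
Proof. by move=> s; apply: smfun_ext => x Wx; rewrite !sE // addNr. Qed.
HB.instance Definition _ := GRing.isZmodule.Build S saddA saddC sadd0 saddN.

Lemma smulA : associative smul.
Proof. by move=> s t u; apply: smfun_ext => x Wx; rewrite !sE // mulrA. Qed.
Lemma smulC : commutative smul.
Proof. by move=> s t; apply: smfun_ext => x Wx; rewrite !sE // mulrC. Qed.
Lemma smul1 : left_id (scst 1) smul.
Proof. by move=> s; apply: smfun_ext => x Wx; rewrite !sE // mul1r. Qed.
Lemma smulD : left_distributive smul sadd.
Proof. by move=> s t u; apply: smfun_ext => x Wx; rewrite !sE // mulrDl. Qed.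
HB.instance Definition _ := GRing.Zmodule_isComPzRing.Build S smulA smulC smul1 smulD.

Definition pt := {x | W x}.
Definition evs (x : pt) (s : S) : R := s (sval x).
Arguments evs : simpl never.
Arguments mks : simpl never.
Arguments scst : simpl never.
Lemma evs_is_zmod_morphism x : zmod_morphism (evs x).
Proof.
by move=> s t; rewrite /evs; have Wx := svalP x; rewrite (saddE s (sopp t) Wx) (soppE t Wx).
Qed.
HB.instance Definition _ x := GRing.isZmodMorphism.Build S R (evs x) (evs_is_zmod_morphism x).
Lemma evs_is_monoid_morphism x : monoid_morphism (evs x).
Proof. by split=> [|s t]; [exact: (scstE 1 (svalP x)) | exact: (smulE s t (svalP x))]. Qed.
HB.instance Definition _ x := GRing.isMonoidMorphism.Build S R (evs x) (evs_is_monoid_morphism x).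

Lemma evs_inj (s t : S) : (forall x, evs x s = evs x t) -> s = t.
Proof. by move=> e; apply: smfun_ext => x Wx; exact: (e (exist _ x Wx)). Qed.
Lemma evs_mks x f (sf : smooth_on W f) : evs x (mks sf) = f (sval x).
Proof. exact: mksE (svalP x). Qed.
Lemma evs_cst x r : evs x (scst r) = r.
Proof. exact: evs_mks. Qed.

Lemma sinv_ex (s : S) : (forall x, evs x s != 0) -> exists t, t * s = 1.
Proof.
move=> s0; have s0' x : W x -> s x != 0 by move=> Wx; exact: (s0 (exist _ x Wx)).
have si : smooth_on W (fun x => (s x)^-1) by move=> k; apply: Ck_inv => //; exact: sapp_smooth.
exists (mks si); apply: evs_inj => x; rewrite rmorphM rmorph1 /= evs_mks.
by rewrite mulVf // s0.
Qed.

Definition pd (i : 'I_m) (s : S) : S := mks (smooth_derive (delta_mx 0 i) (sapp_smooth s)).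
Arguments pd : simpl never.
Lemma sdiff (s : S) (x : pt) : differentiable (sapp s) (sval x).
Proof. exact: smooth_differentiable oW (sapp_smooth s) (svalP x). Qed.
Lemma evs_pd x i s : evs x (pd i s) = 'D_(delta_mx 0 i) (sapp s) (sval x).
Proof. exact: evs_mks. Qed.

Lemma derive_near (f h : 'rV[R]_m -> R) (x : pt) v : (forall y, W y -> f y = h y) ->
  'D_v f (sval x) = 'D_v h (sval x).
Proof. by move=> fh; apply: near_eq_derive; exact: (nbhs_open oW (svalP x) fh). Qed.

Lemma pdD i (s t : S) : pd i (s + t) = pd i s + pd i t.
Proof.
apply: evs_inj => x; rewrite rmorphD /= !evs_pd.
rewrite (@derive_near _ ((sapp s) + (sapp t))); last by move=> y; exact: saddE.
by rewrite deriveD //; apply: diff_derivable; exact: sdiff.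
Qed.
Lemma pdM i (s t : S) : pd i (s * t) = pd i s * t + s * pd i t.
Proof.
apply: evs_inj => x; rewrite rmorphD !rmorphM /= !evs_pd.
rewrite (@derive_near _ ((sapp s) * (sapp t))); last by move=> y; exact: smulE.
rewrite deriveM; [|by apply: diff_derivable; exact: sdiff|by apply: diff_derivable; exact: sdiff].
by rewrite addrC [_ *: 'D_ _ _ _]mulrC.
Qed.
Lemma pd_cst i r : pd i (scst r) = 0.
Proof.
apply: evs_inj => x; rewrite rmorph0 evs_pd (@derive_near _ (cst r)) ?derive_cst //.
by move=> y Wy; rewrite mksE.
Qed.
Lemma pd_comm i k (s : S) : pd i (pd k s) = pd k (pd i s).
Proof.
apply: evs_inj => x; rewrite !evs_pd.
rewrite (@derive_near _ ('D_(delta_mx 0 k) (sapp s))); last by move=> y Wy; rewrite mksE.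
rewrite (@derive_near (pd i s) ('D_(delta_mx 0 i) (sapp s))); last by move=> y Wy; rewrite mksE.
exact: schwarz oW (sapp_smooth s) (svalP x).
Qed.
End SmoothRing.
Arguments evs : simpl never.
Arguments mks : simpl never.
Arguments scst : simpl never.
Arguments pd : simpl never.

(** * The Levi-Civita connection on fields with smooth coefficients *)
Section Connection.
Variables (R : realType) (m : nat) (M : semiRiemannian R m) (a : mf_idx M).
Variables (W : set 'rV[R]_m) (oW : open W) (sub_cod : W `<=` ch_cod (atlas a)).
Local Notation S := (smfun oW).
Local Notation E := 'rV[S]_m.
Implicit Types (x : pt W) (X Y Z : E).

Definition fld X : 'rV[R]_m -> 'rV[R]_m := fun y => \row_i X 0 i y.
Lemma fldE x X : fld X (sval x) = map_mx (evs x) X.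
Proof. by apply/rowP => i; rewrite !mxE. Qed.
Lemma fld_smooth X : smooth_on W (fld X).
Proof.
apply: smooth_mx => // i k; rewrite ord1.
have -> : (fun y => fld X y 0 k) = sapp (X 0 k) by apply: funext => y; rewrite mxE.
exact: sapp_smooth.
Qed.

Lemma gram_smoothW i k : smooth_on W (fun y => gram a y i k : R^o).
Proof.
exact: (smooth_sub sub_cod (smooth_coord i k (ch_cod_open (c := atlas a))
  (@gram_smooth _ _ M a))).
Qed.

Definition gramS : 'M[S]_m := \matrix_(i, k) mks oW (gram_smoothW i k).
Lemma ev_gram x : map_mx (evs x) gramS = gram a (sval x).
Proof. by apply/matrixP => i k; rewrite !mxE evs_mks. Qed.

Lemma det_gramS_inv : exists t, t * \det gramS = 1 :> S.
Proof.
apply: sinv_ex => x; rewrite -det_map_mx ev_gram -unitfE -unitmxE.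
exact/gram_unit/sub_cod/svalP.
Qed.
Definition ginvS : 'M[S]_m := sval (cid det_gramS_inv) *: \adj gramS.
Lemma mul_ginvS : ginvS *m gramS = 1%:M.
Proof.
rewrite /ginvS; case: cid => t /= ht.
by rewrite -scalemxAl mul_adj_mx scale_scalar_mx ht.
Qed.
Lemma mul_gram_ginvS : gramS *m ginvS = 1%:M.
Proof.
rewrite /ginvS; case: cid => t /= ht.
by rewrite -scalemxAr mul_mx_adj scale_scalar_mx ht.
Qed.
Lemma ev_ginv x : map_mx (evs x) ginvS = invmx (gram a (sval x)).
Proof.
have gu := gram_unit (sub_cod (svalP x)).
rewrite -[LHS]mulmx1 -(mulmxV gu) mulmxA -{1}ev_gram -map_mxM mul_ginvS.
by rewrite map_mx1 mul1mx.
Qed.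
Lemma gramS_sym : gramS^T = gramS.
Proof.
apply/matrixP => i k; apply: (evs_inj (oW := oW)) => x.
have := gram_sym (sub_cod (svalP x)); rewrite -ev_gram => /matrixP/(_ i k).
by rewrite !mxE.
Qed.

Lemma evs_dgram x k i j : evs x (pd k (gramS i j)) = dgram a (sval x) k i j.
Proof.
rewrite evs_pd; apply: (derive_near oW) => y Wy.
by rewrite !mxE mksE.
Qed.

Definition chrS (k i j : 'I_m) : S := scst oW 2^-1 * \sum_l ginvS k l *
  (pd i (gramS j l) + pd j (gramS i l) - pd l (gramS i j)).
Lemma evs_chr x k i j : evs x (chrS k i j) = christoffel a (sval x) k i j.
Proof.
rewrite /chrS rmorphM /= evs_cst rmorph_sum /=; congr (_ * _).
apply: eq_bigr => l _; rewrite rmorphM rmorphB rmorphD /= !evs_dgram; congr (_ * _).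
by rewrite -ev_ginv [RHS]mxE.
Qed.

Definition DS X (s : S) : S := \sum_i X 0 i * pd i s.
Lemma evs_D x X s : evs x (DS X s) = 'D_(fld X (sval x)) (sapp s) (sval x).
Proof.
rewrite derive_sum_coord; last exact: sdiff.
rewrite /DS rmorph_sum /=; apply: eq_bigr => i _.
by rewrite rmorphM /= evs_pd mxE.
Qed.
Lemma DS_addl X Y s : DS (X + Y) s = DS X s + DS Y s.
Proof. by rewrite /DS -big_split; apply: eq_bigr => i _; rewrite mxE mulrDl. Qed.
Lemma DS_Zl f X s : DS (f *: X) s = f * DS X s.
Proof. by rewrite /DS mulr_sumr; apply: eq_bigr => i _; rewrite mxE mulrA. Qed.
Lemma DS_add X s t : DS X (s + t) = DS X s + DS X t.
Proof. by rewrite /DS -big_split; apply: eq_bigr => i _; rewrite pdD mulrDr. Qed.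
Lemma DS_mul X s t : DS X (s * t) = DS X s * t + s * DS X t.
Proof.
rewrite /DS mulr_suml mulr_sumr -big_split; apply: eq_bigr => i _ /=.
by rewrite pdM; ring.
Qed.
Lemma DS_cst X r : DS X (scst oW r) = 0.
Proof. by rewrite /DS big1 // => i _; rewrite pd_cst mulr0. Qed.
Lemma DS0 X : DS X 0 = 0.
Proof. by apply: (addrI (DS X 0)); rewrite -DS_add !addr0. Qed.
Lemma DS_sum X (I : Type) (r : seq I) (P : pred I) (f : I -> S) :
  DS X (\sum_(i <- r | P i) f i) = \sum_(i <- r | P i) DS X (f i).
Proof. by apply: (big_morph (DS X)); [exact: DS_add | exact: DS0]. Qed.

Definition dm X p q (B : 'M[S]_(p, q)) : 'M[S]_(p, q) := map_mx (DS X) B.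
Lemma dmD X p q (B C : 'M[S]_(p, q)) : dm X (B + C) = dm X B + dm X C.
Proof. by apply/matrixP => i k; rewrite !mxE DS_add. Qed.
Lemma dmM X p q r (B : 'M[S]_(p, q)) (C : 'M[S]_(q, r)) :
  dm X (B *m C) = dm X B *m C + B *m dm X C.
Proof.
apply/matrixP => i k; rewrite !mxE DS_sum -big_split; apply: eq_bigr => l _ /=.
by rewrite DS_mul !mxE.
Qed.
Lemma dm_tr X p q (B : 'M[S]_(p, q)) : dm X B^T = (dm X B)^T.
Proof. by apply/matrixP => i k; rewrite !mxE. Qed.

Definition conn_mx X : 'M[S]_m := \matrix_(j, k) \sum_i chrS k i j * X 0 i.
Definition nabS X Y : E := dm X Y + Y *m conn_mx X.
Definition gS X Y : S := (X *m gramS *m Y^T) 0 0.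

Lemma evs_g x X Y : evs x (gS X Y) = met a (sval x) (fld X (sval x)) (fld Y (sval x)).
Proof.
rewrite /met /bform !fldE -ev_gram map_trmx -!map_mxM.
by rewrite [RHS]mxE.
Qed.

Lemma fld_nab x X Y : fld (nabS X Y) (sval x) = nabla a (fld X (sval x)) (fld Y) (sval x).
Proof.
have dY : derivable (fld Y) (sval x) (fld X (sval x)).
  exact: smooth_derivable (fld_smooth Y) (svalP x).
rewrite fldE /nabla; apply/rowP => k; rewrite mxE [RHS]mxE mxE rmorphD /=; congr (_ + _).
  rewrite mxE evs_D derive_coord //; apply: (derive_near oW) => y Wy.
  by rewrite mxE.
rewrite !mxE.
rewrite rmorph_sum /= exchange_big; apply: eq_bigr => i _ /=.
rewrite rmorphM !mxE rmorph_sum /= mulr_sumr; apply: eq_bigr => l _.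
rewrite rmorphM /= evs_chr [in fld X _ 0 l]mxE -!/(evs x _); ring.
Qed.

Lemma dm_gram X : dm X gramS = conn_mx X *m gramS + gramS *m (conn_mx X)^T.
Proof.
apply/matrixP => i j; apply: (evs_inj (oW := oW)) => x.
rewrite mxE /DS rmorph_sum /=.
under eq_bigr do rewrite rmorphM /= evs_dgram (christoffel_metric _ _ _ (sub_cod (svalP x)))
  mulr_sumr.
rewrite exchange_big /= !mxE rmorphD !rmorph_sum -big_split; apply: eq_bigr => l _ /=.
rewrite !rmorphM !mxE !rmorph_sum /= mulr_suml mulr_sumr -big_split; apply: eq_bigr => k _ /=.
rewrite (rmorphM (evs x) (chrS l k i)) (rmorphM (evs x) (chrS l k j)) /= !evs_chr !evs_mks; ring.
Qed.

Lemma nabS_met X Y Z : DS X (gS Y Z) = gS (nabS X Y) Z + gS Y (nabS X Z).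
Proof.
have -> : DS X (gS Y Z) = dm X (Y *m gramS *m Z^T) 0 0 by rewrite mxE.
have madd (A C : 'M[S]_1) : A 0 0 + C 0 0 = (A + C) 0 0 by rewrite mxE.
rewrite /gS madd /nabS !dmM dm_gram dm_tr; congr (fun_of_matrix _ 0 0).
rewrite [(dm X Z + _)^T]linearD /= trmx_mul !(mulmxDl, mulmxDr, mulmxA) -!addrA.
by congr (_ + (_ + _)); rewrite addrC.
Qed.

Lemma chrSC k i j : chrS k i j = chrS k j i.
Proof.
by apply: (evs_inj (oW := oW)) => x; rewrite !evs_chr christoffelC //; exact/sub_cod/svalP.
Qed.
Lemma conn_mx_sym X Y : Y *m conn_mx X = X *m conn_mx Y.
Proof.
apply/rowP => k; rewrite !mxE.
under eq_bigr do rewrite mxE mulr_sumr.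
under [RHS]eq_bigr do rewrite mxE mulr_sumr.
rewrite exchange_big; apply: eq_bigr => i _; apply: eq_bigr => l _ /=.
by rewrite chrSC; ring.
Qed.
Lemma nabS_br X Y : nabS X Y - nabS Y X = dm X Y - dm Y X.
Proof. by rewrite /nabS conn_mx_sym opprD addrACA subrr addr0. Qed.

(** Both sides contain the same second partial derivatives of [s]; these are symmetric,
and the Christoffel symbols cancel as the connection is torsion free. *)
Lemma DS_br X Y s : DS (nabS X Y - nabS Y X) s = DS X (DS Y s) - DS Y (DS X s).
Proof.
have second Z Z' : DS Z (DS Z' s) = \sum_i DS Z (Z' 0 i) * pd i s
    + \sum_i \sum_k Z 0 k * Z' 0 i * pd k (pd i s).
  rewrite {2}/DS DS_sum -big_split; apply: eq_bigr => i _ /=.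
  rewrite DS_mul; congr (_ + _); rewrite {1}/DS mulr_sumr; apply: eq_bigr => k _.
  by rewrite mulrCA mulrA.
have sym : \sum_i \sum_k X 0 k * Y 0 i * pd k (pd i s) =
    \sum_i \sum_k Y 0 k * X 0 i * pd k (pd i s).
  rewrite [RHS]exchange_big; apply: eq_bigr => i _; apply: eq_bigr => k _ /=.
  by rewrite pd_comm (mulrC (X 0 k)).
rewrite nabS_br !second sym opprD addrACA subrr addr0 -sumrB.
by apply: eq_bigr => i _; rewrite !mxE mulrBl.
Qed.
End Connection.

(** * Derivatives of bilinear forms and of composites *)
Section Curves.
Variables (R : realType) (m : nat).

Lemma bformE (A : 'M[R]_m) u v : bform A u v = \sum_i \sum_j u 0 i * A i j * v 0 j.
Proof.
rewrite /bform mxE exchange_big /=; apply: eq_bigr => i _.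
by rewrite !mxE mulr_suml.
Qed.

Lemma is_derive_mx_coord (V : normedModType R) p q (F : V -> 'M[R]_(p, q)) (x v : V) dF i j :
  is_derive x v F dF -> is_derive x v (fun y => F y i j : R^o) (dF i j).
Proof.
move=> [dF_ dF_E]; apply: DeriveDef; first by have /derivable_mxP/(_ i j) := dF_.
by rewrite -dF_E derive_coord.
Qed.

Lemma is_derive_bform (V : normedModType R) (Q : V -> 'M[R]_m) (al be : V -> 'rV[R]_m)
    (x v : V) dQ da db :
  is_derive x v Q dQ -> is_derive x v al da -> is_derive x v be db ->
  is_derive x v (fun y => bform (Q y) (al y) (be y) : R^o)
    (bform dQ (al x) (be x) + bform (Q x) da (be x) + bform (Q x) (al x) db).
Proof.
move=> hQ ha hb.
have -> : (fun y => bform (Q y) (al y) (be y) : R^o) =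
    \sum_i \sum_j (fun y => al y 0 i * Q y i j * be y 0 j : R^o).
  apply: funext => s; rewrite bformE fct_sumE; apply: eq_bigr => i _.
  by rewrite fct_sumE.
rewrite !bformE -!big_split /=.
apply: is_derive_sum => i; rewrite -!big_split /=; apply: is_derive_sum => j.
have d1 := is_derive_mx_coord 0 i ha; have d2 := is_derive_mx_coord 0 j hb.
have d3 := is_derive_mx_coord i j hQ.
have d4 : is_derive x v (fun y => al y 0 i * Q y i j : R^o) _ := is_deriveM d1 d3.
apply: (is_derive_eq (is_deriveM d4 d2)).
rewrite /GRing.scale /=; ring.
Qed.

Lemma derive_bform (V : normedModType R) (Q : V -> 'M[R]_m) (x v : V) u w :
  derivable Q x v -> 'D_v (fun y => bform (Q y) u w : R^o) x = bform ('D_v Q x) u w.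
Proof.
move=> dQ.
have h := is_derive_bform (derivableP dQ) (is_derive_cst u x v) (is_derive_cst w x v).
rewrite (@derive_val _ _ _ _ _ _ _ h) /bform.
by rewrite !(mul0mx, trmx0, mulmx0) !mxE !addr0.
Qed.

Lemma is_derive_comp_curve (V W : normedModType R) (f : V -> W) (gam : R -> V) (t : R) v :
  differentiable f (gam t) -> is_derive t (1 : R) gam v ->
  is_derive t (1 : R) (fun s => f (gam s)) ('D_v f (gam t)).
Proof.
move=> df [dg gE]; have dg' : differentiable gam t by apply/derivable1_diffP.
apply: DeriveDef.
  apply: diff_derivable; exact: differentiable_comp dg' df.
by rewrite -[fun s => _]/(f \o gam) derive_comp // gE.
Qed.

Lemma is_derive_bform_curve (Q : 'rV[R]_m -> 'M[R]_m) (gam beta : R -> 'rV[R]_m) (t : R) db :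
  differentiable Q (gam t) -> is_derive t (1 : R) gam (beta t) ->
  is_derive t (1 : R) beta db ->
  is_derive t (1 : R) (fun s => bform (Q (gam s)) (beta s) (beta s) : R^o)
    ('D_(beta t) (fun y => bform (Q y) (beta t) (beta t)) (gam t)
     + bform (Q (gam t)) db (beta t) + bform (Q (gam t)) (beta t) db).
Proof.
move=> dQ dg dbeta; rewrite derive_bform; last exact: diff_derivable.
exact: (is_derive_bform (is_derive_comp_curve dQ dg) dbeta dbeta).
Qed.

Lemma derive2_comp p (A : set 'rV[R]_m) (A' : set 'rV[R]_p) (phi : 'rV[R]_m -> 'rV[R]_p)
    (h : 'rV[R]_p -> R) x u v :
  open A -> open A' -> smooth_on A phi -> smooth_on A' h ->
  (forall y, A y -> A' (phi y)) -> A x ->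
  'D_u ('D_v (h \o phi)) x = 'D_('D_u phi x) ('D_('D_v phi x) h) (phi x)
    + 'D_('D_u ('D_v phi) x) h (phi x).
Proof.
move=> oA oA' sphi sh AA' Ax.
have dphi y : A y -> differentiable phi y by exact: (smooth_differentiable_mx oA sphi).
have dh y : A' y -> differentiable (h : _ -> R^o) y by exact: (smooth_differentiable oA' sh).
have first y : A y -> 'D_v (h \o phi) y = \sum_i 'D_v phi y 0 i * 'D_(delta_mx 0 i) h (phi y).
  by move=> Ay; rewrite derive_comp ?derive_sum_coord //;
    [exact/dh/AA' | exact: dphi | exact/dh/AA'].
have -> : 'D_u ('D_v (h \o phi)) x =
    'D_u (\sum_i (fun y => 'D_v phi y 0 i * 'D_(delta_mx 0 i) h (phi y) : R^o)) x.
  by apply: near_eq_derive; apply: (nbhs_open oA Ax) => y Ay; rewrite first // fct_sumE.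
have dv : differentiable ('D_v phi) x.
  exact: (smooth_differentiable_mx oA (smooth_derive v sphi)).
have dhi i : differentiable ('D_(delta_mx 0 i) h : _ -> R^o) (phi x).
  exact: (smooth_differentiable oA' (smooth_derive (delta_mx 0 i) sh) (AA' _ Ax)).
have term i : is_derive x u (fun y => 'D_v phi y 0 i * 'D_(delta_mx 0 i) h (phi y) : R^o)
    ('D_v phi x 0 i * 'D_('D_u phi x) ('D_(delta_mx 0 i) h) (phi x)
     + 'D_(delta_mx 0 i) h (phi x) * 'D_u ('D_v phi) x 0 i).
  have d1 : is_derive x u (fun y => 'D_v phi y 0 i : R^o) ('D_u ('D_v phi) x 0 i).
    exact: is_derive_mx_coord (derivableP (diff_derivable dv)).
  have d2 : is_derive x u (fun y => 'D_(delta_mx 0 i) h (phi y) : R^o)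
      ('D_('D_u phi x) ('D_(delta_mx 0 i) h) (phi x)).
    apply: DeriveDef.
      apply: diff_derivable; exact: differentiable_comp (dphi _ Ax) (dhi i).
    by rewrite -[fun y => _]/('D_(delta_mx 0 i) h \o phi) derive_comp //; exact: dphi.
  exact: (is_deriveM d1 d2).
rewrite (@derive_val _ _ _ _ _ _ _ (is_derive_sum term)) big_split /=; congr (_ + _).
  pose w := 'D_v phi x.
  have -> : 'D_('D_u phi x) ('D_('D_v phi x) h) (phi x) =
      'D_('D_u phi x) (\sum_i (fun y => w 0 i *: ('D_(delta_mx 0 i) h y : R^o))) (phi x).
    apply: near_eq_derive; apply: (nbhs_open oA' (AA' _ Ax)) => y A'y.
    by rewrite derive_sum_coord ?fct_sumE //; exact: dh.
  rewrite derive_sum => [|i]; last by apply: derivableZ; exact: diff_derivable.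
  by apply: eq_bigr => i _; rewrite deriveZ //; exact: diff_derivable.
rewrite derive_sum_coord; last exact/dh/AA'.
by apply: eq_bigr => i _; rewrite mulrC.
Qed.
End Curves.

(** * The submersion in charts *)
Section Charts.
Variables (R : realType).

Lemma crep_dom_open m n (M N : topologicalType) (a : chart R m M) (b : chart R n N) (f : M -> N) :
  continuous f -> open (crep_dom a b f).
Proof.
move=> cf; rewrite openE => x [ax bx].
have n1 : nbhs x (ch_cod a) by apply: open_nbhs_nbhs; split=> //; exact: ch_cod_open.
have n2 : nbhs (f (ch_inv a x)) (ch_dom b) by apply: open_nbhs_nbhs; split=> //;
  exact: ch_dom_open.
exact: filterI n1 (continuous_comp (ch_inv_cont ax) (cf _) n2).
Qed.

Lemma derive_crep_comp m n p (M N P : topologicalType) (a : chart R m M) (b : chart R n N)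
    (d : chart R p P) (f : M -> N) (h : N -> P) x v :
  open (crep_dom a b f) -> crep_dom a b f x ->
  differentiable (crep a b f) x -> differentiable (crep b d h) (crep a b f x) ->
  'D_v (crep a d (h \o f)) x = 'D_('D_v (crep a b f) x) (crep b d h) (crep a b f x).
Proof.
move=> oD Dx df dh; apply: etrans (derive_comp v df dh); apply: near_eq_derive.
apply: (nbhs_open oD Dx) => y [ay by_].
by rewrite /crep /= ch_mapK.
Qed.
End Charts.

Section SubmersionCharts.
Variables (R : realType) (m n : nat).
Variables (M : semiRiemannian R m) (B : semiRiemannian R n) (piM : M -> B).
Variable pi_sub : semiRiemannian_submersion piM.
Implicit Types (a : mf_idx M) (b : mf_idx B).

Lemma pi_dom_open a b : open (crep_dom (atlas a) (atlas b) piM).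
Proof. by apply: crep_dom_open; have [] := sub_smooth pi_sub. Qed.

Lemma pi_crep_smooth a b :
  smooth_on (crep_dom (atlas a) (atlas b) piM) (crep (atlas a) (atlas b) piM).
Proof. by have [_] := sub_smooth pi_sub; exact. Qed.

Lemma pi_crep_diff a b x : crep_dom (atlas a) (atlas b) piM x ->
  differentiable (crep (atlas a) (atlas b) piM) x.
Proof.
by move=> Dx; exact: (smooth_differentiable_mx (@pi_dom_open a b) (@pi_crep_smooth a b) Dx).
Qed.

Lemma trans_dom_open p (Q : manifold R p) (q q' : mf_idx Q) :
  open (crep_dom (atlas q) (atlas q') id).
Proof. by apply: crep_dom_open => z; exact: cvg_id. Qed.

Lemma trans_diff p (Q : manifold R p) (q q' : mf_idx Q) y : crep_dom (atlas q) (atlas q') id y ->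
  differentiable (crep (atlas q) (atlas q') id) y.
Proof.
move=> Dx.
exact: (smooth_differentiable_mx (@trans_dom_open _ _ q q') (@mf_smooth _ _ Q q q') Dx).
Qed.

Lemma verticalE a b x v : crep_dom (atlas a) (atlas b) piM x ->
  vertical piM a x v <-> 'D_v (crep (atlas a) (atlas b) piM) x = 0.
Proof.
move=> Dx; split=> [|D0 b' b'x]; first by apply; case: Dx.
have [ax bx] := Dx.
have Dy : crep_dom (atlas b) (atlas b') id (crep (atlas a) (atlas b) piM x).
  by split; [exact: ch_map_cod | rewrite /= /crep ch_mapK].
have dx := pi_crep_diff Dx; have dy := trans_diff Dy.
have := derive_crep_comp v (@pi_dom_open a b) Dx dx dy.
by rewrite D0 derive0.
Qed.

Lemma met_sym a x u v : ch_cod (atlas a) x -> met a x u v = met a x v u.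
Proof.
move=> ax; rewrite /met /bform.
have -> : v *m gram a x *m u^T = (u *m gram a x *m v^T)^T.
  by rewrite !trmx_mul trmxK gram_sym // mulmxA.
by rewrite [RHS]mxE.
Qed.
Lemma metDl a x u u' v : met a x (u + u') v = met a x u v + met a x u' v.
Proof. by rewrite /met /bform !mulmxDl mxE. Qed.
Lemma metZl a x (t : R) u v : met a x (t *: u) v = t * met a x u v.
Proof. by rewrite /met /bform -!scalemxAl mxE. Qed.
Lemma metDr a x u v v' : met a x u (v + v') = met a x u v + met a x u v'.
Proof. by rewrite /met /bform linearD /= mulmxDr mxE. Qed.
Lemma metZr a x (t : R) u v : met a x u (t *: v) = t * met a x u v.
Proof. by rewrite /met /bform linearZ /= -scalemxAr mxE. Qed.
Lemma met0l a x v : met a x 0 v = 0.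
Proof. by rewrite -(scale0r 0) metZl mul0r. Qed.

(** On an open set [W] of a chart that the submersion maps into one chart of the base,
horizontal and vertical projections are matrices over the ring of smooth functions on
[W]. The hypotheses of the algebraic part are checked for them. *)
Section Domain.
Variables (a : mf_idx M) (b : mf_idx B) (W : set 'rV[R]_m) (oW : open W).
Variable WD : W `<=` crep_dom (atlas a) (atlas b) piM.
Local Notation S := (smfun oW).
Local Notation E := 'rV[S]_m.
Local Notation f := (crep (atlas a) (atlas b) piM).
Implicit Types (x : pt W) (X Y Z U V : E).

Lemma sub_cod : W `<=` ch_cod (atlas a). Proof. by move=> y /WD[]. Qed.
Local Notation G := (gramS oW sub_cod).
Local Notation Gi := (ginvS oW sub_cod).
Local Notation g := (gS sub_cod).
Local Notation nab := (nabS sub_cod).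

Lemma pi_coord_smooth k : smooth_on W (fun y => f y 0 k : R^o).
Proof. exact: (smooth_sub WD (smooth_coord 0 k (@pi_dom_open a b) (@pi_crep_smooth a b))). Qed.
Definition piS k : S := mks oW (pi_coord_smooth k).
Definition dpiS : 'M[S]_(m, n) := \matrix_(i, k) pd i (piS k).
Definition dpi_at x : 'M[R]_(m, n) := map_mx (evs x) dpiS.

Lemma dpiS_coord X k : (X *m dpiS) 0 k = DS X (piS k).
Proof. by rewrite mxE; apply: eq_bigr => i _; rewrite mxE. Qed.

Lemma derive_pi x v : 'D_v f (sval x) = v *m dpi_at x.
Proof.
have dx := pi_crep_diff (WD (svalP x)).
apply/rowP => k; rewrite derive_coord; last exact: diff_derivable.
have -> : 'D_v (fun y => f y 0 k : R^o) (sval x) = 'D_v (sapp (piS k)) (sval x).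
  by apply: (derive_near oW) => y Wy; rewrite mksE.
rewrite derive_sum_coord; last exact: sdiff.
by rewrite mxE; apply: eq_bigr => i _; rewrite !mxE evs_pd.
Qed.

Lemma vertical_dpi x v : vertical piM a (sval x) v <-> v *m dpi_at x = 0.
Proof. by rewrite -derive_pi; exact/verticalE/WD/svalP. Qed.

Lemma dpi_onto x (w : 'rV[R]_n) : exists v, v *m dpi_at x = w.
Proof.
by have [v] := sub_onto pi_sub (WD (svalP x)) w; rewrite derive_pi; exists v.
Qed.

(** The matrix of the cometric pushed forward to the base. Its inverse is the metric of
the base read in the chart of the base. *)
Definition cogramS : 'M[S]_n := dpiS^T *m Gi *m dpiS.

(** A row [w] in the kernel gives a vector [z] that is both vertical and orthogonal to
the vertical ones, hence zero as the fibres are nondegenerate; then [w] kills the image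
of the differential, which is everything. *)
Lemma cogramS_unit x : map_mx (evs x) cogramS \in unitmx.
Proof.
rewrite -row_free_unit; apply: inj_row_free => w.
rewrite !map_mxM -map_trmx ev_ginv -/(dpi_at x) !mulmxA => w0.
have ax := sub_cod (svalP x).
pose z := w *m (dpi_at x)^T *m invmx (gram a (sval x)).
have vz : vertical piM a (sval x) z by apply/vertical_dpi.
have z0 : z = 0.
  apply: (sub_nondeg pi_sub ax vz) => u /vertical_dpi uF.
  rewrite /met /bform /z mulmxKV ?gram_unit // -mulmxA -trmx_mul uF.
  by rewrite trmx0 mulmx0 mxE.
have wF : w *m (dpi_at x)^T = 0.
  by rewrite -[LHS](mulmxKV (gram_unit ax)) -/z z0 mul0mx.
have [v vw] := dpi_onto x w.
apply/rowP => i; rewrite mxE.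
have : w *m w^T = 0 by rewrite -{2}vw trmx_mul mulmxA wF mul0mx.
move=> /matrixP/(_ 0 0); rewrite !mxE => /eqP.
rewrite psumr_eq0 => [/allP/(_ i (mem_index_enum _))|j _].
  by rewrite mxE mulf_eq0 orbb => /eqP.
by rewrite mxE -expr2 sqr_ge0.
Qed.

Lemma det_cogramS_inv : exists t, t * \det cogramS = 1 :> S.
Proof.
by apply: sinv_ex => x; rewrite -det_map_mx -unitfE -unitmxE; exact: cogramS_unit.
Qed.
Definition base_gramS : 'M[S]_n := sval (cid det_cogramS_inv) *: \adj cogramS.
Lemma mul_base_gramS : base_gramS *m cogramS = 1%:M.
Proof.
rewrite /base_gramS; case: cid => t /= ht.
by rewrite -scalemxAl mul_adj_mx scale_scalar_mx ht.
Qed.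
Lemma ginvS_sym : Gi^T = Gi.
Proof.
rewrite -[LHS]mul1mx -(mul_ginvS oW sub_cod) -mulmxA -{1}(gramS_sym oW sub_cod) -trmx_mul.
by rewrite mul_ginvS trmx1 mulmx1.
Qed.
Lemma base_gramS_sym : base_gramS^T = base_gramS.
Proof.
have S0_sym : cogramS^T = cogramS by rewrite /cogramS !trmx_mul trmxK ginvS_sym mulmxA.
rewrite -[LHS]mul1mx -mul_base_gramS -mulmxA -{1}S0_sym -trmx_mul.
by rewrite mul_base_gramS trmx1 mulmx1.
Qed.

(** The horizontal lift of tangent vectors of the base. *)
Definition liftS : 'M[S]_(n, m) := base_gramS *m dpiS^T *m Gi.
Lemma liftS_dpiS : liftS *m dpiS = 1%:M.
Proof. by rewrite /liftS -!mulmxA (mulmxA dpiS^T) mul_base_gramS. Qed.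
Lemma liftS_gram : liftS *m G = base_gramS *m dpiS^T.
Proof. by rewrite /liftS -mulmxA mul_ginvS mulmx1. Qed.

Definition vpS X : E := X - X *m dpiS *m liftS.

Lemma vpS_dpiS X : vpS X *m dpiS = 0.
Proof. by rewrite /vpS mulmxBl -(mulmxA (X *m dpiS)) liftS_dpiS mulmx1 subrr. Qed.
Lemma vpS_id X : X *m dpiS = 0 -> vpS X = X.
Proof. by move=> XF; rewrite /vpS XF mul0mx subr0. Qed.
Lemma dpiS_ver X : vpS X = X -> X *m dpiS = 0.
Proof. by move=> <-; exact: vpS_dpiS. Qed.
Lemma vpS_liftS (w : 'rV[S]_n) : vpS (w *m liftS) = 0.
Proof. by rewrite /vpS -(mulmxA w liftS) liftS_dpiS mulmx1 subrr. Qed.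

Lemma vpSD X Y : vpS (X + Y) = vpS X + vpS Y.
Proof. by rewrite /vpS !mulmxDl opprD addrACA. Qed.
Lemma vpSZ s X : vpS (s *: X) = s *: vpS X.
Proof. by rewrite /vpS -!scalemxAl scalerBr. Qed.
Lemma vpSK X : vpS (vpS X) = vpS X.
Proof. exact/vpS_id/vpS_dpiS. Qed.

Lemma gSDl X Y Z : g (X + Y) Z = g X Z + g Y Z.
Proof. by rewrite /gS !mulmxDl mxE. Qed.
Lemma gSZl s X Z : g (s *: X) Z = s * g X Z.
Proof. by rewrite /gS -!scalemxAl mxE. Qed.
Lemma gSC X Y : g X Y = g Y X.
Proof.
rewrite /gS; have -> : Y *m G *m X^T = (X *m G *m Y^T)^T.
  by rewrite !trmx_mul trmxK gramS_sym mulmxA.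
by rewrite [RHS]mxE.
Qed.
Lemma gS_ndg X : (forall Y, g X Y = 0) -> X = 0.
Proof.
move=> X0; rewrite -[LHS]mulmx1 -(mul_gram_ginvS oW sub_cod) mulmxA.
suff -> : X *m G = 0 by rewrite mul0mx.
apply/rowP => i; have := X0 (delta_mx 0 i).
by rewrite /gS trmx_delta -colE !mxE.
Qed.
Lemma gram_liftS : G *m liftS^T = dpiS *m base_gramS.
Proof. by rewrite -(gramS_sym oW sub_cod) -trmx_mul liftS_gram trmx_mul trmxK base_gramS_sym. Qed.
Lemma gS_vpS X Y : g (vpS X) Y = g X (vpS Y).
Proof.
rewrite /gS /vpS [(Y - _)^T]linearB /= !mulmxBl mulmxBr; congr (fun_of_matrix (_ - _) 0 0).
have -> : X *m dpiS *m liftS *m G *m Y^T = X *m dpiS *m base_gramS *m dpiS^T *m Y^T.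
  by rewrite -(mulmxA _ liftS) liftS_gram !mulmxA.
by rewrite (trmx_mul (Y *m dpiS)) (trmx_mul Y) -!mulmxA (mulmxA G liftS^T) gram_liftS !mulmxA.
Qed.

Definition lift_at x : 'M[R]_(n, m) := map_mx (evs x) liftS.
Lemma lift_dpi x : lift_at x *m dpi_at x = 1%:M.
Proof. by rewrite /lift_at /dpi_at -map_mxM liftS_dpiS map_mx1. Qed.
Lemma lift_gram x : lift_at x *m gram a (sval x) = map_mx (evs x) base_gramS *m (dpi_at x)^T.
Proof. by rewrite /lift_at -(ev_gram oW sub_cod) -map_mxM liftS_gram map_mxM -map_trmx. Qed.

Lemma horizontal_lift x w : horizontal piM a (sval x) (w *m lift_at x).
Proof.
move=> u /vertical_dpi uF; rewrite /met /bform -(mulmxA w) lift_gram.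
by rewrite -!mulmxA -trmx_mul uF trmx0 !mulmx0 mxE.
Qed.

Lemma horizontal_vertical0 x v : horizontal piM a (sval x) v ->
  vertical piM a (sval x) v -> v = 0.
Proof. by move=> hv vv; exact: (sub_nondeg pi_sub (sub_cod (svalP x)) vv hv). Qed.

Lemma hpartE x v : hpart piM a (sval x) v = v *m dpi_at x *m lift_at x.
Proof.
set w := v *m dpi_at x *m lift_at x.
have hw : horizontal piM a (sval x) w by exact: horizontal_lift.
have vw : vertical piM a (sval x) (v - w).
  by apply/vertical_dpi; rewrite mulmxBl -mulmxA lift_dpi mulmx1 subrr.
have [h1 v1] : horizontal piM a (sval x) (hpart piM a (sval x) v) /\
    vertical piM a (sval x) (v - hpart piM a (sval x) v).
  by apply: (@xgetPex _ 0 (fun w0 => horizontal piM a (sval x) w0 /\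
    vertical piM a (sval x) (v - w0))); exists w.
have metN u u' : met a (sval x) (- u) u' = - met a (sval x) u u'.
  by rewrite -scaleN1r metZl mulN1r.
apply/eqP; rewrite -subr_eq0; apply/eqP/(@horizontal_vertical0 x) => [u vu|].
  by rewrite metDl metN (h1 _ vu) (hw _ vu) subrr.
apply/vertical_dpi; move/vertical_dpi: v1 => v1; move/vertical_dpi: vw => vw.
have -> : hpart piM a (sval x) v - w = (v - w) - (v - hpart piM a (sval x) v).
  by rewrite opprB [RHS]addrC subrKA.
by rewrite mulmxBl vw v1 subrr.
Qed.

Lemma fld_hpart x X : fld (X *m dpiS *m liftS) (sval x) = hpart piM a (sval x) (fld X (sval x)).
Proof. by rewrite hpartE !fldE /dpi_at /lift_at -!map_mxM. Qed.
Lemma fld_vpart x X : fld (vpS X) (sval x) = vpart piM a (sval x) (fld X (sval x)).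
Proof. by rewrite /vpart -fld_hpart !fldE -map_mxB. Qed.

Lemma fld_inj X Y : (forall x, fld X (sval x) = fld Y (sval x)) -> X = Y.
Proof.
move=> e; apply/rowP => i; apply: (evs_inj (oW := oW)) => x.
by have /rowP/(_ i) := e x; rewrite !fldE !mxE.
Qed.

Lemma fld_vertical X : vpS X = X <-> forall x, vertical piM a (sval x) (fld X (sval x)).
Proof.
split=> [vX x|vX].
  by apply/vertical_dpi; rewrite fldE /dpi_at -map_mxM dpiS_ver // map_mx0.
apply: vpS_id; apply/matrixP => i k; apply: (evs_inj (oW := oW)) => x; rewrite ord1.
have /vertical_dpi/rowP/(_ k) := vX x.
by rewrite fldE /dpi_at -map_mxM !mxE rmorph0 => ->.
Qed.

Hypothesis B_riem : riemannian B.

Lemma horizontal_pos x v : horizontal piM a (sval x) v -> v != 0 -> 0 < met a (sval x) v v.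
Proof.
move=> hv v0; rewrite -(sub_isom pi_sub (WD (svalP x)) hv hv).
apply: B_riem; first by have [_ /ch_map_cod] := WD (svalP x).
apply: contra v0 => /eqP Dv0; apply/eqP/(@horizontal_vertical0 x) => //.
by apply/vertical_dpi; rewrite -derive_pi.
Qed.

Lemma horizontal_ge0 x v : horizontal piM a (sval x) v -> 0 <= met a (sval x) v v.
Proof.
move=> hv; have [->|v0] := eqVneq v 0; first by rewrite met0l.
exact/ltW/horizontal_pos.
Qed.

Lemma leq_base_dim x : (n <= m)%N.
Proof.
have : row_free (lift_at x) by apply/row_freeP; exists (dpi_at x); exact: lift_dpi.
by rewrite -row_leq_rank => /leq_trans; apply; exact: rank_leq_col.
Qed.

Hypothesis M_index : sr_index M = (m - n)%N.

(** A maximal negative definite subspace has dimension [m - n], while the horizontal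
vectors and a vertical [v] span a space of dimension [n + 1]. The two share a nonzero
vector, whose square would be nonnegative if [v] were not timelike. *)
Lemma vertical_neg x v : vertical piM a (sval x) v -> v != 0 -> met a (sval x) v v < 0.
Proof.
move=> vv v0; rewrite ltNge; apply/negP => v_ge0.
have [[A [rA negA]] _] := gram_index (sub_cod (svalP x)).
have rL : \rank (lift_at x) = n.
  by apply/eqP; rewrite -/(row_free _); apply/row_freeP; exists (dpi_at x); exact: lift_dpi.
have rv : \rank v = 1%N by rewrite rank_rV v0.
have cap0 : (lift_at x :&: v)%MS = 0.
  apply/eqP; rewrite -submx0; apply/rV_subP => u;
    rewrite sub_capmx => /andP[/submxP[w ->] /submxP[t ut]].
  suff -> : w *m lift_at x = 0 by exact: sub0mx.
  apply: (@horizontal_vertical0 x); first exact: horizontal_lift.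
  by apply/vertical_dpi; rewrite ut -mulmxA (vertical_dpi x v).1 // mulmx0.
have rHv : \rank (lift_at x + v)%MS = n.+1.
  by have := mxrank_sum_cap (lift_at x) v; rewrite cap0 mxrank0 addn0 rL rv addn1.
have rcap : (0 < \rank (A :&: (lift_at x + v))%MS)%N.
  have := mxrank_sum_cap A (lift_at x + v)%MS; rewrite rA rHv M_index => e.
  have le : (\rank (A + (lift_at x + v))%MS <= m)%N by exact: rank_leq_col.
  rewrite lt0n; apply/eqP => z; move: e le; rewrite z addn0 => ->.
  by rewrite addnS (subnK (leq_base_dim x)) ltnn.
have [u uA u0] : exists2 u : 'rV[R]_m, (u <= A :&: (lift_at x + v))%MS & u != 0.
  by apply/rowV0Pn; rewrite -mxrank_eq0 -lt0n.
have [uA1 uHv] : (u <= A)%MS /\ (u <= lift_at x + v)%MS by apply/andP; rewrite -sub_capmx.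
have /sub_addsmxP[[w t] /= uE] := uHv.
have := negA u uA1 u0; rewrite -/(met a (sval x) u u) uE.
have [s ts] : exists s, t *m v = s *: v.
  by exists (t 0 0); rewrite {1}[t]mx11_scalar mul_scalar_mx.
rewrite ts metDl !metDr !metZr !metZl (met_sym v _ (sub_cod (svalP x))).
rewrite (horizontal_lift w vv) !mulr0 addr0 add0r mulrA.
rewrite ltNge addr_ge0 //; first exact/horizontal_ge0/horizontal_lift.
by rewrite mulr_ge0 // -expr2 sqr_ge0.
Qed.

Definition cfieldS (v : 'rV[R]_m) : E := map_mx (scst oW) v.
Lemma fld_cfield x v : fld (cfieldS v) (sval x) = v.
Proof. by rewrite fldE; apply/rowP => i; rewrite !mxE evs_cst. Qed.

Lemma vpS0 : vpS 0 = 0.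
Proof. by rewrite /vpS !mul0mx subr0. Qed.

Hypothesis r_ge2 : (2 <= m - n)%N.

(** Being vertical and orthogonal to [U] at [x] are [n + 1] linear conditions on a vector
of length [m]. *)
Lemma exists_ver_orthS x U : vpS U = U -> exists V,
  [/\ vpS V = V, evs x (g U V) = 0 & evs x (g V V) != 0].
Proof.
move=> vU; pose Gu := gram a (sval x) *m (fld U (sval x))^T.
have [v v0 vK] : exists2 v : 'rV[R]_m, v != 0 & v *m row_mx (dpi_at x) Gu = 0.
  have : kermx (row_mx (dpi_at x) Gu) != 0.
    rewrite -mxrank_eq0 mxrank_ker -lt0n subn_gt0.
    apply: (leq_ltn_trans (rank_leq_col _)).
    by rewrite -ltn_subRL.
  by case/rowV0Pn => v /sub_kermxP vK v0; exists v.
have [vF vG] : v *m dpi_at x = 0 /\ v *m Gu = 0.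
  by move: vK; rewrite mul_mx_row -[0 in RHS]row_mx0 => /eq_row_mx[].
have vv : vertical piM a (sval x) v by apply/vertical_dpi.
have fV : fld (vpS (cfieldS v)) (sval x) = v.
  by rewrite fld_vpart fld_cfield /vpart hpartE vF mul0mx subr0.
exists (vpS (cfieldS v)); split; first exact: vpSK.
  by rewrite gSC evs_g fV /met /bform -mulmxA -/Gu vG mxE.
by rewrite evs_g fV lt_eqF // vertical_neg.
Qed.

(** Horizontal lifts of the fields of the base with constant coefficients. They span all
horizontal fields over the functions, and no more general basic fields occur. *)
Definition basicS X := exists w : 'rV[R]_n, X = map_mx (scst oW) w *m liftS.

Lemma basicS_hor X : basicS X -> vpS X = 0.
Proof. by case=> w ->; exact: vpS_liftS. Qed.
Lemma scstD (r s : R) : scst oW (r + s) = scst oW r + scst oW s.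
Proof. by apply: (evs_inj (oW := oW)) => x; rewrite rmorphD /= !evs_cst. Qed.
Lemma scstN (r : R) : scst oW (- r) = - scst oW r.
Proof. by apply: (evs_inj (oW := oW)) => x; rewrite rmorphN /= !evs_cst. Qed.
Lemma basicSD X Y : basicS X -> basicS Y -> basicS (X + Y).
Proof.
case=> w -> [w' ->]; exists (w + w'); rewrite -mulmxDl; congr (_ *m _).
by apply/matrixP => i k; rewrite !mxE scstD.
Qed.
Lemma basicSN X : basicS X -> basicS (- X).
Proof.
case=> w ->; exists (- w); rewrite -mulNmx; congr (_ *m _).
by apply/matrixP => i k; rewrite !mxE scstN.
Qed.

Lemma DS_DS_const X Y (w : 'rV[R]_n) k : Y *m dpiS = map_mx (scst oW) w ->
  DS X (DS Y (piS k)) = 0.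
Proof. by move=> YF; rewrite -dpiS_coord YF mxE DS_cst. Qed.

(** The coordinates of the submersion have constant derivatives along both fields, so
the bracket kills them. *)
Lemma bracket_verS X Y (w w' : 'rV[R]_n) : X *m dpiS = map_mx (scst oW) w ->
  Y *m dpiS = map_mx (scst oW) w' -> vpS (nab X Y - nab Y X) = nab X Y - nab Y X.
Proof.
move=> XF YF; apply: vpS_id; apply/matrixP => i k; rewrite ord1 dpiS_coord DS_br.
by rewrite (DS_DS_const _ _ XF) (DS_DS_const _ _ YF) subr0 mxE.
Qed.
Lemma dpiS_ver_const U : vpS U = U -> U *m dpiS = map_mx (scst oW) (0 : 'rV[R]_n).
Proof.
by move=> /dpiS_ver ->; apply/matrixP => i k; rewrite !mxE.
Qed.

(** The scalar product of two basic fields is that of their projections, a function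
lifted from the base. *)
Lemma DS_g_basic X Y U : basicS X -> basicS Y -> vpS U = U -> DS U (g X Y) = 0.
Proof.
case=> w -> [w' ->] vU; apply: (evs_inj (oW := oW)) => x.
have fl x' (u : 'rV[R]_n) : fld (map_mx (scst oW) u *m liftS) (sval x') = u *m lift_at x'.
  rewrite fldE map_mxM; congr (_ *m _).
  by apply/matrixP => i k; rewrite !mxE /= evs_cst.
rewrite evs_D rmorph0.
have -> : 'D_(fld U (sval x)) (sapp (g (map_mx (scst oW) w *m liftS) (map_mx (scst oW) w' *m
  liftS))) (sval x)
   = 'D_(fld U (sval x)) ((fun y => met b y w w' : R^o) \o f) (sval x).
  apply: (derive_near oW) => y Wy.
  rewrite -[LHS]/(evs (exist _ y Wy) _) evs_g !fl.
  have := sub_isom pi_sub (WD Wy) (@horizontal_lift (exist _ y Wy) w) (@horizontal_lift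
    (exist _ y Wy) w').
  by rewrite !(derive_pi (exist _ y Wy)) -!mulmxA lift_dpi !mulmx1 => <-.
have [ax bx] := WD (svalP x).
rewrite derive_comp; first last.
- have by_ : ch_cod (atlas b) (f (sval x)) by exact: ch_map_cod.
  have -> : (fun y => met b y w w' : R^o) =
      \sum_(i < n) \sum_(k < n) (fun y => (w 0 i * w' 0 k) *: (gram b y i k : R^o)).
    apply: funext => y; rewrite /met /bform mxE.
    under eq_bigr do rewrite mxE mulr_suml.
    rewrite exchange_big fct_sumE; apply: eq_bigr => i _; rewrite fct_sumE.
    by apply: eq_bigr => k _; rewrite !mxE /GRing.scale /=; ring.
  apply: differentiable_sum => i; apply: differentiable_sum => k.
  apply: differentiableZ.
  exact: (smooth_differentiable (@ch_cod_open _ _ _ (atlas b))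
    (smooth_coord i k (@ch_cod_open _ _ _ (atlas b)) (@gram_smooth _ _ B b)) by_).
- exact: pi_crep_diff (WD (svalP x)).
by rewrite ((verticalE _ (WD (svalP x))).1 ((fld_vertical U).1 vU x)) derive0.
Qed.

Lemma hor_indS (P : E -> Prop) :
  (forall X Y, P X -> P Y -> P (X + Y)) -> (forall s X, P X -> P (s *: X)) ->
  (forall X, basicS X -> P X) -> forall X, vpS X = 0 -> P X.
Proof.
move=> PD PZ Pb X /eqP; rewrite subr_eq0 => /eqP ->.
have P0 : P 0.
  have := PZ 0 _ (Pb _ (ex_intro _ 0 erefl)); by rewrite scale0r.
rewrite (row_sum_delta (X *m dpiS)) mulmx_suml.
apply: (big_ind P) => // k _; rewrite -scalemxAl; apply/PZ/Pb.
exists (delta_mx 0 k); congr (_ *m _); apply/matrixP => i l.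
by rewrite !mxE; case: (_ && _).
Qed.

Lemma hor_definiteS x X Y : vpS X = 0 -> evs x (g X X) = 0 -> evs x (g X Y) = 0.
Proof.
move=> hX; rewrite !evs_g => X0; have [->|nz] := eqVneq (fld X (sval x)) 0; first
  by rewrite met0l.
have : horizontal piM a (sval x) (fld X (sval x)).
  move: hX => /eqP; rewrite subr_eq0 => /eqP ->.
  by rewrite fld_hpart hpartE; exact: horizontal_lift.
by move=> /horizontal_pos/(_ nz); rewrite X0 ltxx.
Qed.
Lemma ver_definiteS x X Y : vpS X = X -> evs x (g X X) = 0 -> evs x (g X Y) = 0.
Proof.
move=> vX; rewrite !evs_g => X0; have [->|nz] := eqVneq (fld X (sval x)) 0; first
  by rewrite met0l.
have := (fld_vertical X).1 vX x.
by move=> /vertical_neg/(_ nz); rewrite X0 ltxx.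
Qed.

Hypothesis pi_umb : totally_umbilic_fibres piM (m - n).
Variable c : R.
Hypothesis M_curv : constant_curvature M c.
Hypothesis H_neq : forall y, W y -> normalized_H_sq piM (m - n) a y <> - c.
Variable U0 : E.
Hypothesis verU0 : vpS U0 = U0.

(** A vertical field without null points gives the normalized mean curvature as a
quotient, and thereby its smoothness: umbilicity yields it only multiplied by the scalar
products of vertical fields. *)
Hypothesis U0_neq0 : forall x, evs x (g U0 U0) != 0.

Lemma nab_hor_umb x U V : vpS U = U -> vpS V = V ->
  fld (nab U V *m dpiS *m liftS) (sval x) = evs x (g U V) *: normalized_H piM (m - n) a (sval x).
Proof.
move=> vU vV.
have vf Z : vpS Z = Z -> vertical_field piM a W (fld Z).
  move=> vZ; split; first exact: fld_smooth.
  by move=> y Wy; exact: ((fld_vertical Z).1 vZ (exist _ y Wy)).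
have := pi_umb oW sub_cod (vf _ vU) (vf _ vV) (svalP x).
rewrite /Ttensor -(fld_nab (oW := oW) sub_cod) -fld_hpart => ->.
by rewrite /normalized_H evs_g !scalerA mulrC.
Qed.

Lemma meanS_ex : exists NN : E, forall x, fld NN (sval x) = normalized_H piM (m - n) a (sval x).
Proof.
have [t ht] := sinv_ex U0_neq0.
exists (t *: (nab U0 U0 *m dpiS *m liftS)) => x.
rewrite fldE map_mxZ -fldE nab_hor_umb // scalerA -rmorphM ht rmorph1.
by rewrite scale1r.
Qed.

Definition meanS : E := sval (cid meanS_ex).
Lemma fld_mean x : fld meanS (sval x) = normalized_H piM (m - n) a (sval x).
Proof. exact: (svalP (cid meanS_ex)). Qed.

Lemma umbilicS U V : vpS U = U -> vpS V = V -> hor_part vpS (nab U V) = g U V *: meanS.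
Proof.
move=> vU vV; rewrite hor_partE /vpS opprB addrC subrK; apply: fld_inj => x.
by rewrite nab_hor_umb // [in RHS]fldE map_mxZ -fldE fld_mean.
Qed.

Lemma hor_meanS : vpS meanS = 0.
Proof.
have [t ht] := sinv_ex U0_neq0.
have -> : meanS = (t *: (nab U0 U0 *m dpiS)) *m liftS.
  have e := umbilicS verU0 verU0; rewrite hor_partE /vpS opprB addrC subrK in e.
  by rewrite -scalemxAl e scalerA ht scale1r.
exact: vpS_liftS.
Qed.

Lemma nabla_near x v (F F' : 'rV[R]_m -> 'rV[R]_m) : (forall y, W y -> F y = F' y) ->
  nabla a v F (sval x) = nabla a v F' (sval x).
Proof.
move=> FF; have dF : 'D_v F (sval x) = 'D_v F' (sval x).
  by apply: near_eq_derive; exact: (nbhs_open oW (svalP x) FF).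
exact: (f_equal2 (fun p q => p + christoffel_form a (sval x) v q) dF (FF _ (svalP x))).
Qed.

Lemma curvS X Y Z : nab X (nab Y Z) - nab Y (nab X Z) - nab (nab X Y - nab Y X) Z
  = scst oW c *: (g Y Z *: X - g X Z *: Y).
Proof.
apply: fld_inj => x.
have sub (P Q : E) : fld (P - Q) (sval x) = fld P (sval x) - fld Q (sval x).
  by rewrite !fldE map_mxB.
have scl (s : S) (P : E) : fld (s *: P) (sval x) = evs x s *: fld P (sval x).
  by rewrite !fldE map_mxZ.
rewrite !(sub, scl) evs_cst !evs_g.
have := M_curv oW sub_cod (fld_smooth X) (fld_smooth Y) (fld_smooth Z) (svalP x).
rewrite /curv => <-.
have second P Q V : fld (nab P (nab Q V)) (sval x) =
    nabla a (fld P (sval x)) (fun y => nabla a (fld Q y) (fld V) y) (sval x).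
  rewrite (fld_nab (oW := oW) sub_cod x P (nab Q V)).
  apply: (@nabla_near x (fld P (sval x)) (fld (nab Q V)) (fun y => nabla a (fld Q y) (fld V) y)).
  exact: (fun y Wy => fld_nab (oW := oW) sub_cod (exist _ y Wy) Q V).
rewrite (second X Y Z) (second Y X Z) (fld_nab (oW := oW) sub_cod x (nab X Y - nab Y X) Z).
rewrite (sub (nab X Y) (nab Y X)).
rewrite (fld_nab (oW := oW) sub_cod x X Y) (fld_nab (oW := oW) sub_cod x Y X).
by rewrite (nabla_torsion_free (fld X) (fld Y) (sub_cod (svalP x))).
Qed.

Lemma evs_addS x (s t : S) : evs x (s + t) = evs x s + evs x t. Proof. exact: rmorphD. Qed.
Lemma evs_mulS x (s t : S) : evs x (s * t) = evs x s * evs x t. Proof. exact: rmorphM. Qed.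
Lemma evs_inj0 (s : S) : (forall x, evs x s = 0) -> s = 0.
Proof. by move=> s0; apply: (evs_inj (oW := oW)) => x; rewrite s0 rmorph0. Qed.

Lemma nabS_addl X Y Z : nab (X + Y) Z = nab X Z + nab Y Z.
Proof.
rewrite /nabS; have -> : dm (X + Y) Z = dm X Z + dm Y Z.
  by apply/matrixP => i k; rewrite !mxE DS_addl.
by rewrite !(conn_mx_sym sub_cod _ Z) mulmxDl addrACA.
Qed.
Lemma nabS_Zl s X Z : nab (s *: X) Z = s *: nab X Z.
Proof.
rewrite /nabS; have -> : dm (s *: X) Z = s *: dm X Z.
  by apply/matrixP => i k; rewrite !mxE DS_Zl.
by rewrite !(conn_mx_sym sub_cod _ Z) -scalemxAl scalerDr.
Qed.
Lemma nabS_add X Y Z : nab X (Y + Z) = nab X Y + nab X Z.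
Proof. by rewrite /nabS dmD mulmxDl addrACA. Qed.
Lemma nabS_Z X s Y : nab X (s *: Y) = DS X s *: Y + s *: nab X Y.
Proof.
rewrite /nabS scalerDr -scalemxAl addrA; congr (_ + _).
by apply/matrixP => i k; rewrite !mxE DS_mul.
Qed.

Lemma gS_mean x : evs x (g meanS meanS) = normalized_H_sq piM (m - n) a (sval x).
Proof. by rewrite evs_g fld_mean. Qed.

Lemma fibre_curvS_neq0 x : evs x (fibre_curv g (scst oW c) meanS) != 0.
Proof.
rewrite fibre_curvE rmorphD /= evs_cst gS_mean addrC; apply/eqP => /eqP; rewrite addr_eq0 => /eqP.
exact/H_neq/svalP.
Qed.

Lemma DS_fibre_curv X : DS X (fibre_curv g (scst oW c) meanS) =
  2%:R * fibre_curv g (scst oW c) meanS * g meanS X.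
Proof.
apply: (@D_fibre_curv R (pt W) S E (fun x s => evs x s) evs_addS evs_mulS evs_inj0 g gSC
  gSDl gSZl gS_ndg
  (fun X s => DS X s) (@DS_addl _ _ _ _) (@DS_add _ _ _ _) (@DS_mul _ _ _ _) nab nabS_addl
    nabS_Zl nabS_add nabS_Z (nabS_met sub_cod)
  _ (scst oW c) (fun X => DS_cst X c) _ vpS vpSD vpSZ vpSK gS_vpS meanS hor_meanS umbilicS basicS
  basicS_hor basicSD basicSN _ _ DS_g_basic hor_indS _ _ exists_ver_orthS fibre_curvS_neq0).
- by move=> X' Y s; rewrite bracketE; exact: DS_br.
- by move=> X' Y Z; rewrite bracketE; exact: curvS.
- move=> X' U [w ->] vU; rewrite /ver bracketE; apply: bracket_verS (dpiS_ver_const vU) _.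
  by rewrite -mulmxA liftS_dpiS mulmx1.
- move=> X' Y [w ->] [w' ->]; rewrite /ver bracketE.
  by apply: bracket_verS; rewrite -mulmxA liftS_dpiS mulmx1.
- by move=> x X' Y hX _; exact: hor_definiteS.
- by move=> x X' Y vX _; exact: ver_definiteS.
Qed.

Lemma DS_g_vpS X : DS X (g (vpS X) (vpS X)) =
  2%:R * (g (nab X X) (vpS X) + g meanS X * g (vpS X) (vpS X)).
Proof.
apply: (@D_g_vp R (pt W) S E (fun x s => evs x s) evs_addS evs_inj0 g gSC gSDl gSZl gS_ndg
  (fun X s => DS X s) (@DS_add _ _ _ _) nab nabS_addl nabS_Zl nabS_add nabS_Z (nabS_met sub_cod)
  vpS vpSD vpSZ vpSK gS_vpS meanS hor_meanS umbilicS basicS basicS_hor _ DS_g_basic hor_indS).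
move=> X' U [w ->] vU; rewrite /ver bracketE; apply: bracket_verS (dpiS_ver_const vU) _.
by rewrite -mulmxA liftS_dpiS mulmx1.
Qed.

Definition fibre_curvature y : R := c + normalized_H_sq piM (m - n) a y.

Lemma fibre_curvatureE y : W y -> fibre_curvature y = sapp (fibre_curv g (scst oW c) meanS) y.
Proof.
move=> Wy; rewrite -[RHS]/(evs (exist _ y Wy) _) fibre_curvE evs_addS evs_cst.
by rewrite (gS_mean (exist _ y Wy)).
Qed.

Lemma fibre_curvature_diff x : differentiable (fibre_curvature : _ -> R^o) (sval x).
Proof.
apply: (smooth_differentiable oW _ (svalP x)).
apply: smooth_ext (sapp_smooth (fibre_curv g (scst oW c) meanS)) => // y Wy.
by rewrite fibre_curvatureE.
Qed.

Lemma fibre_curvature_derive x v : 'D_v fibre_curvature (sval x) =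
  2 * fibre_curvature (sval x) * met a (sval x) (normalized_H piM (m - n) a (sval x)) v.
Proof.
have := congr1 (evs x) (DS_fibre_curv (cfieldS v)).
rewrite evs_D fld_cfield !evs_mulS evs_g fld_mean fld_cfield => e.
have -> : 'D_v fibre_curvature (sval x) = 'D_v (sapp (fibre_curv g (scst oW c) meanS)) (sval x).
  by apply: (derive_near oW) => y; exact: fibre_curvatureE.
by rewrite e (fibre_curvatureE (svalP x)) (rmorph_nat (evs x) 2).
Qed.

(** The vertical projection as a matrix, and below the vertical part of the metric: a
velocity is a vector field along a curve only, so the matrices rather than the fields
have to be differentiated. *)
Definition vprojS : 'M[S]_m := 1%:M - dpiS *m liftS.
Lemma vpS_vproj X : vpS X = X *m vprojS.
Proof. by rewrite /vprojS mulmxBr mulmx1 mulmxA. Qed.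
Definition vgramS : 'M[S]_m := vprojS *m G *m vprojS^T.
Definition vgram (y : 'rV[R]_m) : 'M[R]_m := \matrix_(i, j) sapp (vgramS i j) y.

Lemma vgram_smooth : smooth_on W vgram.
Proof.
apply: smooth_mx => // i j; apply: (smooth_ext oW _ (sapp_smooth (vgramS i j))) => y _.
by rewrite [RHS]mxE.
Qed.

Lemma vgramE x : vgram (sval x) = map_mx (evs x) vgramS.
Proof. by apply/matrixP => i j; rewrite [LHS]mxE [RHS]mxE. Qed.

Lemma vpart_vproj x v : vpart piM a (sval x) v = v *m map_mx (evs x) vprojS.
Proof.
by rewrite -[in LHS](fld_cfield x v) -fld_vpart vpS_vproj fldE map_mxM -fldE fld_cfield.
Qed.

Lemma vgramP x u v : bform (vgram (sval x)) u v =
  met a (sval x) (vpart piM a (sval x) u) (vpart piM a (sval x) v).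
Proof.
rewrite vgramE /met /bform !vpart_vproj -(ev_gram oW sub_cod) /vgramS !map_mxM -map_trmx.
by rewrite trmx_mul !mulmxA.
Qed.

Lemma met_vpart x u v : met a (sval x) (vpart piM a (sval x) u) (vpart piM a (sval x) v)
  = met a (sval x) u (vpart piM a (sval x) v).
Proof.
have := congr1 (evs x) (gS_vpS (cfieldS u) (vpS (cfieldS v))).
by rewrite vpSK !evs_g (fld_vpart x (cfieldS u)) (fld_vpart x (cfieldS v)) (fld_cfield x u)
  (fld_cfield x v).
Qed.

Lemma fld_nab_cfield x v :
  fld (nab (cfieldS v) (cfieldS v)) (sval x) = christoffel_form a (sval x) v v.
Proof.
rewrite (fld_nab (oW := oW) sub_cod) fld_cfield /nabla fld_cfield.
have -> : 'D_v (fld (cfieldS v)) (sval x) = 'D_v (cst v) (sval x).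
  apply: near_eq_derive; apply: (nbhs_open oW (svalP x)) => y Wy.
  exact: (fld_cfield (exist _ y Wy) v).
by rewrite derive_cst add0r.
Qed.

Lemma vgram_derive x v : 'D_v (fun y => bform (vgram y) v v) (sval x) =
  2 * (met a (sval x) (christoffel_form a (sval x) v v) (vpart piM a (sval x) v) +
       met a (sval x) (normalized_H piM (m - n) a (sval x)) v *
       met a (sval x) (vpart piM a (sval x) v) (vpart piM a (sval x) v)).
Proof.
have := congr1 (evs x) (DS_g_vpS (cfieldS v)).
rewrite evs_D fld_cfield evs_mulS evs_addS evs_mulS !evs_g !fld_vpart fld_nab_cfield
  fld_mean !fld_cfield.
rewrite (rmorph_nat (evs x) 2) => <-.
apply: (derive_near oW) => y Wy.
by rewrite (vgramP (exist _ y Wy)) -[RHS]/(evs (exist _ y Wy) _) evs_g !fld_vpart !fld_cfield.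
Qed.

Lemma gram_derive x v : 'D_v (fun y => bform (gram a y) v v) (sval x) =
  2 * met a (sval x) (christoffel_form a (sval x) v v) v.
Proof.
have := congr1 (evs x) (nabS_met sub_cod (cfieldS v) (cfieldS v) (cfieldS v)).
rewrite (gSC (cfieldS v) (nab _ _)) evs_D fld_cfield evs_addS !evs_g fld_nab_cfield
  fld_cfield -mulr2n.
rewrite mulr_natl => <-.
apply: (derive_near oW) => y Wy.
by rewrite -[RHS]/(evs (exist _ y Wy) _) evs_g !fld_cfield.
Qed.

Lemma fibre_curvature_neq0 y : W y -> fibre_curvature y != 0.
Proof.
move=> Wy; have := fibre_curvS_neq0 (exist _ y Wy).
by rewrite -[evs _ _]/(sapp _ y) -fibre_curvatureE.
Qed.

(** Along a geodesic the squared length [q] of the velocity is constant, while the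
squared length [p] of its vertical part and the fibre curvature both have logarithmic
derivative [2 g(N, E)]: the former by [vgram_derive], the latter by
[fibre_curvature_derive]. *)
Lemma ratio_derive (gam : R -> 'rV[R]_m) (t : R) :
  W (gam t) -> derivable gam t 1 -> derivable (derive1 gam) t 1 ->
  derive1 (derive1 gam) t + christoffel_form a (gam t) (derive1 gam t) (derive1 gam t) = 0 ->
  met a (gam t) (derive1 gam t) (derive1 gam t) < 0 ->
  is_derive t (1 : R) (fun s =>
    met a (gam s) (vpart piM a (gam s) (derive1 gam s)) (vpart piM a (gam s) (derive1 gam s))
     / (fibre_curvature (gam s) * met a (gam s) (derive1 gam s) (derive1 gam s)) : R^o) 0.
Proof.
move=> Wt dg db geo tl; pose x : pt W := exist _ _ Wt.
pose beta := derive1 gam; pose v := beta t; pose db' := derive1 (derive1 gam) t.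
have ax := sub_cod Wt.
have dg1 : is_derive t (1 : R) gam (beta t).
  exact: DeriveDef dg (esym (derive1E gam t)).
have db1 : is_derive t (1 : R) beta db'.
  exact: DeriveDef db (esym (derive1E beta t)).
pose Ga := christoffel_form a (gam t) v v.
have dbE : db' = - Ga by apply/eqP; rewrite -addr_eq0; apply/eqP.
have nW : \forall s \near t, W (gam s).
  have cg : {for t, continuous gam}.
    exact: (differentiable_continuous ((derivable1_diffP _ _).1 dg)).
  by apply: cg; apply: open_nbhs_nbhs.
pose p s := bform (vgram (gam s)) (beta s) (beta s).
pose q s := bform (gram a (gam s)) (beta s) (beta s).
pose nv := met a (gam t) (normalized_H piM (m - n) a (gam t)) v.
have metN u u' : met a (gam t) (- u) u' = - met a (gam t) u u'.
  by rewrite -scaleN1r metZl mulN1r.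
pose me := met a (gam t); pose vpa := vpart piM a (gam t).
have ptE : p t = met a (gam t) (vpart piM a (gam t) v) (vpart piM a (gam t) v)
  by exact: (vgramP x).
have d1 : is_derive t (1 : R) (p : R -> R^o) (2 * nv * p t).
  have dQ : differentiable vgram (gam t) by exact: (smooth_differentiable_mx oW vgram_smooth Wt).
  apply: (is_derive_eq (is_derive_bform_curve dQ dg1 db1)).
  have E0 : 'D_v (fun y => bform (vgram y) v v) (gam t) = 2 * (me Ga (vpa v) + nv * p t).
    by rewrite ptE; exact: (vgram_derive x v).
  have E1 : bform (vgram (gam t)) db' v = - me Ga (vpa v).
    by rewrite dbE -metN; exact: (etrans (vgramP x (- Ga) v) (met_vpart x (- Ga) v)).
  have E2 : bform (vgram (gam t)) v db' = - me Ga (vpa v).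
    rewrite -E1; exact: (etrans (vgramP x v db') (etrans (met_sym _ _ ax)
      (esym (vgramP x db' v)))).
  apply: (etrans (f_equal2 +%R (f_equal2 +%R E0 E1) E2)).
  by ring.
have d2 : is_derive t (1 : R) (fun s => fibre_curvature (gam s) : R^o)
    (2 * fibre_curvature (gam t) * nv).
  by apply: (is_derive_eq (is_derive_comp_curve (fibre_curvature_diff x) dg1));
    exact: (fibre_curvature_derive x v).
have d3 : is_derive t (1 : R) (q : R -> R^o) 0.
  have dG : differentiable (gram a) (gam t).
    exact: (smooth_differentiable_mx (@ch_cod_open _ _ _ (atlas a)) (@gram_smooth _ _ M a) ax).
  apply: (is_derive_eq (is_derive_bform_curve dG dg1 db1)).
  have E0 : 'D_v (fun y => bform (gram a y) v v) (gam t) = 2 * me Ga v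
    by exact: (gram_derive x v).
  have E1 : bform (gram a (gam t)) db' v = - me Ga v by rewrite dbE; exact: metN.
  have E2 : bform (gram a (gam t)) v db' = - me Ga v by rewrite -E1; exact: (met_sym _ _ ax).
  apply: (etrans (f_equal2 +%R (f_equal2 +%R E0 E1) E2)).
  by ring.
have Kt0 : fibre_curvature (gam t) != 0 by exact: fibre_curvature_neq0.
have q0 : q t != 0 by rewrite lt_eqF.
pose F s := fibre_curvature (gam s) * q s.
have d4 : is_derive t (1 : R) (F : R -> R^o) (F t * (2 * nv)).
  apply: (is_derive_eq (is_deriveM d2 d3)); rewrite /F /GRing.scale /=; ring.
have F0 : F t != 0 by rewrite mulf_neq0.
have d5 : is_derive t (1 : R) (fun s => p s * (F s)^-1 : R^o) 0.
  have d6 := is_deriveV F0 d4.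
  apply: (is_derive_eq (is_deriveM d1 d6)); rewrite /GRing.scale /=.
  by move: F0; move: (F t) => Ft F0; field.
have e : \forall s \near t, p s * (F s)^-1 =
    met a (gam s) (vpart piM a (gam s) (derive1 gam s)) (vpart piM a (gam s) (derive1 gam s))
     / (fibre_curvature (gam s) * met a (gam s) (derive1 gam s) (derive1 gam s)).
  by apply: filterS nW => s Ws; rewrite /p (vgramP (exist _ (gam s) Ws)).
by apply: near_eq_is_derive d5.
Qed.

Lemma hpart_spec x v : horizontal piM a (sval x) (hpart piM a (sval x) v) /\
  vertical piM a (sval x) (v - hpart piM a (sval x) v).
Proof.
rewrite hpartE; split; first exact: horizontal_lift.
by apply/vertical_dpi; rewrite mulmxBl -(mulmxA _ (lift_at x)) lift_dpi mulmx1 subrr.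
Qed.

(** The mean curvature in terms of the vertical Hessian of the submersion. The right-hand
side involves neither an orthonormal frame nor an arbitrary choice, which allows for
comparing charts. *)
Lemma mean_hessian x u : vertical piM a (sval x) u ->
  met a (sval x) u u *: 'D_(normalized_H piM (m - n) a (sval x)) f (sval x)
  = 'D_(christoffel_form a (sval x) u u) f (sval x) - 'D_u ('D_u f) (sval x).
Proof.
move=> /vertical_dpi uF; pose U := vpS (cfieldS u).
have fU : fld U (sval x) = u by rewrite fld_vpart fld_cfield /vpart hpartE uF mul0mx subr0.
have vU : vpS U = U by exact: vpSK.
have dUF : dm U U *m dpiS = - (U *m dm U dpiS).
  apply/eqP; rewrite -addr_eq0 -dmM (dpiS_ver vU); apply/eqP.
  by apply/matrixP => i k; rewrite !mxE DS0.
have e : map_mx (evs x) (nab U U) *m dpi_at x =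
    met a (sval x) u u *: (normalized_H piM (m - n) a (sval x) *m dpi_at x).
  have e0 : map_mx (evs x) (nab U U) *m dpi_at x *m lift_at x =
      met a (sval x) u u *: normalized_H piM (m - n) a (sval x).
    have := nab_hor_umb x vU vU; rewrite fldE (map_mxM _ (nab U U *m dpiS) liftS).
    by rewrite (map_mxM _ (nab U U) dpiS) evs_g fU.
  by rewrite scalemxAl -e0 -(mulmxA _ (lift_at x)) lift_dpi mulmx1.
rewrite !derive_pi -e -map_mxM /nabS mulmxDl dUF map_mxD map_mxN addrC; congr (_ - _).
  rewrite map_mxM -/(dpi_at x); congr (_ *m _); rewrite -fldE.
  have := fld_nab_cfield x u; rewrite /nabS.
  have -> : dm (cfieldS u) (cfieldS u) = 0 by apply/matrixP => i k; rewrite !mxE DS_cst.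
  rewrite add0r !fldE !map_mxM => <-; rewrite -!fldE fU fld_cfield; congr (_ *m _).
  apply/matrixP => i k; rewrite !mxE !rmorph_sum; apply: eq_bigr => l _ /=.
  rewrite !rmorphM; congr (_ * _).
  have /rowP/(_ l) : fld (cfieldS u) (sval x) = fld U (sval x) by rewrite fU fld_cfield.
  by rewrite !fldE [in X in X -> _]mxE [in X in _ = X -> _]mxE.
have dD : 'D_u ('D_u f) (sval x) =
    'D_u (fun y => u *m (\matrix_(i, k) sapp (dpiS i k) y)) (sval x).
  apply: near_eq_derive; apply: (nbhs_open oW (svalP x)) => y Wy.
  rewrite (derive_pi (exist _ y Wy)); congr (_ *m _).
  by apply/matrixP => i k; rewrite !mxE.
rewrite dD map_mxM -fldE fU; apply/rowP => k.
have dFS i : derivable (sapp (dpiS i k)) (sval x) u by apply: diff_derivable; exact: sdiff.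
have eE : (fun y => (u *m (\matrix_(i, k) sapp (dpiS i k) y)) 0 k : R^o) =
    \sum_i (fun y => u 0 i *: (sapp (dpiS i k) y : R^o)).
  apply: funext => y; rewrite mxE fct_sumE; apply: eq_bigr => i _; by rewrite mxE.
rewrite derive_coord; last first.
  apply/derivable_mxP => i l; rewrite ord1.
  have -> : (fun y => (u *m (\matrix_(i, k) sapp (dpiS i k) y)) 0 l) =
    \sum_i (fun y => u 0 i *: (sapp (dpiS i l) y : R^o)).
    apply: funext => y; rewrite mxE fct_sumE; apply: eq_bigr => i' _; by rewrite mxE.
  by apply: derivable_sum => i'; apply: derivableZ; apply: diff_derivable; exact: sdiff.
rewrite eE derive_sum => [|i]; last by apply: derivableZ; exact: dFS.
rewrite mxE; apply: eq_bigr => i _; rewrite deriveZ; last exact: dFS.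
have -> : map_mx (evs x) (dm U dpiS) i k = evs x (DS U (dpiS i k))
  by rewrite [LHS]mxE [in LHS]mxE.
by rewrite evs_D fU.
Qed.

Lemma christoffel_koszul x u w :
  2 * met a (sval x) (christoffel_form a (sval x) u u) w =
  2 * 'D_u (fun y => bform (gram a y) u w : R^o) (sval x)
  - 'D_w (fun y => bform (gram a y) u u : R^o) (sval x).
Proof.
have const_g (p q : 'rV[R]_m) v : 'D_v (fun y => bform (gram a y) p q : R^o) (sval x) =
    evs x (DS (cfieldS v) (g (cfieldS p) (cfieldS q))).
  rewrite evs_D fld_cfield; apply: (derive_near oW) => y Wy.
  by rewrite -[RHS]/(evs (exist _ y Wy) _) evs_g !fld_cfield.
have sym : nab (cfieldS u) (cfieldS w) = nab (cfieldS w) (cfieldS u).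
  have z p q : dm (cfieldS p) (cfieldS q) = 0 by apply/matrixP => i k; rewrite !mxE DS_cst.
  by rewrite /nabS !z !add0r conn_mx_sym.
rewrite !const_g !nabS_met sym (gSC (cfieldS u)) !evs_addS.
rewrite (evs_g sub_cod x (nab (cfieldS u) (cfieldS u)) (cfieldS w)) fld_nab_cfield fld_cfield.
ring.
Qed.

End Domain.
End SubmersionCharts.

(** * Pointwise consequences in an arbitrary chart *)
Section Global.
Variables (R : realType) (m n : nat).
Variables (M : semiRiemannian R m) (B : semiRiemannian R n) (piM : M -> B).
Hypothesis pi_sub : semiRiemannian_submersion piM.
Hypothesis B_riem : riemannian B.
Hypothesis M_index : sr_index M = (m - n)%N.
Hypothesis r_ge2 : (2 <= m - n)%N.
Implicit Types (a : mf_idx M) (b : mf_idx B) (x u v : 'rV[R]_m).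

Lemma base_chart a x : exists b, ch_cod (atlas a) x -> crep_dom (atlas a) (atlas b) piM x.
Proof. by have [b hb] := mf_cover (piM (ch_inv (atlas a) x)); exists b. Qed.

Definition dom_pt a b x (Dx : crep_dom (atlas a) (atlas b) piM x) :
  pt (crep_dom (atlas a) (atlas b) piM) :=
  exist _ x Dx.
Local Notation DD := (fun a b => @subset_refl _ (crep_dom (atlas a) (atlas b) piM)).

Lemma hpart_spec_at a x v : ch_cod (atlas a) x ->
  horizontal piM a x (hpart piM a x v) /\ vertical piM a x (v - hpart piM a x v).
Proof.
have [b hb] := base_chart a x => /hb Dx.
exact: (hpart_spec pi_sub (pi_dom_open pi_sub (a := a) (b := b)) (DD a b) (dom_pt Dx) v).
Qed.

Lemma vertical_neg_at a x v : ch_cod (atlas a) x -> vertical piM a x v -> v != 0 ->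
  met a x v v < 0.
Proof.
have [b hb] := base_chart a x => /hb Dx.
exact: (vertical_neg pi_sub (pi_dom_open pi_sub (a := a) (b := b)) (DD a b) B_riem
  M_index (x := dom_pt Dx)).
Qed.

Lemma horizontal_ge0_at a x v : ch_cod (atlas a) x -> horizontal piM a x v -> 0 <= met a x v v.
Proof.
have [b hb] := base_chart a x => /hb Dx.
exact: (horizontal_ge0 pi_sub (pi_dom_open pi_sub (a := a) (b := b)) (DD a b)
  B_riem (x := dom_pt Dx)).
Qed.

Lemma verticalB a x u v : ch_cod (atlas a) x -> vertical piM a x u -> vertical piM a x v ->
  vertical piM a x (u - v).
Proof.
have [b hb] := base_chart a x => /hb Dx.
have dx := pi_crep_diff pi_sub Dx.
rewrite !(verticalE pi_sub _ Dx) !deriveE // => hu hv.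
by rewrite linearB /= hu hv subrr.
Qed.

Lemma hpart_uniq a x v w : ch_cod (atlas a) x -> horizontal piM a x w ->
  vertical piM a x (v - w) ->
  hpart piM a x v = w.
Proof.
move=> ax hw vw; have [h1 v1] := hpart_spec_at v ax.
apply/eqP; rewrite -subr_eq0; apply/eqP; apply: (sub_nondeg pi_sub ax) => [|u vu].
  have -> : hpart piM a x v - w = (v - w) - (v - hpart piM a x v).
    by rewrite opprB [RHS]addrC subrKA.
  exact: verticalB.
by rewrite -scaleN1r metDl metZl (h1 _ vu) (hw _ vu) mulr0 addr0.
Qed.

Lemma met_vpart_at a x u v : ch_cod (atlas a) x ->
  met a x (vpart piM a x u) (vpart piM a x v) = met a x u (vpart piM a x v).
Proof.
have [b hb] := base_chart a x => /hb Dx.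
exact: (met_vpart pi_sub (pi_dom_open pi_sub (a := a) (b := b)) (DD a b) (dom_pt Dx)).
Qed.

Lemma vertical_vector a x : ch_cod (atlas a) x ->
  exists2 u, vertical piM a x u & u != 0.
Proof.
have [b hb] := base_chart a x => /hb Dx.
have [V [vV _ VV]] := exists_ver_orthS B_riem M_index r_ge2 (dom_pt Dx)
  (vpS0 pi_sub (pi_dom_open pi_sub (a := a) (b := b)) (DD a b)).
exists (fld V x).
  exact: ((fld_vertical pi_sub (DD a b) V).1 vV (dom_pt Dx)).
apply: contraNneq VV => V0; rewrite evs_g.
have -> : fld V (sval (dom_pt Dx)) = 0 by exact: V0.
by rewrite met0l.
Qed.

(** The vertical part of a constant field is timelike near [x] if it is so at [x]. *)
Lemma vertical_field_nbhs a x : ch_cod (atlas a) x ->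
  exists b (W : set 'rV[R]_m) (oW : open W) (WD : W `<=` crep_dom (atlas a) (atlas b) piM)
    (U0 : 'rV[smfun oW]_m),
    [/\ W x, vpS pi_sub WD U0 = U0 & forall y : pt W, evs y (gS (sub_cod WD) U0 U0) != 0].
Proof.
move=> ax; have [b /(_ ax) Dx] := base_chart a x.
have [u vu u0] := vertical_vector ax.
pose D := crep_dom (atlas a) (atlas b) piM.
have oD : open D by exact: pi_dom_open.
pose U1 := vpS pi_sub (DD a b) (cfieldS oD u).
pose q := gS (sub_cod (DD a b)) U1 U1.
have qE (y : pt D) : evs y q = met a (sval y) (vpart piM a (sval y) u) (vpart piM a (sval y) u).
  by rewrite /q evs_g !fld_vpart fld_cfield.
pose W := D `&` [set y | sapp q y != 0].
have oW : open W.
  rewrite openE => y [Dy qy].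
  have cq : {for y, continuous (sapp q)} by exact: smooth_continuous (sapp_smooth q) Dy.
  apply: filterI; first by apply: open_nbhs_nbhs.
  have n1 : nbhs (sapp q y) [set r : R | r != 0].
    by apply: open_nbhs_nbhs; split=> //; exact: open_neq.
  exact: (cq _ n1).
have WD : W `<=` D by move=> y [].
exists b, W, oW, WD, (vpS pi_sub WD (cfieldS oW u)); split.
- split=> //; suff : evs (dom_pt Dx) q != 0 by [].
  rewrite qE /= (_ : vpart piM a x u = u); first by rewrite lt_eqF // vertical_neg_at.
  rewrite /vpart (@hpart_uniq _ _ u 0) ?subr0 // => v _; exact: met0l.
- exact: vpSK.
move=> [y [Dy qy]]; rewrite evs_g !fld_vpart fld_cfield /=.
by rewrite -(qE (exist _ y Dy)).
Qed.

Hypothesis pi_umb : totally_umbilic_fibres piM (m - n).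
Variable c : R.
Hypothesis M_curv : constant_curvature M c.
Hypothesis H_neq : forall a x, ch_cod (atlas a) x -> normalized_H_sq piM (m - n) a x <> - c.
Local Notation Nv := (normalized_H piM (m - n)).
Local Notation K a := (fibre_curvature piM a c).

Lemma fibre_curvature_facts a x : ch_cod (atlas a) x ->
  [/\ differentiable (K a : 'rV[R]_m -> R^o) x, K a x != 0 &
      forall v, 'D_v (K a) x = 2 * K a x * met a x (Nv a x) v].
Proof.
move=> /vertical_field_nbhs[b [W [oW [WD [U0 [Wx vU0 U00]]]]]].
have Hn y : W y -> normalized_H_sq piM (m - n) a y <> - c by move=> /WD[ay _]; exact: H_neq.
split.
- exact: (fibre_curvature_diff pi_umb c vU0 U00 (exist _ x Wx)).
- exact: (fibre_curvature_neq0 pi_umb Hn vU0 U00 Wx).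
move=> v; exact: (fibre_curvature_derive B_riem M_index r_ge2 pi_umb M_curv Hn vU0
  U00 (exist _ x Wx) v).
Qed.

Lemma ratio_is_derive_chart a (gam : R -> 'rV[R]_m) (t : R) :
  ch_cod (atlas a) (gam t) -> derivable gam t 1 -> derivable (derive1 gam) t 1 ->
  derive1 (derive1 gam) t + christoffel_form a (gam t) (derive1 gam t) (derive1 gam t) = 0 ->
  met a (gam t) (derive1 gam t) (derive1 gam t) < 0 ->
  is_derive t (1 : R) (fun s =>
    met a (gam s) (vpart piM a (gam s) (derive1 gam s)) (vpart piM a (gam s) (derive1 gam s))
     / (K a (gam s) * met a (gam s) (derive1 gam s) (derive1 gam s)) : R^o) 0.
Proof.
move=> /vertical_field_nbhs[b [W [oW [WD [U0 [Wx vU0 U00]]]]]].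
have Hn y : W y -> normalized_H_sq piM (m - n) a y <> - c by move=> /WD[ay _]; exact: H_neq.
exact: (ratio_derive B_riem M_index r_ge2 pi_umb M_curv Hn vU0 U00 Wx).
Qed.

Lemma is_derive_ln_norm (r : R) : r != 0 -> is_derive r (1 : R) (fun s : R => ln `|s| : R^o) r^-1.
Proof.
move=> r0; have [rpos|rneg|/eqP] := ltgtP r 0; last by rewrite (negPf r0).
  have nr : 0 < - r by rewrite oppr_gt0.
  have h : is_derive r (1 : R) (fun s : R => ln (- s) : R^o) r^-1.
    have h1 : is_derive (- r) (1 : R) (@ln R) (- r)^-1 by exact: is_derive1_ln.
    have h2 : is_derive r (1 : R) (fun s : R => - s : R^o) (- 1).
      by apply: is_deriveN.
    apply: (is_derive_eq (is_derive1_comp h1 h2)).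
    by rewrite invrN mulrNN mulr1.
  apply: near_eq_is_derive h.
  have : nbhs r [set s : R | s < 0] by apply: open_nbhs_nbhs; split=> //; exact: open_lt.
  by apply: filterS => s s0; rewrite ltr0_norm.
have h : is_derive r (1 : R) (@ln R) r^-1 by exact: is_derive1_ln.
apply: near_eq_is_derive h.
have : nbhs r [set s : R | 0 < s] by apply: open_nbhs_nbhs; split=> //; exact: open_gt.
by apply: filterS => s s0; rewrite gtr0_norm.
Qed.

Lemma normalized_H_grad a x : ch_cod (atlas a) x ->
  Nv a x = 2^-1 *: grad a (fun y => ln `|c + normalized_H_sq piM (m - n) a y|) x.
Proof.
move=> ax; have [dK K0 DK] := fibre_curvature_facts ax.
have dln := is_derive_ln_norm K0.
have dl : differentiable (fun s : R => ln `|s| : R^o) (K a x).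
  by apply/derivable1_diffP; exact: (@ex_derive _ _ _ _ _ _ _ dln).
have e v : 'D_v (fun y => ln `|K a y| : R^o) x = 2 * met a x (Nv a x) v.
  have -> : (fun y => ln `|K a y| : R^o) = (fun s : R => ln `|s| : R^o) \o K a by [].
  rewrite derive_comp // DK deriveE // -[X in 'd _ _ X]mulr1 -[X in 'd _ _ X]/(_ *: 1) linearZ /=.
  rewrite -deriveE // (@derive_val _ _ _ _ _ _ _ dln) /GRing.scale /=.
  by field.
have -> : grad a (fun y => ln `|c + normalized_H_sq piM (m - n) a y|) x = 2 *: Nv a x.
  rewrite /grad -[RHS]mulmx1 -(mulmxV (gram_unit ax)) mulmxA; congr (_ *m _).
  apply/rowP => k; rewrite mxE -[LHS]/('D_(delta_mx 0 k) (fun y => ln `|K a y| : R^o) x) e.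
  by rewrite -scalemxAl mxE /met /bform trmx_delta -colE mxE.
by rewrite scalerA mulVf ?scale1r // pnatr_eq0.
Qed.

(** * Independence of the chart *)
Lemma derive2_coord p q (A : set 'rV[R]_p) (F : 'rV[R]_p -> 'rV[R]_q) (x u v : 'rV[R]_p) k :
  open A -> smooth_on A F -> A x ->
  'D_u ('D_v F) x 0 k = 'D_u ('D_v (fun y => F y 0 k : R^o)) x.
Proof.
move=> oA sF Ax; rewrite derive_coord.
  apply: near_eq_derive; apply: (nbhs_open oA Ax) => y Ay.
  by rewrite derive_coord //; exact: smooth_derivable sF Ay.
exact: smooth_derivable (smooth_derive v sF) Ax.
Qed.

Lemma schwarz_rV p q (A : set 'rV[R]_p) (F : 'rV[R]_p -> 'rV[R]_q) (x u v : 'rV[R]_p) :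
  open A -> smooth_on A F -> A x -> 'D_u ('D_v F) x = 'D_v ('D_u F) x.
Proof.
move=> oA sF Ax; apply/rowP => k.
have e := schwarz u v oA (smooth_coord 0 k oA sF) Ax.
exact: etrans (derive2_coord u v k oA sF Ax) (etrans e (esym (derive2_coord v u k oA sF Ax))).
Qed.

Lemma derive2_comp_rV p q s (A : set 'rV[R]_p) (A' : set 'rV[R]_q) (phi : 'rV[R]_p -> 'rV[R]_q)
    (h : 'rV[R]_q -> 'rV[R]_s) (x u v : 'rV[R]_p) :
  open A -> open A' -> smooth_on A phi -> smooth_on A' h -> (forall y, A y -> A' (phi y)) ->
  smooth_on A (h \o phi) -> A x ->
  'D_u ('D_v (h \o phi)) x = 'D_('D_u phi x) ('D_('D_v phi x) h) (phi x)
    + 'D_('D_u ('D_v phi) x) h (phi x).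
Proof.
move=> oA oA' sp sh AA' shp Ax; apply/rowP => k.
have e0 := derive2_coord u v k oA shp Ax.
have e1 := derive2_comp u v oA oA' sp (smooth_coord 0 k oA' sh) AA' Ax.
have e2 := derive2_coord ('D_u phi x) ('D_v phi x) k oA' sh (AA' _ Ax).
have e3 := derive_coord 0 k (smooth_derivable (v := 'D_u ('D_v phi) x) sh (AA' _ Ax)).
rewrite mxE; apply: (etrans e0); apply: (etrans e1).
exact: esym (f_equal2 +%R e2 e3).
Qed.

Lemma normalized_H_horizontal a x : ch_cod (atlas a) x -> horizontal piM a x (Nv a x).
Proof.
move=> ax; have [b [W [oW [WD [U0 [Wx vU0 U00]]]]]] := vertical_field_nbhs ax.
have e := fld_vpart pi_sub WD (exist _ x Wx) (meanS pi_umb vU0 U00).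
rewrite hor_meanS fld_mean fldE map_mx0 in e.
have -> : Nv a x = hpart piM a x (Nv a x) by apply/eqP; rewrite -subr_eq0; apply/eqP;
  exact: (esym e).
by have [] := hpart_spec_at (Nv a x) ax.
Qed.

(** The normalized mean curvature is chosen in each chart separately; its values in two
charts at the same point are compared here through the transition map [phi], whose
differential [Phi] identifies the tangent vectors. *)
Section Transition.
Variables (a a' : mf_idx M) (x : 'rV[R]_m).
Local Notation phi := (crep (atlas a) (atlas a') id).
Local Notation T := (crep_dom (atlas a) (atlas a') id).
Hypothesis Tx : T x.
Local Notation y := (phi x).
Local Notation Phi := (fun u => 'D_u phi x).

Let ax : ch_cod (atlas a) x. Proof. by case: Tx. Qed.
Let ay : ch_cod (atlas a') y. Proof. by case: Tx => _ /ch_map_cod. Qed.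
Let oT : open T. Proof. exact: trans_dom_open. Qed.
Let sphi : smooth_on T phi. Proof. exact: (@mf_smooth _ _ M a a'). Qed.
Let dphi : differentiable phi x. Proof. exact: trans_diff. Qed.

Lemma PhiB u v : Phi (u - v) = Phi u - Phi v.
Proof. by rewrite /= !deriveE // linearB. Qed.

Lemma met_trans u v : met a x u v = met a' y (Phi u) (Phi v).
Proof. exact: gram_compat. Qed.

Lemma trans_back : crep_dom (atlas a') (atlas a) id y.
Proof.
split; first exact: ay.
have a'x : ch_dom (atlas a') (ch_inv (atlas a) x) by case: Tx.
rewrite /crep /= ch_mapK //; exact: ch_inv_dom.
Qed.
Lemma crep_back : crep (atlas a') (atlas a) id y = x.
Proof.
have a'x : ch_dom (atlas a') (ch_inv (atlas a) x) by case: Tx.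
rewrite /crep /= ch_mapK //; exact: ch_invK.
Qed.

Lemma Phi_surj w : exists u, Phi u = w.
Proof.
exists ('D_w (crep (atlas a') (atlas a) id) y).
have dphi' : differentiable phi (crep (atlas a') (atlas a) id y) by rewrite crep_back.
have e0 := derive_crep_comp w (@trans_dom_open _ _ M a' a) trans_back
  (trans_diff trans_back) dphi'.
rewrite crep_back in e0; apply: (etrans (esym e0)).
have e : 'D_w (crep (atlas a') (atlas a') id) y = 'D_w id y.
  apply: near_eq_derive; apply: (nbhs_open (@ch_cod_open _ _ _ (atlas a')) ay) => z az.
  by rewrite /crep /= ch_invK.
by apply: (etrans e); rewrite derive_id.
Qed.

Lemma pi_dom_trans b : crep_dom (atlas a) (atlas b) piM x -> crep_dom (atlas a') (atlas b) piM y.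
Proof. by case: Tx => /= _ a'x [_ bx]; split=> //; rewrite /crep /= ch_mapK. Qed.

Lemma pi_derive_trans b u : crep_dom (atlas a) (atlas b) piM x ->
  'D_u (crep (atlas a) (atlas b) piM) x = 'D_(Phi u) (crep (atlas a') (atlas b) piM) y.
Proof.
move=> Dx; exact: (derive_crep_comp u oT Tx dphi (pi_crep_diff pi_sub (pi_dom_trans Dx))).
Qed.

Lemma vertical_trans u : vertical piM a x u <-> vertical piM a' y (Phi u).
Proof.
have [b /(_ ax) Dx] := base_chart a x.
by rewrite (verticalE pi_sub _ Dx) (verticalE pi_sub _ (pi_dom_trans Dx)) pi_derive_trans.
Qed.

Lemma horizontal_trans u : horizontal piM a x u -> horizontal piM a' y (Phi u).
Proof.
move=> hu w; have [w' <-] := Phi_surj w.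
by move=> /vertical_trans vw; rewrite -met_trans; exact: hu.
Qed.

Lemma vpart_trans u : vpart piM a' y (Phi u) = Phi (vpart piM a x u).
Proof.
rewrite /vpart PhiB; congr (_ - _); have [h1 v1] := hpart_spec_at u ax.
apply: hpart_uniq => //; first exact: horizontal_trans.
by rewrite -PhiB; exact/vertical_trans.
Qed.

Lemma met_nondeg u : (forall w, met a' y u w = 0) -> u = 0.
Proof.
move=> u0; rewrite -[LHS]mulmx1 -(mulmxV (gram_unit ay)) mulmxA.
suff -> : u *m gram a' y = 0 by rewrite mul0mx.
apply/rowP => i; have := u0 (delta_mx 0 i).
by rewrite /met /bform trmx_delta -colE !mxE.
Qed.

Lemma derive_gram_trans s p q :
  'D_s (fun z => bform (gram a z) p q : R^o) x =
  'D_(Phi s) (fun z => bform (gram a' z) (Phi p) (Phi q) : R^o) y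
  + met a' y ('D_s ('D_p phi) x) (Phi q) + met a' y (Phi p) ('D_s ('D_q phi) x).
Proof.
have -> : 'D_s (fun z => bform (gram a z) p q : R^o) x =
    'D_s (fun z => bform (gram a' (phi z)) ('D_p phi z) ('D_q phi z) : R^o) x.
  by apply: near_eq_derive; apply: (nbhs_open oT Tx) => z Tz; exact: gram_compat.
have dG : differentiable (gram a') y.
  exact: (smooth_differentiable_mx (@ch_cod_open _ _ _ (atlas a')) (@gram_smooth _ _ M a') ay).
have d1 : is_derive x s (fun z => gram a' (phi z)) ('D_(Phi s) (gram a') y).
  apply: DeriveDef; first by apply: diff_derivable; exact: differentiable_comp dphi dG.
  exact: (derive_comp s dphi dG).
have d2 r : is_derive x s ('D_r phi) ('D_s ('D_r phi) x).
  apply: derivableP; exact: smooth_derivable (smooth_derive r sphi) Tx.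
have e := derive_bform (Phi p) (Phi q) (diff_derivable (v := Phi s) dG).
apply: (etrans (@derive_val _ _ _ _ _ _ _ (is_derive_bform d1 (d2 p) (d2 q)))).
exact: (f_equal (fun r => r + _ + _) (esym e)).
Qed.

Lemma koszul_at (a0 : mf_idx M) z u w : ch_cod (atlas a0) z ->
  2 * met a0 z (christoffel_form a0 z u u) w =
  2 * 'D_u (fun y0 => bform (gram a0 y0) u w : R^o) z
  - 'D_w (fun y0 => bform (gram a0 y0) u u : R^o) z.
Proof.
have [b hb] := base_chart a0 z => /hb Dx.
exact: (christoffel_koszul (pi_dom_open pi_sub (a := a0) (b := b)) (DD a0 b) (dom_pt Dx)).
Qed.

(** The transformation law of the Christoffel symbols, on the diagonal. It follows from
Koszul's formula in both charts and the derivative of the compatibility of the metrics,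
the second derivatives of [phi] being symmetric. *)
Lemma christoffel_trans u : Phi (christoffel_form a x u u) =
  'D_u ('D_u phi) x + christoffel_form a' y (Phi u) (Phi u).
Proof.
apply/eqP; rewrite -subr_eq0; apply/eqP/met_nondeg => w'; have [w <-] := Phi_surj w'.
rewrite -scaleN1r metDl metZl metDl -met_trans.
have e1 := koszul_at u w ax; have e2 := koszul_at (Phi u) (Phi w) ay.
rewrite !derive_gram_trans in e1.
rewrite (schwarz_rV w u oT sphi Tx) (met_sym (Phi u) ('D_u ('D_w phi) x) ay) in e1.
have two0 : (2 : R) != 0 by rewrite pnatr_eq0.
apply: (mulfI two0); rewrite mulr0.
have lin (p q r s t t' : R) : 2 * p = 2 * (q + r + s) - (t + s + s) -> 2 * t' = 2 * q - t ->
   2 * (p + -1 * (r + t')) = 0.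
  move=> h1 h2; have -> : 2 * (p + -1 * (r + t')) = 2 * p - 2 * r - 2 * t' by ring.
  by rewrite h1 h2; ring.
exact: (lin _ _ _ _ _ _ e1 e2).
Qed.

(** Apply [mean_hessian] in both charts to a vertical vector [u] with nonzero square. The
second derivatives of [phi] in the Hessian and in the Christoffel symbols cancel, so the
two vectors have the same projection to the base; both are horizontal. *)
Lemma normalized_H_trans : Nv a' y = Phi (Nv a x).
Proof.
have [b /(_ ax) Dx] := base_chart a x; have Dy := pi_dom_trans Dx.
pose f := crep (atlas a) (atlas b) piM; pose f' := crep (atlas a') (atlas b) piM.
pose A := T `&` crep_dom (atlas a) (atlas b) piM.
have oA : open A by apply: openI => //; exact: pi_dom_open.
have Ax : A x by split.
have AA' z : A z -> crep_dom (atlas a') (atlas b) piM (phi z).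
  case=> -[az a'z] [_ bz]; split; first exact: ch_map_cod.
  by rewrite /crep /= ch_mapK.
have ff z : A z -> f z = (f' \o phi) z.
  by case=> -[az a'z] _; rewrite /f /f' /crep /= ch_mapK.
have sphiA : smooth_on A phi by apply: (@smooth_sub _ _ _ T A _ _ sphi) => z [].
have sf' := @pi_crep_smooth _ _ _ _ _ _ pi_sub a' b.
have sfp : smooth_on A (f' \o phi).
  apply: (smooth_ext oA ff).
  by apply: (@smooth_sub _ _ _ _ A _ _ (@pi_crep_smooth _ _ _ _ _ _ pi_sub a b)) => z [].
have [u vu u0] := vertical_vector ax.
have h1 := mean_hessian pi_sub (pi_dom_open pi_sub (a := a) (b := b)) (DD a b)
  pi_umb (x := dom_pt Dx) vu.
have h2 := mean_hessian pi_sub (pi_dom_open pi_sub (a := a') (b := b)) (DD a' b)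
  pi_umb (x := dom_pt Dy)
  ((vertical_trans u).1 vu).
have e2 : 'D_u ('D_u f) x = 'D_u ('D_u (f' \o phi)) x.
  apply: near_eq_derive; apply: (nbhs_open oA Ax) => z Az.
  by apply: near_eq_derive; apply: (nbhs_open oA Az) => z' Az'; exact: ff.
have e3 := etrans e2 (derive2_comp_rV u u oA (pi_dom_open pi_sub (a := a') (b := b)) sphiA
  sf' AA' sfp Ax).
have df' : differentiable f' y by exact: pi_crep_diff.
have dE p : 'D_p f' y = 'd f' y p := deriveE p df'.
have lin p q : 'D_(p + q) f' y = 'D_p f' y + 'D_q f' y.
  exact: (etrans (dE _) (etrans (linearD _ _ _) (esym (f_equal2 +%R (dE p) (dE q))))).
have linB p q : 'D_(p - q) f' y = 'D_p f' y - 'D_q f' y.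
  have e := f_equal2 (fun s t => s - t) (dE p) (dE q).
  exact: (etrans (dE _) (etrans (linearB _ _ _) (esym e))).
have e4 : 'D_(Phi (christoffel_form a x u u)) f' y =
   'D_('D_u ('D_u phi) x) f' y + 'D_(christoffel_form a' y (Phi u) (Phi u)) f' y.
  by rewrite christoffel_trans; exact: lin.
have cancel (p q s : 'rV[R]_n) : p + q - (s + p) = q - s.
  by apply/eqP; rewrite subr_eq addrA subrK addrC.
have e5 : 'D_(Phi (Nv a x)) f' y = 'D_(Nv a' y) f' y.
  have n0 := negbT (lt_eqF (vertical_neg_at ax vu u0)).
  apply: (scalerI n0).
  apply: etrans (etrans (esym h2) (f_equal (fun r => r *: _) (esym (met_trans u u)))).
  apply: (etrans (f_equal (fun z => met a x u u *: z) (esym (pi_derive_trans (Nv a x) Dx)))).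
  apply: (etrans h1).
  apply: (etrans (f_equal2 (fun p q => p - q) (etrans (pi_derive_trans _ Dx) e4) e3)).
  exact: cancel.
apply/eqP; rewrite eq_sym -subr_eq0; apply/eqP; apply: (sub_nondeg pi_sub ay) => [|w vw].
  apply/(verticalE pi_sub _ Dy); apply: (etrans (linB _ _)).
  exact: (etrans (f_equal (fun z => z - _) e5) (subrr _)).
rewrite -scaleN1r metDl metZl (normalized_H_horizontal ay vw).
by rewrite (horizontal_trans (normalized_H_horizontal ax) vw) mulr0 addr0.
Qed.

Lemma fibre_curvature_trans : K a' y = K a x.
Proof. by rewrite /fibre_curvature /normalized_H_sq normalized_H_trans -met_trans. Qed.
End Transition.

(** * The Clairaut relation *)
Lemma exists_cosh (C : R) : 1 <= C -> exists2 phi : R, 0 <= phi & cosh phi = C.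
Proof.
move=> C1; have C0 : 0 < C by exact: lt_le_trans C1.
have C2 : 0 <= C ^+ 2 - 1 by rewrite subr_ge0 exprn_ege1.
pose s := Num.sqrt (C ^+ 2 - 1); pose z := C + s.
have s2 : s ^+ 2 = C ^+ 2 - 1 by rewrite sqr_sqrtr.
have z1 : 1 <= z by rewrite (le_trans C1) // lerDl sqrtr_ge0.
have z0 : 0 < z by exact: lt_le_trans z1.
exists (ln z); first exact: ln_ge0.
rewrite /cosh expRN (lnK z0).
have zi : z^-1 = C - s.
  apply: (mulfI (lt0r_neq0 z0)); rewrite divff ?lt0r_neq0 // /z.
  have -> : (C + s) * (C - s) = C ^+ 2 - s ^+ 2 by ring.
  by rewrite s2; ring.
by rewrite zi /z; field.
Qed.

(** The horizontal part of [v] is spacelike, so its vertical part is at least as long as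
[v] and the quotient is the hyperbolic cosine of an angle. *)
Lemma cosh_hangle a x v : ch_cod (atlas a) x -> met a x v v < 0 ->
  cosh (hangle piM a x v) = Num.sqrt
    (met a x (vpart piM a x v) (vpart piM a x v) / met a x v v).
Proof.
move=> ax v0; have [hv vv] := hpart_spec_at v ax.
pose w := vpart piM a x v.
have vw : vertical piM a x w by exact: vv.
have pE : met a x v w = met a x w w by rewrite -(met_vpart_at v v ax).
have hw : met a x (hpart piM a x v) w = 0 by exact: hv.
have qE : met a x v v = met a x (hpart piM a x v) (hpart piM a x v) + met a x w w.
  have gen h k : met a x h k = 0 -> met a x (h + k) (h + k) = met a x h h + met a x k k.
    by move=> hk; rewrite metDl !metDr (met_sym k h ax) hk; ring.
  have {1 2}-> : v = hpart piM a x v + w by rewrite /w /vpart addrC subrK.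
  exact: gen.
have h0 := horizontal_ge0_at ax hv.
have pq : met a x w w <= met a x v v by rewrite qE lerDr.
set p := met a x w w in pE qE pq *; set q := met a x v v in v0 qE pq *.
have p0 : p < 0 by exact: le_lt_trans v0.
have np0 : 0 < - p by rewrite oppr_gt0.
have nq0 : 0 < - q by rewrite oppr_gt0.
have sp0 : 0 < Num.sqrt (- p) by rewrite sqrtr_gt0.
have sq0 : 0 < Num.sqrt (- q) by rewrite sqrtr_gt0.
have rE : Num.sqrt (p / q) = Num.sqrt (- p) / Num.sqrt (- q).
  by rewrite -[p / q]mulrNN -invrN sqrtrM ?ltW // sqrtrV ?ltW.
have sp2 : Num.sqrt (- p) * Num.sqrt (- p) = - p by rewrite -expr2 sqr_sqrtr ?ltW.
have cfieldS : Num.sqrt (- q) * Num.sqrt (- p) * (Num.sqrt (- p) / Num.sqrt (- q)) = - p.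
  by rewrite -[RHS]sp2; field; rewrite gt_eqF.
have phi_ex : exists phi, 0 <= phi /\
    met a x v w = - (tnorm a x v * tnorm a x w * cosh phi).
  have [|phi phi0 phiE] := @exists_cosh (Num.sqrt (p / q)).
    by rewrite rE ler_pdivlMr // mul1r; apply: ler_wsqrtr; rewrite lerN2.
  by exists phi; split=> //; rewrite phiE rE pE /tnorm -/p -/q cfieldS opprK.
have := xgetPex 0 phi_ex; rewrite -/(hangle piM a x v) => -[_].
rewrite pE /tnorm -/p -/q => e; rewrite rE.
have n1 : Num.sqrt (- q) * Num.sqrt (- p) != 0 by rewrite mulf_neq0 // gt_eqF.
apply: (mulfI n1); apply: oppr_inj; rewrite -e.
by rewrite cfieldS opprK.
Qed.

Definition chart_at (p : M) : mf_idx M := sval (cid (mf_cover p)).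
Lemma chart_atP p : ch_dom (atlas (chart_at p)) p.
Proof. exact: (svalP (cid (mf_cover p))). Qed.

Definition fibre_curvature_pt (p : M) : R := K (chart_at p) (ch_map (atlas (chart_at p)) p).

Lemma fibre_curvature_pt_chart a p : ch_dom (atlas a) p ->
  fibre_curvature_pt p = K a (ch_map (atlas a) p).
Proof.
move=> ap; have T : crep_dom (atlas a) (atlas (chart_at p)) id (ch_map (atlas a) p).
  by split; [exact: ch_map_cod | rewrite /= ch_mapK //; exact: chart_atP].
rewrite -(fibre_curvature_trans T) /fibre_curvature_pt /crep /= ch_mapK //.
Qed.

Section Geodesic.
Variables (I : set R) (gam : R -> M).
Hypothesis gam_geo : geodesic I gam.
Hypothesis gam_time : timelike I gam.

Lemma gam_nbhs a t : I t -> ch_dom (atlas a) (gam t) ->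
  nbhs t [set s | I s /\ ch_dom (atlas a) (gam s)].
Proof.
case: gam_geo => oI _ cg _ It at_; apply: filterI; first exact: open_nbhs_nbhs.
apply: (cg _ It); apply: open_nbhs_nbhs; split=> //; exact: ch_dom_open.
Qed.

Lemma curve_derivable a t : I t -> ch_dom (atlas a) (gam t) ->
  derivable (curve_in a gam) t 1 /\ derivable (velocity a gam) t 1.
Proof.
case: gam_geo => _ _ _ /(_ a)[sg _] It at_.
have [_ /(_ 1)[d1 [_ /(_ 1)[d2 _]]]] := sg 2%N.
split; first by apply: d1; split.
have -> : velocity a gam = 'D_1 (curve_in a gam) by apply: funext => s; exact: derive1E.
by apply: d2; split.
Qed.

(** The square of the Clairaut invariant up to sign, as a function that can be
differentiated in a chart. *)
Definition clairaut_ratio a t : R :=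
  met a (curve_in a gam t) (vpart piM a (curve_in a gam t) (velocity a gam t))
    (vpart piM a (curve_in a gam t) (velocity a gam t)) /
  (K a (curve_in a gam t) * met a (curve_in a gam t) (velocity a gam t) (velocity a gam t)).

Lemma ratio_chart a a' t : I t -> ch_dom (atlas a) (gam t) -> ch_dom (atlas a') (gam t) ->
  clairaut_ratio a' t = clairaut_ratio a t.
Proof.
move=> It at_ a't.
pose x := curve_in a gam t; pose phi := crep (atlas a) (atlas a') id.
have T : crep_dom (atlas a) (atlas a') id x.
  by split; [exact: ch_map_cod | rewrite /x /curve_in /= ch_mapK].
have yE : curve_in a' gam t = phi x by rewrite /phi /crep /x /curve_in /= ch_mapK.
have dphi : differentiable phi x by exact: trans_diff.
have [dg _] := curve_derivable It at_.
have vE : velocity a' gam t = 'D_(velocity a gam t) phi x.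
  have hg : is_derive t (1 : R) (curve_in a gam) (velocity a gam t).
    by apply: DeriveDef => //; rewrite /velocity derive1E.
  have h := is_derive_comp_curve dphi hg.
  rewrite {1}/velocity derive1E; apply: etrans (@derive_val _ _ _ _ _ _ _ h).
  apply: near_eq_derive; apply: filterS (gam_nbhs It at_) => s [_ as_].
  by rewrite /phi /crep /curve_in /= ch_mapK.
rewrite /clairaut_ratio yE vE -/x (vpart_trans T) -!(met_trans T) (fibre_curvature_trans T) //.
Qed.

Lemma ratio_is_derive t : I t ->
  is_derive t (1 : R) (fun s => clairaut_ratio (chart_at (gam s)) s : R^o) 0.
Proof.
move=> It; pose a := chart_at (gam t).
have at_ : ch_dom (atlas a) (gam t) by exact: chart_atP.
have [dg dv] := curve_derivable It at_.
have h : is_derive t (1 : R) (fun s => clairaut_ratio a s : R^o) 0.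
  apply: ratio_is_derive_chart => //; first exact: ch_map_cod.
  - by case: gam_geo => _ _ _ /(_ a)[_]; apply; split.
  - exact: gam_time.
apply: near_eq_is_derive h; apply: filterS (gam_nbhs It at_) => s [Is as_].
by apply: ratio_chart => //; exact: chart_atP.
Qed.

(** The chart at each time depends on the time; by [ratio_chart] the ratio does not
notice, so its derivative vanishes throughout the interval. *)
Lemma ratio_cst s t : I s -> I t ->
  clairaut_ratio (chart_at (gam s)) s = clairaut_ratio (chart_at (gam t)) t.
Proof.
pose rho s := clairaut_ratio (chart_at (gam s)) s; rewrite -/(rho s) -/(rho t).
wlog : s t / s <= t => [hw Is It|].
  by have [st|/ltW ts] := leP s t; [exact: hw | apply: esym; exact: hw].
rewrite le_eqVlt => /orP[/eqP -> //|st] Is It.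
have II z : z \in `[s, t] -> I z.
  by case: gam_geo => _ iI _ _; rewrite in_itv /= => hz; exact: (iI s t).
have [||z _ e] := @MVT R rho (fun=> 0) s t st.
- by move=> z /subset_itv_oo_cc hz; exact: (ratio_is_derive (II _ hz)).
- apply: derivable_within_continuous => z hz.
  exact: (@ex_derive _ _ _ _ _ _ _ (ratio_is_derive (II _ hz))).
by apply/esym/eqP; rewrite -subr_eq0 e mul0r.
Qed.

Lemma clairaut_value t a : I t -> ch_dom (atlas a) (gam t) ->
  (Num.sqrt `|fibre_curvature_pt (gam t)|)^-1 * cosh (hangle piM a (curve_in a gam t)
    (velocity a gam t)) =
  Num.sqrt `|clairaut_ratio (chart_at (gam t)) t|.
Proof.
move=> It at_; rewrite (ratio_chart It at_ (chart_atP _)) (fibre_curvature_pt_chart at_).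
have ax : ch_cod (atlas a) (curve_in a gam t) by exact: ch_map_cod.
have v0 := gam_time It at_.
rewrite cosh_hangle // /clairaut_ratio.
have [_ K0 _] := fibre_curvature_facts ax; rewrite -/(curve_in a gam t).
set p := met _ _ (vpart _ _ _ _) _; set q := met _ _ _ _ in v0 *.
set k := K a _ in K0 *.
have pq0 : 0 <= p / q.
  rewrite -[p / q]mulrNN -invrN; apply: divr_ge0; rewrite oppr_ge0; last exact: ltW.
  have [_ vv] := hpart_spec_at (velocity a gam t) ax.
  have [w0|w0] := eqVneq (vpart piM a (curve_in a gam t) (velocity a gam t)) 0.
    by rewrite /p w0 met0l.
  exact: ltW (vertical_neg_at ax vv w0).
rewrite -sqrtrV ?normr_ge0 // -sqrtrM ?invr_ge0 ?normr_ge0 //; congr (Num.sqrt _).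
rewrite -[p / q]ger0_norm // -normfV -normrM; congr `|_|.
by rewrite invfM; ring.
Qed.
End Geodesic.

Lemma umbilic_clairaut : clairaut piM.
Proof.
exists (fun p => (Num.sqrt `|fibre_curvature_pt p|)^-1); split=> [p|I gam geo tl].
  rewrite invr_gt0 sqrtr_gt0 normr_gt0.
  by have [] := fibre_curvature_facts (ch_map_cod (chart_atP p)).
have [[t0 It0]|no] := pselect (exists t, I t); last first.
  by exists 0 => t a It; case: no; exists t.
exists (Num.sqrt `|clairaut_ratio gam (chart_at (gam t0)) t0|) => t a It at_.
by rewrite (clairaut_value geo tl It at_) (ratio_cst geo tl It It0).
Qed.
End Global.

(** * The theorem *)

Theorem corollary3p20 (R : realType) (m n r : nat)
    (M : semiRiemannian R m) (B : semiRiemannian R n) (piM : M -> B) (c : R)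
    (r_def : r = (m - n)%N) (r_ge2 : (2 <= r)%N)
    (B_riem : riemannian B)
    (M_index : sr_index M = r)
    (M_curv : constant_curvature M c)
    (pi_sub : semiRiemannian_submersion piM)
    (pi_conn : connected_fibres piM)
    (pi_umb : totally_umbilic_fibres piM r)
    (H_neq : forall (a : mf_idx M) (x : 'rV[R]_m), ch_cod (atlas a) x ->
       normalized_H_sq piM r a x <> - c) :
  (forall (a : mf_idx M) (x : 'rV[R]_m), ch_cod (atlas a) x ->
     normalized_H piM r a x =
       2^-1 *: grad a (fun y => ln `|c + normalized_H_sq piM r a y|) x)
  /\ clairaut piM.
Proof.
subst r; split.
  exact: (normalized_H_grad pi_sub B_riem M_index r_ge2 pi_umb M_curv H_neq).
exact: (umbilic_clairaut pi_sub B_riem M_index r_ge2 pi_umb M_curv H_neq).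
Qed.
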